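(* Let $L$ be a positive-definite even lattice of rank $l$, let $H=\mathbf{C}\otimes L$, and let $h\in H$. Then the quadruple $V_{L,h}=(V_L,Y,\mathbf{1},\omega_h)$, where $\omega_h=\omega_L+h(-2)\mathbf 1$, is a $\mathbf{C}$-graded vertex operator algebra with central charge $$c_h=l-12(h,h).$$ If $h\in H_k$ for an additive subgroup $k\subseteq\mathbf{C}$, then $V_{L,h}$ is $k$-graded. In particular, if $h\in L^o$ then $V_{L,h}$ is a vertex operator algebra.
   Context: Lattice notation. $(\ ,\ ):L\times L\to\mathbf Z$ is the inner product of $L$, extended $\mathbf C$-linearly to $H$. The dual lattice is $L^o=\{f\in\mathbf{R}\otimes L\mid (f,\alpha)\in\mathbf Z\text{ for all }\alpha\in L\}$. For a (nonzero) additive subgroup $k\subseteq\mathbf C$, set $H_k=k\otimes L^o\subseteq H$. $(V_L,Y,\mathbf 1,\omega_L)$ is the usual lattice vertex operator algebra, of central charge $l$, with Fock space $V_L=M(1)\otimes\mathbf C[L]$, where $M(1)$ is the Fock space of the free bosonic (Heisenberg) vertex operator algebra based on $H$ and $\mathbf C[L]$ is the group algebra of $L$. $H$ is regarded as a subspace of $(V_L)_1$ via $h\mapsto h(-1)\mathbf 1$, and $Y(h,z)=\sum_n h(n)z^{-n-1}$. $V_{L,h}$ has the same Fock space, fields $Y$ and vacuum as $V_L$, and only the Virasoro element (hence the conformal structure and grading) is changed. Definition. A $\mathbf C$-graded vertex operator algebra is a quadruple $(V,Y,\mathbf 1,\omega)$ with $V=\bigoplus_{r\in\mathbf C}V_r$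 a $\mathbf C$-graded complex linear space, $Y:V\to(\mathrm{End}\,V)[[z,z^{-1}]]$, $v\mapsto Y(v,z)=\sum_{n\in\mathbf Z}v_nz^{-n-1}$ a linear map (one also writes $v(n)$ for $v_n$), and $\mathbf 1,\omega\in V$, such that: (a) for $u,v\in V$, $u_nv=0$ for $n$ sufficiently large; (b) each $V_r$ is finite-dimensional, and the implication $V_r\neq0\Rightarrow \mathrm{Re}(r)\geq|\mathrm{Im}(r)|$ holds for all but finitely many $r$; (c) for $u,v\in V$ there is a nonnegative integer $n$ with $(z_1-z_2)^n[Y(u,z_1),Y(v,z_2)]=0$; (d) $Y(v,z)\mathbf 1=v+\sum_{n<-1}v(n)\mathbf 1z^{-n-1}$ for $v\in V$; (e) writing $Y(\omega,z)=\sum L(n)z^{-n-2}$, there is $c\in\mathbf C$ (the central charge) with $[L(m),L(n)]=(m-n)L(m+n)+\frac{m^3-m}{12}\delta_{m,-n}c\,\mathrm{Id}$; moreover $\frac{d}{dz}Y(v,z)=Y(L(-1)v,z)$ for $v\in V$, and $L(0)$ is a semisimple operator with $V_r=\{v\in V\mid L(0)v=rv\}$. For an additive subgroup $k\subseteq\mathbf C$, $V$ is $k$-graded if it is a $\mathbf C$-graded vertex operator algebra and $V_r\neq0\Rightarrow r\in k$. A $\mathbf Z$-graded one is a vertex operator algebra in the usual sense.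
   Formalization: The k-graded clause additionally assumes 1 ∈ k; for rank l ≥ 1 this is necessary, since b(−1)1 always has weight 1 (e.g. h = 0, k = 2Z is a counterexample to the literal claim). *)

(* Defs.v *)
From mathcomp Require Import all_boot all_order all_algebra.
From mathcomp Require Import finmap multiset.
From mathcomp Require Import boolp classical_sets fsbigop reals.
From mathcomp Require Import complex.
From mathcomp Require Export monalg.

Set Implicit Arguments.
Unset Strict Implicit.
Unset Printing Implicit Defensive.

Import Order.TTheory GRing.Theory Num.Theory.

Local Open Scope classical_set_scope.
Local Open Scope ring_scope.

(** ** Graded vertex operator algebras *)

Section VertexOperatorAlgebra.
Context {R : realType} {V : lmodType R[i]}.
Implicit Types (Y : V -> int -> V -> V) (vac omega u v w : V) (c r : R[i]).
Implicit Types (k : set R[i]).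

(* The state-field map is given by its modes: [Y v n] is the operator v_n
   in Y(v,z) = \sum_n v_n z^(-n-1). *)

Definition state_field_linear Y : Prop :=
  (forall v n, linear (Y v n)) /\ (forall n w, linear (fun v => Y v n w)).

(* Y(omega,z) = \sum_n L(n) z^(-n-2), hence L(n) = omega_(n+1). *)
Definition vir Y omega (n : int) : V -> V := Y omega (n + 1).

Definition weight_space Y omega r : set V :=
  [set v | vir Y omega 0 v = r *: v].

Definition direct_sum (W : R[i] -> set V) : Prop :=
  (forall v, exists (s : seq R[i]) (f : R[i] -> V),
     (forall r, W r (f r)) /\ v = \sum_(r <- s) f r) /\
  (forall (s : seq R[i]) (f : R[i] -> V), uniq s -> (forall r, W r (f r)) ->
     \sum_(r <- s) f r = 0 -> forall r, r \in s -> f r = 0).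

Definition finite_dimensional (W : set V) : Prop :=
  exists e : seq V, forall v, W v ->
    exists a : nat -> R[i], v = \sum_(i < size e) a i *: e`_i.

Definition truncation Y : Prop :=
  forall u v, exists N : int, forall n : int, N <= n -> Y u n v = 0.

(* Coefficient of z1^(-p-1) z2^(-q-1) in (z1 - z2)^n [Y(u,z1), Y(v,z2)]. *)
Definition locality Y : Prop :=
  forall u v, exists n : nat, forall (p q : int) w,
    \sum_(i < n.+1) ((-1) ^+ i * 'C(n, i)%:R : R[i]) *:
      (Y u (p + n%:Z - i%:Z) (Y v (q + i%:Z) w)
       - Y v (q + i%:Z) (Y u (p + n%:Z - i%:Z) w)) = 0.

Definition creation Y vac : Prop :=
  forall v, Y v (- 1) vac = v /\ forall n : int, 0 <= n -> Y v n vac = 0.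

Definition virasoro Y omega c : Prop :=
  forall (m n : int) v,
    vir Y omega m (vir Y omega n v) - vir Y omega n (vir Y omega m v)
    = (m - n)%:~R *: vir Y omega (m + n) v
      + (if m == - n then (m ^+ 3 - m)%:~R / 12%:R * c else 0) *: v.

(* d/dz Y(v,z) = Y(L(-1)v,z), at z^(-n-1). *)
Definition translation Y omega : Prop :=
  forall v n w, Y (vir Y omega (- 1) v) n w = - n%:~R *: Y v (n - 1) w.

Definition finite_weight_spaces Y omega : Prop :=
  (forall r, finite_dimensional (weight_space Y omega r)) /\
  exists s : seq R[i], forall r, r \notin s ->
    (exists2 v, weight_space Y omega r v & v <> 0) ->
    `|complex.Im r| <= complex.Re r.

(* The grading is not a separate datum: V_r is the r-eigenspace of L(0), and
   semisimplicity of L(0) is the decomposition of V as the direct sum of the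
   V_r. *)
Record graded_voa Y vac omega c : Prop := GradedVOA {
  graded_voa_linear : state_field_linear Y;
  graded_voa_direct_sum : direct_sum (weight_space Y omega);
  graded_voa_truncation : truncation Y;
  graded_voa_finite : finite_weight_spaces Y omega;
  graded_voa_locality : locality Y;
  graded_voa_creation : creation Y vac;
  graded_voa_virasoro : virasoro Y omega c;
  graded_voa_translation : translation Y omega }.

Definition k_graded_voa k Y vac omega c : Prop :=
  graded_voa Y vac omega c /\
  forall r, (exists2 v, weight_space Y omega r v & v <> 0) -> k r.

Definition voa Y vac omega c : Prop :=
  k_graded_voa (range (fun m : int => m%:~R)) Y vac omega c.

End VertexOperatorAlgebra.

Definition additive_subgroup (A : zmodType) (k : set A) : Prop :=
  k 0 /\ forall x y, k x -> k y -> k (x - y).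

(** ** Even lattices *)

(* A positive-definite even lattice with a chosen Z-basis: L = Z^l, with inner
   product given by the Gram matrix.  For F = R, C, row vectors of length l
   over F are the elements of F (x) L in the same basis. *)
Record even_lattice (l : nat) := EvenLattice {
  gram : 'M[int]_l;
  gram_sym : gram^T = gram;
  gram_even : forall a : 'rV[int]_l, (2 %| (a *m gram *m a^T) ord0 ord0)%Z;
  gram_pos : forall a : 'rV[int]_l, a != 0 -> 0 < (a *m gram *m a^T) 0 0 }.

Section Lattice.
Context {l : nat} (L : even_lattice l).

Definition ip (a b : 'rV[int]_l) : int := (a *m gram L *m b^T) 0 0.

Definition gramF (F : nzRingType) : 'M[F]_l := map_mx intr (gram L).

Definition ipF (F : nzRingType) (x y : 'rV[F]_l) : F :=
  (x *m gramF F *m y^T) 0 0.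

Definition latF (F : nzRingType) (a : 'rV[int]_l) : 'rV[F]_l := map_mx intr a.

(* A normalized 2-cocycle L x L -> {1, -1} with commutator (-1)^(a,b), defining
   the central extension of L that enters the construction of V_L. *)
Definition lattice_cocycle (eps : 'rV[int]_l -> 'rV[int]_l -> int) : Prop :=
  [/\ forall a b, eps a b = 1 \/ eps a b = - 1,
      forall a, eps a 0 = 1 /\ eps 0 a = 1,
      forall a b c, eps a b * eps (a + b) c = eps b c * eps a (b + c)
    & forall a b, eps a b = (-1) ^+ `|ip a b|%N * eps b a].

Context {R : realType}.

(* The dual lattice L^o, as a subset of R (x) L. *)
Definition dual_lattice : set 'rV[R]_l :=
  [set f | forall a : 'rV[int]_l, exists m : int, ipF f (latF R a) = m%:~R].

Definition complexify (f : 'rV[R]_l) : 'rV[R[i]]_l :=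
  map_mx (real_complex R) f.

(* The image H_k of k (x) L^o in H = C (x) L. *)
Definition H_k (k : set R[i]) : set 'rV[R[i]]_l :=
  [set h | exists (n : nat) (a : 'I_n -> R[i]) (f : 'I_n -> 'rV[R]_l),
    (forall j, k (a j) /\ dual_lattice (f j)) /\
    h = \sum_(j < n) a j *: complexify (f j)].

End Lattice.

Lemma lattice_cocycle_exists (l : nat) (L : even_lattice l) :
  exists eps, lattice_cocycle L eps.
Proof.
pose T : 'M[int]_l := \matrix_(i, j) if (j < i)%N then gram L i j else 0.
pose B (a b : 'rV[int]_l) : int := (a *m T *m b^T) 0 0.
have m1u : (-1 : int) \is a GRing.unit by [].
have BDl a b c : B (a + b) c = B a c + B b c by rewrite /B !mulmxDl mxE.
have BDr a b c : B c (a + b) = B c a + B c b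
  by rewrite /B linearD mulmxDr mxE.
have B0r a : B a 0 = 0 by rewrite /B trmx0 mulmx0 mxE.
have B0l a : B 0 a = 0 by rewrite /B !mul0mx mxE.
have sgnC (x : int) : (-1 : int) ^+ `|x|%N = (-1) ^ x.
  by case: x => n //=; rewrite NegzE abszN /= -exprnN -signr_odd; case: odd.
have evenE (x : int) : (2 %| x)%Z -> (-1 : int) ^ x = 1.
  by move=> /dvdzP[y ->]; rewrite mulrC -exprz_exp exp1rz.
have diag_even i : (2 %| gram L i i)%Z.
  have := gram_even L (delta_mx 0 i); rewrite -rowE trmx_delta.
  by rewrite -colE !mxE.
exists (fun a b => (-1) ^ B a b); split=> [a b|a|a b c|a b].
- by rewrite -sgnC -signr_odd; case: odd; [right|left].
- by rewrite B0r B0l.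
- by rewrite -!exprzDr // BDl BDr; rewrite addrA [in RHS]addrC.
- rewrite sgnC -exprzDr //.
  have GE : gram L = T + T^T + \matrix_(i, j) (if i == j then gram L i i else 0).
    apply/matrixP => i j; rewrite !mxE -val_eqE /=.
    have sG : gram L j i = gram L i j by rewrite -[in RHS](gram_sym L) mxE.
    case: ltngtP => [||/val_inj ->]; rewrite ?addr0 ?add0r //.
  have ipE : ip L a b = B a b + B b a
      + \sum_i a 0 i * gram L i i * b 0 i.
    have BT : (a *m T^T *m b^T) 0 0 = B b a.
      rewrite /B -[a in LHS]trmxK -trmx_mul -trmx_mul mxE mulmxA.
      by [].
    rewrite /ip [in LHS]GE !mulmxDr !mulmxDl.
    set D := a *m \matrix_(i, j) _ *m _.
    rewrite 2!mxE BT -/(B a b); congr (_ + _).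
    rewrite mxE; apply: eq_bigr => i _; rewrite !mxE (bigD1 i) //= mxE eqxx.
    by rewrite big1 ?addr0 // => j ji; rewrite mxE (negbTE ji) mulr0.
  rewrite ipE.
  set S := \sum_i _; have -> : B a b + B b a + S + B b a = B a b + (B b a *+ 2 + S).
    by rewrite mulr2n addrAC !addrA.
  rewrite exprzDr // (evenE (_ + S)) ?mulr1 //; apply: rpredD.
    by apply/dvdzP; exists (B b a); rewrite -mulrzz.
  by apply: rpred_sum => i _; apply: dvdz_mulr; apply: dvdz_mull.
Qed.

(** ** The lattice vertex operator algebra *)

Section LatticeVOA.
Context {l : nat} (L : even_lattice l) (R : realType).
Local Notation C := R[i].
Local Notation H := 'rV[C]_l.

(* M(1) is the polynomial algebra in the b_i(-n-1), for n : nat and b_i the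
   basis of L; the pair (i, n) stands for b_i(-n-1), and a multiset of such pairs
   for a monomial applied to the vacuum.  The pair (m, a) is the basis vector
   m (x) e^a of V_L = M(1) (x) C[L]. *)
Definition monomial : choiceType := {mset 'I_l * nat}%mset.

Definition fock_basis : choiceType := (monomial * 'rV[int]_l)%type.

Definition V_ : lmodType C := {malg C[fock_basis]}.

Definition ket (m : monomial) (a : 'rV[int]_l) : V_ :=
  << ((m, a) : fock_basis) >>.

Definition lin_ext (f : fock_basis -> V_) (v : V_) : V_ :=
  \sum_(b <- msupp (v : {malg C[fock_basis]})) mcoeff b v *: f b.

Definition bas (i : 'I_l) : H := delta_mx 0 i.

(* The Heisenberg operators h(n): multiplication by h(n) for n < 0, the
   scalar (h,a) on M(1) (x) e^a for n = 0, and for n > 0 the derivation with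
   b_j(-n) |-> n (h,b_j), killing b_j(-m) for m <> n. *)
Definition heis (h : H) (n : int) : V_ -> V_ :=
  lin_ext (fun b => let: (m, a) := b in
    match n with
    | Negz k => \sum_(j < l) h 0 j *: ket ((j, k) +` m)%mset a
    | Posz 0 => ipF L h (latF C a) *: ket m a
    | Posz k.+1 => \sum_(j < l)
        (k.+1%:R * ipF L h (bas j) * (m (j, k))%:R) *: ket (m `\ (j, k))%mset a
    end).

(* [exp_coef A k] is the coefficient of z^k in exp(\sum_(n > 0) A n z^n). *)
Fixpoint series_pow (A : nat -> V_ -> V_) (j k : nat) : V_ -> V_ :=
  match j with
  | 0 => fun w => if k == 0%N then w else 0
  | j'.+1 => fun w => \sum_(1 <= n < k.+1) A n (series_pow A j' (k - n) w)
  end.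

Definition exp_coef (A : nat -> V_ -> V_) (k : nat) (w : V_) : V_ :=
  \sum_(j < k.+1) (j`!%:R^-1 : C) *: series_pow A j k w.

(* exp(\sum_(n > 0) a(-n)/n z^n) at z^k, and exp(- \sum_(n > 0) a(n)/n z^(-n))
   at z^(-k). *)
Definition exp_minus (a : 'rV[int]_l) : nat -> V_ -> V_ :=
  exp_coef (fun n w => n%:R^-1 *: heis (latF C a) (- n%:Z) w).
Definition exp_plus (a : 'rV[int]_l) : nat -> V_ -> V_ :=
  exp_coef (fun n w => - n%:R^-1 *: heis (latF C a) n%:Z w).

(* A field \sum_n F n z^(-n-1), given by its modes. *)
Definition field : Type := int -> V_ -> V_.

(* d/dz and the divided powers (1/k!) (d/dz)^k. *)
Definition dfield (F : field) : field :=
  fun n w => - n%:~R *: F (n - 1) w.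
Definition ddfield (k : nat) (F : field) : field :=
  fun n w => (k`!%:R^-1 : C) *: iter k dfield F n w.

(* :A(z)B(z): = A_-(z) B(z) + B(z) A_+(z), where A_-(z) collects the modes A_j
   with j < 0 and A_+(z) those with j >= 0. Both sums have finite support on
   each w when A(z)w and B(z)w are truncated. *)
Definition normal_product (A B : field) : field := fun n w =>
  \sum_(j \in [set j : int | j < 0]) A j (B (n - j - 1) w)
  + \sum_(j \in [set j : int | 0 <= j]) B (n - j - 1) (A j w).

Variable eps : 'rV[int]_l -> 'rV[int]_l -> int.

(* Y(e^a,z) = exp(\sum_(n>0) a(-n)/n z^n) exp(- \sum_(n>0) a(n)/n z^(-n)) e_a z^a,
   with e_a e^b = eps a b e^(a+b) and z^a e^b = z^(a,b) e^b. The mode n is the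
   coefficient of z^(-n-1); only finitely many pairs (p, q) contribute. *)
Definition vertex_exp (a : 'rV[int]_l) : field := fun n =>
  lin_ext (fun b' => let: (m, b) := b' in
    (eps a b)%:~R *:
    \sum_(pq \in [set pq : nat * nat | pq.1%:Z - pq.2%:Z + ip L a b = - n - 1])
      exp_minus a pq.1 (exp_plus a pq.2 (ket m (a + b)))).

(* Y(b_(i1)(-n1-1) ... b_(ir)(-nr-1) e^a, z) is the normal ordered product
   :(1/n1!) d^n1 b_(i1)(z) ... (1/nr!) d^nr b_(ir)(z) Y(e^a,z):. *)
Definition Y_basis (b : fock_basis) : field :=
  let: (m, a) := b in
  foldr (fun x F => normal_product (ddfield x.2 (heis (bas x.1))) F)
    (vertex_exp a) (enum_mset m).

Definition Y_L (v : V_) (n : int) (w : V_) : V_ :=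
  \sum_(b <- msupp (v : {malg C[fock_basis]})) mcoeff b v *: Y_basis b n w.

Definition vac_L : V_ := ket mset0 0.

(* 1/2 \sum_i b_i(-1) b^i(-1) 1, with (b^i) the basis of H dual to (b_i) for the
   inner product. *)
Definition omega_L : V_ :=
  2%:R^-1 *: \sum_(i < l) \sum_(j < l)
    invmx (gramF L C) i j *: heis (bas i) (- 1) (heis (bas j) (- 1) vac_L).

Definition omega_h (h : H) : V_ := omega_L + heis h (- 2) vac_L.

End LatticeVOA.

(* Main.v *)
From mathcomp Require Import all_boot all_order all_algebra.
From mathcomp Require Import finmap multiset zify ring lra.
From mathcomp Require Import boolp classical_sets functions fsbigop.
From mathcomp Require Import reals complex.
Require Import Defs.

(** Call the vectors 1 (x) e^a the vacua. A family of vectors stable, up to linear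
    combinations, under the annihilation operators h(n), n > 0, vanishes once its
    coordinates on the vacua do; and an operator with controlled commutators with the
    creation operators is determined by its values on the vacua. Since
    [h(p), Y(e^a,z)] = (h,a) z^p Y(e^a,z), both the locality of the Y(e^a,z) and the
    Virasoro relations reduce to computing vacuum coordinates: for locality these are
    the coefficients of (1 - x)^(a,b), for the Virasoro relations a finite sum. Dong's
    lemma extends locality to the normal ordered products defining Y. Replacing omega
    by omega + h(-2)1 replaces L(n) by L(n) - (n+1)h(n), which shifts the central
    charge by -12(h,h) and makes m (x) e^a an eigenvector of L(0) of eigenvalue
    |m| + (a,a)/2 - (h,a). The quadratic term dominates the linear one, so only finitely
    many basis vectors have Re - |Im| of their weight below a given bound. *)

Set Implicit Arguments.
Unset Strict Implicit.
Unset Printing Implicit Defensive.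

Import Order.TTheory GRing.Theory Num.Theory.

Local Open Scope classical_set_scope.
Local Open Scope ring_scope.

(** Products of two vertex operators are never put in normal order; all that enters is the
    commutator with h(p), and it shifts a mode index. A single coefficient is therefore not stable,
    and [vacuum_detection] and [creation_ext] speak of a whole indexed family at once: all
    coefficients of (z1 - z2)^N [Y(e^a,z1), Y(e^b,z2)], say, or all modes of a field. The input on
    the vacua is one differential equation, z E' = (\sum a(-n) z^n) E for E(z) = exp(\sum a(-n) z^n
    / n) e^b, whose vacuum coordinates yield the recursion for the coefficients of (1 - x)^s. For s
    = (a,b) the two orders of Y(e^a,z1) and Y(e^b,z2) give expansions of (1 - z2/z1)^s and (1 -
    z1/z2)^s. The factor (z1 - z2)^|s| raises the exponent to s + |s|, which is nonnegative and
    even. Both become polynomials, equal up to (-1)^s, and the cocycle supplies that sign.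
    Everything except the final comparison is done over an abstract [fock_space], known only through
    its basis, its coordinates and the Heisenberg action. *)

Section LinearMaps.
Context {K : nzRingType} {U V : lmodType K}.
Implicit Types (f g : U -> V).

Lemma lin0 f : linear f -> f 0 = 0.
Proof. by move=> lf; have := lf (-1) 0 0; rewrite scaler0 addr0 scaleN1r addNr. Qed.

Lemma linD f u v : linear f -> f (u + v) = f u + f v.
Proof. by move=> lf; have := lf 1 u v; rewrite !scale1r. Qed.

Lemma linZ f a u : linear f -> f (a *: u) = a *: f u.
Proof. by move=> lf; have := lf a u 0; rewrite lin0// !addr0. Qed.

Lemma linN f u : linear f -> f (- u) = - f u.
Proof. by move=> lf; rewrite -scaleN1r linZ// scaleN1r. Qed.

Lemma linB f u v : linear f -> f (u - v) = f u - f v.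
Proof. by move=> lf; rewrite linD// linN. Qed.

Lemma lin_sum f I (r : seq I) (P : pred I) (F : I -> U) : linear f ->
  f (\sum_(i <- r | P i) F i) = \sum_(i <- r | P i) f (F i).
Proof.
by move=> lf; elim/big_rec2: _ => [|i y x _ <-]; rewrite ?lin0// linD.
Qed.

End LinearMaps.

Section LinearClosure.
Context {K : comNzRingType} {U V W : lmodType K}.

Lemma linear_fcomp (f : V -> W) (g : U -> V) :
  linear f -> linear g -> linear (fun u => f (g u)).
Proof. by move=> lf lg a u v; rewrite lg lf. Qed.

Lemma linear_fadd (f g : U -> V) :
  linear f -> linear g -> linear (fun u => f u + g u).
Proof. by move=> lf lg a u v; rewrite lf lg scalerDr addrACA. Qed.

Lemma linear_fscale (c : K) (f : U -> V) :
  linear f -> linear (fun u => c *: f u).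
Proof. by move=> lf a u v; rewrite lf scalerDr !scalerA mulrC. Qed.

Lemma linear_fsub (f g : U -> V) :
  linear f -> linear g -> linear (fun u => f u - g u).
Proof. by move=> lf lg a u v; rewrite lf lg scalerBr opprD addrACA. Qed.

Lemma linear_fsum I (r : seq I) (P : pred I) (f : I -> U -> V) :
  (forall i, linear (f i)) -> linear (fun u => \sum_(i <- r | P i) f i u).
Proof.
move=> lf a u v; rewrite scaler_sumr -big_split /=.
by apply: eq_bigr => i _; rewrite lf.
Qed.

End LinearClosure.

(** * Sums over the naturals with finite support *)

Section EventuallyZeroSums.
Context {K : comNzRingType} {V : lmodType K}.
Implicit Types f g : nat -> V.

Definition evz f := exists N, forall j, (N <= j)%N -> f j = 0.

(** An infinite support gives the value 0, hence the hypotheses [evz] of the additivity lemmas. The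
    normal products and vertex operators are brought to this form by reindexing. *)
Definition Sum f : V := \sum_(j \in [set: nat]) f j.

Lemma SumE N f : (forall j, (N <= j)%N -> f j = 0) -> Sum f = \sum_(j < N) f j.
Proof.
move=> fN; rewrite /Sum (fsbigE (iota 0 N)) ?iota_uniq//; last first.
  by move=> j _; rewrite mem_iota add0n /= -leqNgt => /fN.
rewrite -(big_mkord xpredT) /index_iota subn0; apply: eq_bigl => i.
by rewrite in_setT.
Qed.

Lemma eq_Sum f g : f =1 g -> Sum f = Sum g.
Proof. by move=> /funext ->. Qed.

Lemma Sum0 f : (forall j, f j = 0) -> Sum f = 0.
Proof. by move=> f0; rewrite (@SumE 0) ?big_ord0. Qed.

Lemma evzD f g : evz f -> evz g -> evz (fun j => f j + g j).
Proof.
move=> [N fN] [M gM]; exists (maxn N M) => j; rewrite geq_max => /andP[? ?].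
by rewrite fN ?gM ?addr0.
Qed.

Lemma evzN f : evz f -> evz (fun j => - f j).
Proof. by move=> [N fN]; exists N => j /fN ->; rewrite oppr0. Qed.

Lemma evzB f g : evz f -> evz g -> evz (fun j => f j - g j).
Proof. by move=> ? ?; apply: evzD => //; apply: evzN. Qed.

Lemma evzZ a f : evz f -> evz (fun j => a *: f j).
Proof. by move=> [N fN]; exists N => j /fN ->; rewrite scaler0. Qed.

Lemma evzS f : evz f -> evz (fun j => f j.+1).
Proof. by move=> [N fN]; exists N => j Nj; apply: fN; apply: leqW. Qed.

Lemma SumD f g : evz f -> evz g -> Sum (fun j => f j + g j) = Sum f + Sum g.
Proof.
move=> [N fN] [M gM].
have fM j : (maxn N M <= j)%N -> f j = 0 by rewrite geq_max => /andP[/fN].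
have gN j : (maxn N M <= j)%N -> g j = 0 by rewrite geq_max => /andP[_ /gM].
rewrite (SumE fM) (SumE gN) (@SumE (maxn N M)) ?big_split// => j hj.
by rewrite fM ?gN ?addr0.
Qed.

Lemma Sum_recl f : evz f -> Sum f = f 0%N + Sum (fun j => f j.+1).
Proof.
move=> [N fN]; rewrite (@SumE N.+1) ?big_ord_recl; last first.
  by move=> j Nj; apply: fN; apply: ltnW.
by rewrite (@SumE N)// => j Nj; apply: fN; apply: leqW.
Qed.

Lemma Sum_single j0 f : (forall j, j != j0 -> f j = 0) -> Sum f = f j0.
Proof.
move=> f0; rewrite (@SumE j0.+1); last by move=> j h; apply: f0; rewrite gtn_eqF.
by rewrite big_ord_recr /= big1 ?add0r// => i _; apply: f0; rewrite ltn_eqF.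
Qed.

End EventuallyZeroSums.

Section SumLinear.
Context {K : comNzRingType} {V W : lmodType K}.

Lemma Sum_lin (A : V -> W) (f : nat -> V) : linear A -> evz f ->
  A (Sum f) = Sum (fun j => A (f j)).
Proof.
move=> lA [N fN]; rewrite (SumE fN) lin_sum// (@SumE _ _ N)// => j /fN ->.
by rewrite lin0.
Qed.

Lemma SumZ a (f : nat -> V) : evz f -> Sum (fun j => a *: f j) = a *: Sum f.
Proof.
move=> [N fN]; rewrite (SumE fN) scaler_sumr (@SumE _ _ N)// => j /fN ->.
by rewrite scaler0.
Qed.

Lemma SumN (f : nat -> V) : evz f -> Sum (fun j => - f j) = - Sum f.
Proof.
move=> ef; rewrite -scaleN1r -SumZ//; apply: eq_Sum => j.
by rewrite scaleN1r.
Qed.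

Lemma SumB (f g : nat -> V) : evz f -> evz g ->
  Sum (fun j => f j - g j) = Sum f - Sum g.
Proof. by move=> ef eg; rewrite SumD ?SumN//; apply: evzN. Qed.

(** The hypotheses confine the support to a rectangle: finitely many rows are nonzero and each is
    finite, so a common bound on the columns exists. *)
Lemma Sum_exch (f : nat -> nat -> V) :
    (exists N, forall i, (N <= i)%N -> forall j, f i j = 0) ->
    (forall i, evz (f i)) ->
  Sum (fun i => Sum (f i)) = Sum (fun j => Sum (fun i => f i j)).
Proof.
move=> [N fN] ef.
have [M fM] : exists M, forall i j, (M <= j)%N -> f i j = 0.
  have [M fM] : exists M, forall i, (i < N)%N -> forall j, (M <= j)%N -> f i j = 0.
    elim: (N) => [|n [M IH]]; first by exists 0%N.
    have [M' fM'] := ef n; exists (maxn M M') => i; rewrite ltnS leq_eqVlt.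
    case/orP=> [/eqP ->|/IH h] j; rewrite geq_max => /andP[? ?]; last exact: h.
    exact: fM'.
  by exists M => i j Mj; case: (ltnP i N) => [/fM/(_ j Mj)|/fN].
rewrite (@SumE _ _ N); last by move=> i /fN h; apply: Sum0.
rewrite (@SumE _ _ M); last by move=> j Mj; apply: Sum0 => i; apply: fM.
rewrite (eq_bigr (fun i : 'I_N => \sum_(j < M) f i j)); last first.
  by move=> i _; rewrite (@SumE _ _ M)// => j; apply: fM.
rewrite exchange_big; apply: eq_bigr => j _ /=.
by rewrite (@SumE _ _ N)// => i /fN.
Qed.

End SumLinear.

(** Each term of the binomial expansion of (Y - X)^(a+b) contains X^a or Y^b. Without expanding:
    [X d] and [Y d] satisfy the hypotheses with [a], respectively [b], lowered by one. In Dong's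
    lemma [W] is multiplication by z2 - z3 = (z1 - z3) - (z1 - z2). *)
Lemma iter_nil_sub (G : zmodType) (X Y W : G -> G) (a b : nat) (d : G) :
    (forall u, W u = Y u - X u) -> (forall u v, W (u - v) = W u - W v) ->
    X 0 = 0 -> Y 0 = 0 -> (forall u, X (Y u) = Y (X u)) ->
  iter a X d = 0 -> iter b Y d = 0 -> iter (a + b) W d = 0.
Proof.
move=> WE Wsub X0 Y0 XY.
have W0 : W 0 = 0 by rewrite WE X0 Y0 subr0.
have W0n n : iter n W 0 = 0 by elim: n => //= n ->.
have WBn n u v : iter n W (u - v) = iter n W u - iter n W v.
  by elim: n => //= n ->.
have XYn n u : iter n X (Y u) = Y (iter n X u) by elim: n => //= n ->.
have YXn n u : iter n Y (X u) = X (iter n Y u) by elim: n => //= n ->.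
(* The induction is on a bound for a + b, since the two recursive calls lower different
   exponents. *)
move: {2}(a + b)%N (leqnn (a + b)) => n.
elim: n a b d => [|n IH] a b d hn Xd Yd.
  by move: hn Xd; case: a => // _ d0; rewrite (d0 : d = 0) W0n.
case: a hn Xd => [|a] hn Xd; first by rewrite (Xd : d = 0) W0n.
case: b hn Yd => [|b] hn Yd; first by rewrite (Yd : d = 0) W0n.
rewrite addSn iterSr WE WBn.
have -> : iter (a + b.+1) W (X d) = 0.
  by apply: IH; [lia|rewrite -iterSr|rewrite YXn Yd X0].
by rewrite subr0 addnS -addSn; apply: IH; [lia|rewrite XYn Xd Y0|rewrite -iterSr].
Qed.

(** * Local fields and normal ordered products *)

Section Fields.
Context {K : comNzRingType} {V : lmodType K}.
Implicit Types (A B F : int -> V -> V).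

Definition isfield F := (forall n, linear (F n)) /\
  (forall w, exists N : int, forall n, N <= n -> F n w = 0).

(** The coefficients of A_-(z)B(z) and B(z)A_+(z). They are kept apart because they come, up to
    sign, from the two opposite expansions of 1/(z1 - z2) that Dong's lemma recombines. *)
Definition Lp A B n w : V := Sum (fun j : nat => A (- 1 - j%:Z) (B (n + j%:Z) w)).
Definition Rp A B n w : V := Sum (fun j : nat => B (n - 1 - j%:Z) (A j%:Z w)).
Definition nprod A B n w : V := Lp A B n w + Rp A B n w.

Lemma field_evzp F n w : isfield F -> evz (fun j : nat => F (n + j%:Z) w).
Proof.
by move=> [_ /(_ w)[N FN]]; exists `|N - n|%N => j hj; apply: FN; lia.
Qed.

Lemma evz_Lp A B n w : isfield A -> isfield B ->
  evz (fun j : nat => A (- 1 - j%:Z) (B (n + j%:Z) w)).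
Proof.
by move=> [lA _] /(field_evzp n w)[N hN]; exists N => j /hN ->; rewrite lin0.
Qed.

Lemma evz_Rp A B n w : isfield A -> isfield B ->
  evz (fun j : nat => B (n - 1 - j%:Z) (A j%:Z w)).
Proof.
move=> /(field_evzp 0 w)[N hN] [lB _]; exists N => j /hN.
by rewrite add0r => ->; rewrite lin0.
Qed.

Lemma isfield_Lp A B : isfield A -> isfield B -> isfield (Lp A B).
Proof.
move=> fA fB; have [[lA tA] [lB tB]] := (fA, fB); split=> [n|w].
  suff: forall (a : K) (u v : V), Lp A B n (a *: u + v) = a *: Lp A B n u + Lp A B n v by [].
  move=> a u v; rewrite /Lp -SumZ; last exact: (evz_Lp _ _ fA fB).
  rewrite -SumD; [|by apply: evzZ; apply: (evz_Lp _ _ fA fB)|exact: (evz_Lp _ _ fA fB)].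
  by apply: eq_Sum => j; rewrite lB lA.
have [N hN] := tB w; exists N => n Nn; apply: Sum0 => j.
by rewrite hN ?lin0//; lia.
Qed.

Lemma isfield_Rp A B : isfield A -> isfield B -> isfield (Rp A B).
Proof.
move=> fA fB; have [[lA tA] [lB tB]] := (fA, fB); split=> [n|w].
  suff: forall (a : K) (u v : V), Rp A B n (a *: u + v) = a *: Rp A B n u + Rp A B n v by [].
  move=> a u v; rewrite /Rp -SumZ; last exact: (evz_Rp _ _ fA fB).
  rewrite -SumD; [|by apply: evzZ; apply: (evz_Rp _ _ fA fB)|exact: (evz_Rp _ _ fA fB)].
  by apply: eq_Sum => j; rewrite lA lB.
have [M hM] := field_evzp 0 w fA.
(* Only the A_j w with j < M can be nonzero. [N] truncates B on all of them, and the bound N + 1 + M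
   absorbs the shift n - 1 - j. *)
have [N hN] : exists N : int, forall j, (j < M)%N -> forall n, N <= n -> B n (A j%:Z w) = 0.
  elim: (M) => [|m [N IH]]; first by exists 0.
  have [N' hN'] := tB (A m%:Z w); exists (Num.max N N') => j.
  rewrite ltnS leq_eqVlt => /orP[/eqP->|/IH h] n; rewrite ge_max => /andP[? ?].
    exact: hN'.
  exact: h.
exists (N + 1 + M%:Z) => n hn; apply: Sum0 => j; case: (ltnP j M) => jM.
  by apply: (hN j) => //; lia.
by have := hM j jM; rewrite add0r => ->; rewrite lin0.
Qed.

Lemma isfieldD A B : isfield A -> isfield B -> isfield (fun n w => A n w + B n w).
Proof.
move=> [lA tA] [lB tB]; split=> [n|w]; first exact: linear_fadd.
have [N hN] := tA w; have [N' hN'] := tB w; exists (Num.max N N') => n.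
by rewrite ge_max => /andP[/hN -> /hN' ->]; rewrite addr0.
Qed.

Lemma isfieldZ a A : isfield A -> isfield (fun n w => a *: A n w).
Proof.
move=> [lA tA]; split=> [n|w]; first exact: linear_fscale.
by have [N hN] := tA w; exists N => n /hN ->; rewrite scaler0.
Qed.

Lemma isfield_nprod A B : isfield A -> isfield B -> isfield (nprod A B).
Proof. by move=> *; apply: isfieldD; [apply: isfield_Lp|apply: isfield_Rp]. Qed.

Lemma Lp_lin A B B' a : isfield A -> isfield B -> isfield B' -> forall n w,
  Lp A (fun n w => a *: B n w + B' n w) n w = a *: Lp A B n w + Lp A B' n w.
Proof.
move=> fA fB fB' n w; rewrite /Lp -SumZ; last by exact: (evz_Lp _ _ fA fB).
rewrite -SumD; [|by apply: evzZ; apply: (evz_Lp _ _ fA fB)|by exact: (evz_Lp _ _ fA fB')].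
by apply: eq_Sum => j; rewrite (proj1 fA).
Qed.

Lemma Rp_lin A B B' a : isfield A -> isfield B -> isfield B' -> forall n w,
  Rp A (fun n w => a *: B n w + B' n w) n w = a *: Rp A B n w + Rp A B' n w.
Proof.
move=> fA fB fB' n w; rewrite /Rp -SumZ; last by exact: (evz_Rp _ _ fA fB).
by rewrite -SumD; [|by apply: evzZ; apply: (evz_Rp _ _ fA fB)|by exact: (evz_Rp _ _ fA fB')].
Qed.

Lemma nprod_lin A B B' a : isfield A -> isfield B -> isfield B' -> forall n w,
  nprod A (fun n w => a *: B n w + B' n w) n w
  = a *: nprod A B n w + nprod A B' n w.
Proof. by move=> *; rewrite /nprod Lp_lin// Rp_lin// scalerDr addrACA. Qed.

Lemma nprod_linl A A' B a : isfield A -> isfield A' -> isfield B -> forall n w,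
  nprod (fun n w => a *: A n w + A' n w) B n w
  = a *: nprod A B n w + nprod A' B n w.
Proof.
move=> fA fA' fB n w; rewrite /nprod scalerDr addrACA; congr (_ + _); rewrite -SumZ.
- by rewrite -SumD; [|by apply: evzZ; apply: (evz_Lp _ _ fA fB)|by exact: (evz_Lp _ _ fA' fB)].
- by exact: (evz_Lp _ _ fA fB).
- rewrite -SumD; [|by apply: evzZ; apply: (evz_Rp _ _ fA fB)|by exact: (evz_Rp _ _ fA' fB)].
  by apply: eq_Sum => j; rewrite (proj1 fB).
- by exact: (evz_Rp _ _ fA fB).
Qed.

Lemma eq_nprod A B B' : (forall n w, B n w = B' n w) ->
  forall n w, nprod A B n w = nprod A B' n w.
Proof. by move=> BB' n w; have -> : B = B' by apply/funext => m; apply/funext. Qed.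

(** Only commutators of modes of equal sign intervene. In the mixed terms A_- stands left of F and
    B_+ right of it, whichever product is outermost, so the central terms of the Heisenberg
    relations are never met. *)
Lemma nprodC A B F : isfield A -> isfield B -> isfield F ->
    (forall i j : int, i < 0 -> j < 0 -> forall w, A i (B j w) = B j (A i w)) ->
    (forall i j : int, 0 <= i -> 0 <= j -> forall w, A i (B j w) = B j (A i w)) ->
  forall n w, nprod A (nprod B F) n w = nprod B (nprod A F) n w.
Proof.
move=> fA fB fF ABm ABp n w.
have [[lA tA] [lB tB] [lF tF]] := And3 fA fB fF.
have LpD A' B' B'' m u : isfield A' -> isfield B' -> isfield B'' ->
    Lp A' (fun n w => B' n w + B'' n w) m u = Lp A' B' m u + Lp A' B'' m u.
  move=> fA' fB' fB''; rewrite -[Lp A' B' m u]scale1r -Lp_lin//.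
  by apply: eq_Sum => j; rewrite scale1r.
have RpD A' B' B'' m u : isfield A' -> isfield B' -> isfield B'' ->
    Rp A' (fun n w => B' n w + B'' n w) m u = Rp A' B' m u + Rp A' B'' m u.
  move=> fA' fB' fB''; rewrite -[Rp A' B' m u]scale1r -Rp_lin//.
  by apply: eq_Sum => j; rewrite scale1r.
have LR A' B' : isfield A' -> isfield B' ->
    Lp A' (Rp B' F) n w = Rp B' (Lp A' F) n w.
  move=> fA' fB'; have [[lA' tA'] [lB' tB']] := (fA', fB').
  transitivity (Sum (fun j : nat => Sum (fun i : nat =>
      A' (- 1 - j%:Z) (F (n + j%:Z - 1 - i%:Z) (B' i%:Z w))))).
    by apply: eq_Sum => j; rewrite Sum_lin//; exact: (evz_Rp _ _ fB' fF).
  rewrite -Sum_exch.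
  - apply: eq_Sum => i; apply: eq_Sum => j; congr (A' _ (F _ _)); lia.
  - have [M hM] := field_evzp 0 w fB'; exists M => i /hM.
    by rewrite add0r => -> j; rewrite !lin0.
  - move=> i; have [N hN] := field_evzp (n - 1 - i%:Z) (B' i%:Z w) fF.
    exists N => j /hN; have -> : n - 1 - i%:Z + j%:Z = n + j%:Z - 1 - i%:Z by lia.
    by move=> ->; rewrite lin0.
rewrite /nprod !LpD ?RpD; try by [|apply: isfield_Lp|apply: isfield_Rp].
have LL : Lp A (Lp B F) n w = Lp B (Lp A F) n w.
  transitivity (Sum (fun i : nat => Sum (fun j : nat =>
      A (- 1 - i%:Z) (B (- 1 - j%:Z) (F (n + i%:Z + j%:Z) w))))).
    by apply: eq_Sum => i; rewrite Sum_lin//; by exact: (evz_Lp _ _ fB fF).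
  have [N hN] := field_evzp n w fF.
  rewrite Sum_exch; [|exists N => i Ni j|move=> i; exists N => j Nj].
  - apply: eq_Sum => j; rewrite Sum_lin//; last by exact: (evz_Lp _ _ fA fF).
    apply: eq_Sum => i; rewrite ABm; [congr (B _ (A _ (F _ _)))| |]; lia.
  - have := hN (i + j)%N (leq_trans Ni (leq_addr _ _)).
    by rewrite PoszD addrA => ->; rewrite !lin0.
  - have := hN (i + j)%N (leq_trans Nj (leq_addl _ _)).
    by rewrite PoszD addrA => ->; rewrite !lin0.
have RR : Rp A (Rp B F) n w = Rp B (Rp A F) n w.
  transitivity (Sum (fun i : nat => Sum (fun j : nat =>
      F (n - 1 - i%:Z - 1 - j%:Z) (B j%:Z (A i%:Z w))))) => //.
  rewrite Sum_exch.
  - apply: eq_Sum => j; apply: eq_Sum => i; rewrite ABp//; congr (F _ _); lia.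
  - have [M hM] := field_evzp 0 w fA; exists M => i /hM.
    by rewrite add0r => -> j; rewrite !lin0.
  - move=> i; have [M hM] := field_evzp 0 (A i%:Z w) fB; exists M => j /hM.
    by rewrite add0r => ->; rewrite !lin0.
by rewrite LL RR (LR A B)// -(LR B A)// addrACA.
Qed.

(* Multiplication by z1 - z2 on the coefficients of z1^(-p-1) z2^(-q-1). *)
Definition D2 (F : int -> int -> V) (p q : int) : V := F (p + 1) q - F p (q + 1).

Definition comm A B w p q : V := A p (B q w) - B q (A p w).

Definition local A B := exists N, forall w p q, iter N D2 (comm A B w) p q = 0.
End Fields.

Lemma subr_ACA (M : zmodType) (a b c d : M) : a - b - (c - d) = a - c - (b - d).
Proof. by rewrite !opprB addrACA [RHS]addrACA [- b - c]addrC. Qed.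

(** * Locality and Dong's lemma *)

Section Locality.
Context {K : comNzRingType} {V : lmodType K}.
Implicit Types (F G : int -> int -> V) (A B C : int -> V -> V).

Lemma iterD2_0 N F : (forall p q, F p q = 0) -> forall p q, iter N D2 F p q = 0.
Proof. by elim: N => //= N IH F0 p q; rewrite /D2 !IH// subr0. Qed.

Lemma iterD2D N F G p q : iter N D2 (fun p q => F p q + G p q) p q
  = iter N D2 F p q + iter N D2 G p q.
Proof.
by elim: N p q => //= N IH p q; rewrite {1}/D2 !IH opprD addrACA.
Qed.

Lemma iterD2_linear N (f : V -> V) F p q : linear f ->
  iter N D2 (fun p q => f (F p q)) p q = f (iter N D2 F p q).
Proof. by move=> lf; elim: N p q => //= N IH p q; rewrite {1}/D2 !IH -linB. Qed.

Lemma iterD2Z N a F p q :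
  iter N D2 (fun p q => a *: F p q) p q = a *: iter N D2 F p q.
Proof. by elim: N p q => //= N IH p q; rewrite {1}/D2 !IH -scalerBr. Qed.

Lemma iterD2N N F p q :
  iter N D2 (fun p q => - F p q) p q = - iter N D2 F p q.
Proof. by elim: N p q => //= N IH p q; rewrite {1}/D2 !IH opprB opprK addrC. Qed.

Lemma iterD2B N F G p q : iter N D2 (fun p q => F p q - G p q) p q
  = iter N D2 F p q - iter N D2 G p q.
Proof. by rewrite iterD2D iterD2N. Qed.

Lemma iterD2_swap N F p q :
  iter N D2 (fun p q => F q p) p q = (-1) ^+ N *: iter N D2 F q p.
Proof.
elim: N p q => [|N IH] p q /=; first by rewrite expr0 scale1r.
by rewrite {1}/D2 !IH -scalerBr exprS mulN1r scaleNr -scalerN opprB.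
Qed.

Lemma iterD2_ge N M F : (N <= M)%N -> (forall p q, iter N D2 F p q = 0) ->
  forall p q, iter M D2 F p q = 0.
Proof. by move=> /subnK <- h; rewrite iterD; apply: iterD2_0. Qed.

(** Turns [local] into the explicit sum that appears in [locality]; the induction is Pascal's
    rule. *)
Lemma iterD2_binomial N F p q : iter N D2 F p q =
  \sum_(i < N.+1) ((-1) ^+ i * 'C(N, i)%:R : K) *: F (p + N%:Z - i%:Z) (q + i%:Z).
Proof.
elim: N p q => [|N IH] p q.
  by rewrite big_ord1 /= bin0 mulr1 expr0 scale1r !addr0.
pose c M i : K := (-1) ^+ i * 'C(M, i)%:R.
pose T i := F (p + N.+1%:Z - i%:Z) (q + i%:Z).
rewrite iterS {1}/D2 !IH.
rewrite (eq_bigr (fun i : 'I_N.+1 => c N i *: T i)); last first.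
  by move=> i _; congr (_ *: F _ _); lia.
rewrite [X in _ - X](eq_bigr (fun i : 'I_N.+1 => c N i *: T i.+1)); last first.
  by move=> i _; congr (_ *: F _ _); lia.
rewrite [RHS](eq_bigr (fun i : 'I_N.+2 => c N.+1 i *: T i))//.
have -> : \sum_(i < N.+1) c N i *: T i = \sum_(i < N.+2) c N i *: T i.
  by rewrite [RHS]big_ord_recr /= /c bin_small// mulr0 scale0r addr0.
rewrite big_ord_recl [RHS]big_ord_recl -addrA -sumrB; congr (_ + _).
  by rewrite /c !bin0.
apply: eq_bigr => i _; rewrite -scalerBl; congr (_ *: _).
by rewrite /c /bump /= ?add1n binS natrD mulrDr exprS mulN1r !mulNr.
Qed.

Lemma local_sym A B : local A B -> local B A.
Proof.
case=> N hN; exists N => w p q.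
have -> : comm B A w = fun p q => (- 1) *: comm A B w q p.
  by apply/funext => m; apply/funext => n; rewrite /comm scaleN1r opprB.
by rewrite iterD2Z iterD2_swap hN !scaler0.
Qed.

Lemma local_commutator0 A B : (forall p q w, A p (B q w) = B q (A p w)) ->
  local A B.
Proof. by move=> AB; exists 0%N => w p q; rewrite /= /comm AB subrr. Qed.

Section Dong.
Implicit Types (T : int -> int -> int -> V).

(** Multiplication by z1 - z2, z1 - z3 and z2 - z3 on the coefficients of z1^(-p-1) z2^(-n-1)
    z3^(-q-1). *)
Definition D12 T p n q := T (p + 1) n q - T p (n + 1) q.
Definition D13 T p n q := T (p + 1) n q - T p n (q + 1).
Definition D23 T p n q := T p (n + 1) q - T p n (q + 1).

Lemma iterD12E N T p n q :
  iter N D12 T p n q = iter N D2 (fun p n => T p n q) p n.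
Proof. by elim: N p n => //= N IH p n; rewrite /D12 /D2 !IH. Qed.

Lemma iterD13E N T p n q :
  iter N D13 T p n q = iter N D2 (fun p q => T p n q) p q.
Proof. by elim: N p q => //= N IH p q; rewrite /D13 /D2 !IH. Qed.

Lemma iterD23E N T p n q :
  iter N D23 T p n q = iter N D2 (fun n q => T p n q) n q.
Proof. by elim: N n q => //= N IH n q; rewrite /D23 /D2 !IH. Qed.

(* [expL] and [expR] multiply a three-variable distribution by the expansions
   of 1/(z1 - z2) in |z1| > |z2| and of -1/(z1 - z2) in |z2| > |z1|. *)
Definition expL T p n q := Sum (fun j : nat => T (p - 1 - j%:Z) (n + j%:Z) q).
Definition expR T p n q := Sum (fun j : nat => T (p + j%:Z) (n - 1 - j%:Z) q).
Definition okL T := forall p n q, evz (fun j : nat => T (p - 1 - j%:Z) (n + j%:Z) q).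
Definition okR T := forall p n q, evz (fun j : nat => T (p + j%:Z) (n - 1 - j%:Z) q).

(** Telescoping: the series at (p + 1, n) is the series at (p, n + 1) preceded by [T p n q]. *)
Lemma D12_expL T : okL T -> D12 (expL T) = T.
Proof.
move=> oT; apply/funext => p; apply/funext => n; apply/funext => q.
rewrite /D12 /expL Sum_recl//.
rewrite [X in _ + X - _](_ : _ = Sum (fun j : nat => T (p - 1 - j%:Z) (n + 1 + j%:Z) q)).
  by rewrite addrK; congr (T _ _ _); lia.
by apply: eq_Sum => j; congr (T _ _ _); lia.
Qed.

Lemma D12_expR T : okR T -> D12 (expR T) = fun p n q => - T p n q.
Proof.
move=> oT; apply/funext => p; apply/funext => n; apply/funext => q.
rewrite /D12 /expR (Sum_recl (oT p (n + 1) q)) opprD addrCA.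
rewrite [X in - Sum X](_ : _ = (fun j : nat => T (p + 1 + j%:Z) (n - 1 - j%:Z) q)).
  by rewrite subrr addr0; congr (- T _ _ _); lia.
by apply/funext => j; congr (T _ _ _); lia.
Qed.

Lemma eq_evz (f g : nat -> V) : f =1 g -> evz f -> evz g.
Proof. by move=> /funext ->. Qed.

Lemma okL_D13 T : okL T -> okL (D13 T).
Proof.
move=> oT p n q; apply: evzB; last exact: oT.
by apply: eq_evz (oT (p + 1) n q) => j; congr (T _ _ _); lia.
Qed.

Lemma okL_D23 T : okL T -> okL (D23 T).
Proof.
move=> oT p n q; apply: evzB; last exact: oT.
by apply: eq_evz (oT p (n + 1) q) => j; congr (T _ _ _); lia.
Qed.

Lemma okR_D13 T : okR T -> okR (D13 T).
Proof.
move=> oT p n q; apply: evzB; last exact: oT.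
by apply: eq_evz (oT (p + 1) n q) => j; congr (T _ _ _); lia.
Qed.

Lemma okR_D23 T : okR T -> okR (D23 T).
Proof.
move=> oT p n q; apply: evzB; last exact: oT.
by apply: eq_evz (oT p (n + 1) q) => j; congr (T _ _ _); lia.
Qed.

Lemma D13_expL T : okL T -> D13 (expL T) = expL (D13 T).
Proof.
move=> oT; apply/funext => p; apply/funext => n; apply/funext => q.
rewrite /D13 /expL -SumB; [|exact: oT|exact: oT].
by apply: eq_Sum => j; congr (T _ _ _ - _); lia.
Qed.

Lemma D23_expL T : okL T -> D23 (expL T) = expL (D23 T).
Proof.
move=> oT; apply/funext => p; apply/funext => n; apply/funext => q.
rewrite /D23 /expL -SumB; [|exact: oT|exact: oT].
by apply: eq_Sum => j; congr (T _ _ _ - _); lia.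
Qed.

Lemma D13_expR T : okR T -> D13 (expR T) = expR (D13 T).
Proof.
move=> oT; apply/funext => p; apply/funext => n; apply/funext => q.
rewrite /D13 /expR -SumB; [|exact: oT|exact: oT].
by apply: eq_Sum => j; congr (T _ _ _ - _); lia.
Qed.

Lemma D23_expR T : okR T -> D23 (expR T) = expR (D23 T).
Proof.
move=> oT; apply/funext => p; apply/funext => n; apply/funext => q.
rewrite /D23 /expR -SumB; [|exact: oT|exact: oT].
by apply: eq_Sum => j; congr (T _ _ _ - _); lia.
Qed.

Lemma iterD13_expL N T : okL T ->
  iter N D13 (expL T) = expL (iter N D13 T) /\ okL (iter N D13 T).
Proof.
move=> oT; elim: N => //= N [-> ?].
by rewrite D13_expL//; split => //; exact: okL_D13.
Qed.

Lemma iterD23_expL N T : okL T ->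
  iter N D23 (expL T) = expL (iter N D23 T) /\ okL (iter N D23 T).
Proof.
move=> oT; elim: N => //= N [-> ?].
by rewrite D23_expL//; split => //; exact: okL_D23.
Qed.

Lemma iterD13_expR N T : okR T ->
  iter N D13 (expR T) = expR (iter N D13 T) /\ okR (iter N D13 T).
Proof.
move=> oT; elim: N => //= N [-> ?].
by rewrite D13_expR//; split => //; exact: okR_D13.
Qed.

Lemma iterD23_expR N T : okR T ->
  iter N D23 (expR T) = expR (iter N D23 T) /\ okR (iter N D23 T).
Proof.
move=> oT; elim: N => //= N [-> ?].
by rewrite D23_expR//; split => //; exact: okR_D23.
Qed.

Lemma funext3 T T' : (forall p n q, T p n q = T' p n q) -> T = T'.
Proof. by move=> h; do 3!apply/funext => ?. Qed.

Lemma iterD13_comm_D23 N M T :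
  iter N D13 (iter M D23 T) = iter M D23 (iter N D13 T).
Proof.
have DD T' : D13 (D23 T') = D23 (D13 T').
  by apply: funext3 => p n q; rewrite /D13 /D23 subr_ACA.
have DDm m T' : D13 (iter m D23 T') = iter m D23 (D13 T').
  by elim: m => //= m <-; rewrite DD.
by elim: N => //= N ->; rewrite DDm.
Qed.

Lemma iterD12_comm_D23 N M T :
  iter N D12 (iter M D23 T) = iter M D23 (iter N D12 T).
Proof.
have DD T' : D12 (D23 T') = D23 (D12 T').
  by apply: funext3 => p n q; rewrite /D12 /D23 subr_ACA.
have DDm m T' : D12 (iter m D23 T') = iter m D23 (D12 T').
  by elim: m => //= m <-; rewrite DD.
by elim: N => //= N ->; rewrite DDm.
Qed.

(** Dong's lemma. The commutator of :AB: with C is the slice p = 0 of a three-variable [d] built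
    from [AB, C] and [BA, C]. Both (z1 - z2)^(N+1) and (z1 - z3)^N (z2 - z3)^N kill [d]; since z2 -
    z3 is the difference of z1 - z3 and z1 - z2, a power of z2 - z3 alone kills it, and that factor
    acts slice by slice. *)
Lemma local_nprod A B C : isfield A -> isfield B -> isfield C ->
  local A B -> local A C -> local B C -> local (nprod A B) C.
Proof.
move=> fA fB fC [N1 h1] [N2 h2] [N3 h3].
have [[lA tA] [lB tB] [lC tC]] := And3 fA fB fC.
pose N := (N1 + N2 + N3)%N.
have {h1} hAB w p q : iter N D2 (comm A B w) p q = 0.
  by apply: iterD2_ge (h1 w) _ _; rewrite /N; lia.
have {h2} hAC w p q : iter N D2 (comm A C w) p q = 0.
  by apply: iterD2_ge (h2 w) _ _; rewrite /N; lia.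
have {h3} hBC w p q : iter N D2 (comm B C w) p q = 0.
  by apply: iterD2_ge (h3 w) _ _; rewrite /N; lia.
(* N for the factor (z2 - z3)^N that accompanies (z1 - z3)^N, and N.+1 + N from [iter_nil_sub]. *)
exists (N + (N.+1 + N))%N => w p q.
pose E p n q := A p (B n (C q w)) - C q (A p (B n w)).
pose E' p n q := B n (A p (C q w)) - C q (B n (A p w)).
have oE : okL E.
  move=> p' n' q'; apply: evzB.
    have [M hM] := field_evzp n' (C q' w) fB.
    by exists M => j /hM ->; rewrite lin0.
  have [M hM] := field_evzp n' w fB.
  by exists M => j /hM ->; rewrite !lin0.
have oE' : okR E'.
  move=> p' n' q'; apply: evzB.
    have [M hM] := field_evzp p' (C q' w) fA.
    by exists M => j /hM ->; rewrite lin0.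
  have [M hM] := field_evzp p' w fA.
  by exists M => j /hM ->; rewrite !lin0.
(* At p = 0, [expL] is the sum defining [Lp] and [expR] the one defining [Rp]. *)
pose d := fun p n q => expL E p n q + expR E' p n q.
have dE : (fun n q => d 0 n q) = comm (nprod A B) C w.
  apply/funext => n; apply/funext => r.
  rewrite /comm /nprod (linD _ _ (lC r)) opprD addrACA /d; congr (_ + _).
    rewrite /Lp (Sum_lin (lC r) (evz_Lp n w fA fB)).
    rewrite -SumB; [|by exact: (evz_Lp _ _ fA fB)|].
      by apply: eq_Sum => j; rewrite /E sub0r.
    have [M hM] := evz_Lp n w fA fB; exists M => j /hM ->.
    by rewrite lin0.
  rewrite /Rp (Sum_lin (lC r) (evz_Rp n w fA fB)).
  rewrite -SumB; [|by exact: (evz_Rp _ _ fA fB)|].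
    by apply: eq_Sum => j; rewrite /E' add0r.
  have [M hM] := evz_Rp n w fA fB; exists M => j /hM ->.
  by rewrite lin0.
have iter0 (D : (int -> int -> int -> V) -> int -> int -> int -> V) M :
    D (fun _ _ _ => 0) = (fun _ _ _ => 0) ->
    iter M D (fun _ _ _ => 0) = fun _ _ _ => 0.
  by move=> D0; elim: M => //= M ->.
have D120 : D12 (fun _ _ _ => 0) = fun _ _ _ => 0.
  by apply: funext3 => *; rewrite /D12 subr0.
have D130 : D13 (fun _ _ _ => 0) = fun _ _ _ => 0.
  by apply: funext3 => *; rewrite /D13 subr0.
have D230 : D23 (fun _ _ _ => 0) = fun _ _ _ => 0.
  by apply: funext3 => *; rewrite /D23 subr0.
(* One factor z1 - z2 removes the denominators and leaves E - E' = [[A, B], C]; the other N factors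
   kill [A, B]. *)
have d12 : iter N.+1 D12 d = fun _ _ _ => 0.
  have D12d : D12 d = fun p n q => E p n q - E' p n q.
    apply: funext3 => p' n' q'.
    have /(congr1 (fun T => T p' n' q')) eL := D12_expL oE.
    have /(congr1 (fun T => T p' n' q')) eR := D12_expR oE'.
    by rewrite -[E _ _ _]eL -[- E' _ _ _]eR /D12 /d opprD addrACA.
  rewrite iterSr D12d; apply: funext3 => p' n' q'; rewrite iterD12E.
  rewrite (_ : (fun p n => _) = fun p n => comm A B (C q' w) p n - C q' (comm A B w p n)).
    by rewrite iterD2B iterD2_linear// !hAB (lin0 (lC _)) subrr.
  apply/funext => p''; apply/funext => n''; rewrite /comm (linB _ _ (lC _)).
  by rewrite subr_ACA.
(* E = A[B, C] + [A, C]B: the power of z2 - z3 kills the first term, that of z1 - z3 the second.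
   Likewise E' = B[A, C] + [B, C]A. *)
have d13 : iter N D13 (iter N D23 d) = fun _ _ _ => 0.
  have -> : iter N D23 d = fun p n q => expL (iter N D23 E) p n q + expR (iter N D23 E') p n q.
    rewrite -(proj1 (iterD23_expL N oE)) -(proj1 (iterD23_expR N oE')).
    by apply: funext3 => *; rewrite !iterD23E iterD2D.
  apply: funext3 => p' n' q'; rewrite iterD13E iterD2D -!iterD13E.
  rewrite (proj1 (iterD13_expL N (proj2 (iterD23_expL N oE)))).
  rewrite (proj1 (iterD13_expR N (proj2 (iterD23_expR N oE')))).
  rewrite (_ : iter N D13 (iter N D23 E) = fun _ _ _ => 0); last first.
    pose E1 p n q := A p (comm B C w n q); pose E2 p n q := comm A C (B n w) p q.
    have -> : E = fun p n q => E1 p n q + E2 p n q.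
      by apply: funext3 => *; rewrite /E1 /E2 /comm (linB _ _ (lA _)) addrA subrK.
    have -> : iter N D23 (fun p n q => E1 p n q + E2 p n q) = iter N D23 E2.
      apply: funext3 => *; rewrite !iterD23E iterD2D /E1 iterD2_linear//.
      by rewrite hBC (lin0 (lA _)) add0r.
    rewrite iterD13_comm_D23 [X in iter N D23 X](_ : _ = fun _ _ _ => 0) ?iter0//.
    by apply: funext3 => *; rewrite iterD13E hAC.
  rewrite (_ : iter N D13 (iter N D23 E') = fun _ _ _ => 0); last first.
    pose E1 p n q := B n (comm A C w p q); pose E2 p n q := comm B C (A p w) n q.
    have -> : E' = fun p n q => E1 p n q + E2 p n q.
      by apply: funext3 => *; rewrite /E1 /E2 /comm (linB _ _ (lB _)) addrA subrK.
    rewrite iterD13_comm_D23.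
    have -> : iter N D13 (fun p n q => E1 p n q + E2 p n q) = iter N D13 E2.
      apply: funext3 => *; rewrite !iterD13E iterD2D /E1 iterD2_linear//.
      by rewrite hAC (lin0 (lB _)) add0r.
    rewrite -iterD13_comm_D23 [X in iter N D13 X](_ : _ = fun _ _ _ => 0) ?iter0//.
    by apply: funext3 => *; rewrite iterD23E hBC.
  by rewrite /expL /expR !Sum0// addr0.
have : iter (N.+1 + N) D23 (iter N D23 d) = 0.
  apply: (@iter_nil_sub (int -> int -> int -> V) D12 D13 D23) => //.
  - move=> T; apply: funext3 => p' n' q'; rewrite !fctE /D12 /D13 /D23.
    by rewrite opprB addrC addrA subrK.
  - by move=> T T'; apply: funext3 => p' n' q'; rewrite /D23 /= subr_ACA.
  - move=> T; apply: funext3 => p' n' q'.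
    by rewrite /D12 /D13 subr_ACA.
  - by rewrite iterD12_comm_D23 d12 iter0.
rewrite -iterD addnC => /(congr1 (fun T => T 0 p q)).
by rewrite iterD23E dE.
Qed.

End Dong.
End Locality.

(** * Derivatives and commutators of normal products *)

Section Derivations.
Context {K : comNzRingType} {V : lmodType K}.
Implicit Types (A B C : int -> V -> V).

Definition fderiv A n w : V := - n%:~R *: A (n - 1) w.

Lemma isfield_fderiv A : isfield A -> isfield (fderiv A).
Proof.
move=> [lA tA]; split=> [n|w]; first exact: linear_fscale.
by have [N hN] := tA w; exists (N + 1) => n hn; rewrite /fderiv hN ?scaler0//; lia.
Qed.

Lemma isfield_iter_fderiv k A : isfield A -> isfield (iter k fderiv A).
Proof. by move=> fA; elim: k => //= k; apply: isfield_fderiv. Qed.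

(** By the Leibniz rule (z1 - z2)^(N+1) dF/dz1 = d/dz1 ((z1 - z2)^(N+1) F) - (N+1)(z1 - z2)^N F, so
    one more factor suffices. *)
Lemma local_fderiv A B : isfield B -> local A B -> local (fderiv A) B.
Proof.
move=> [lB _] [N hN]; exists N.+1 => w p q.
pose F := comm A B w; pose d1 (G : int -> int -> V) p q := - p%:~R *: G (p - 1) q.
have -> : comm (fderiv A) B w = d1 F.
  apply/funext => p'; apply/funext => q'.
  by rewrite /comm /d1 /F /comm /fderiv (linZ _ _ (lB _)) -scalerBr.
have D2d1 G : D2 (d1 G) = fun p q => d1 (D2 G) p q - G p q.
  apply/funext => p'; apply/funext => q'; rewrite /D2 /d1 addrK subrK.
  by rewrite intrD opprD scalerDl scalerBr scaleN1r addrAC.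
suff -> : iter N.+1 D2 (d1 F) = fun p q => d1 (iter N.+1 D2 F) p q - (N.+1)%:R *: iter N D2 F p q.
  by rewrite /d1 /= /D2 !hN !(subr0, scaler0).
elim: N {hN} => [|N IH]; first by rewrite /= D2d1; do 2!apply/funext => ?; rewrite scale1r.
rewrite iterS IH; apply/funext => p'; apply/funext => q'; rewrite /D2 subr_ACA.
rewrite -scalerBr -/(D2 (iter N D2 F) p' q') -iterS.
rewrite -/(D2 (d1 (iter N.+1 D2 F)) p' q') D2d1 -addrA; congr (_ + _).
by rewrite -opprD -[in RHS]addn1 natrD scalerDl scale1r addrC.
Qed.

Lemma local_iter_fderiv k A B : isfield B -> local A B -> local (iter k fderiv A) B.
Proof. by move=> fB lAB; elim: k => //= k; apply: local_fderiv. Qed.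

(** Differentiation respects the splitting into A_- and A_+: the mode A_(-1) would enter mode 0 of
    the derivative, but with coefficient 0. Hence the boundary terms of the shifted sums
    disappear. *)
Lemma nprod_fderiv A B : isfield A -> isfield B -> forall n w,
  fderiv (nprod A B) n w = nprod (fderiv A) B n w + nprod A (fderiv B) n w.
Proof.
move=> fA fB n w; have [fA' fB'] := (isfield_fderiv fA, isfield_fderiv fB).
have [[lA _] [lB _]] := (fA, fB).
rewrite /nprod addrACA /fderiv scalerDr; congr (_ + _).
  rewrite -SumZ; last by exact: (evz_Lp _ _ fA fB).
  (* The factor -n is split as j - (n + j): the second part differentiates B, and the first
     differentiates A after a shift of j. *)
  have ej : evz (fun j : nat => j%:R *: A (- 1 - j%:Z) (B (n - 1 + j%:Z) w)).
    by have [N hN] := evz_Lp (n - 1) w fA fB; exists N => j /hN ->; rewrite scaler0.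
  transitivity (Sum (fun j : nat => j%:R *: A (- 1 - j%:Z) (B (n - 1 + j%:Z) w)) + Lp A (fderiv B) n w).
    rewrite -SumD//; last by exact: (evz_Lp _ _ fA fB').
    apply: eq_Sum => j; rewrite /fderiv (linZ _ _ (lA _)) [n + _ - 1]addrAC -scalerDl.
    by congr (_ *: _); rewrite intrD -pmulrn; ring.
  congr (_ + _); rewrite Sum_recl// scale0r add0r; apply: eq_Sum => j.
  rewrite /fderiv; congr (_ *: A _ (B _ _)); try lia.
  by rewrite intrB opprB opprK -natr1 addrC.
rewrite -SumZ; last by exact: (evz_Rp _ _ fA fB).
rewrite /Rp [X in _ = X + _]Sum_recl; last exact: (evz_Rp _ _ fA' fB).
rewrite mulr0z !oppr0 scale0r (lin0 (lB _)) add0r -SumD.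
- apply: eq_Sum => j; rewrite (linZ _ _ (lB _)).
  rewrite (_ : j.+1%:Z - 1 = j); last lia.
  rewrite (_ : n - 1 - j.+1%:Z = n - 1 - 1 - j%:Z); last lia.
  rewrite [n - 1 - j%:Z - 1]addrAC -scalerDl; congr (_ *: _).
  by rewrite -[j.+1]addn1 PoszD !intrD; ring.
- have := evzS (evz_Rp n w fA' fB); apply: eq_evz => j.
  by [].
- exact: (evz_Rp _ _ fA fB').
Qed.

(** X contracts with A at the mode j0 only, which lies in [Lp] if j0 < 0 and in [Rp] otherwise.
    Either way the contraction leaves c B_(n-1-j0). *)
Lemma nprod_commutator (X : V -> V) A B B' (c : K) (j0 : int) :
    linear X -> isfield A -> isfield B -> isfield B' ->
    (forall j w, X (A j w) = A j (X w) + (if j == j0 then c else 0) *: w) ->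
    (forall n w, X (B n w) = B n (X w) + B' n w) ->
  forall n w, X (nprod A B n w)
    = nprod A B n (X w) + nprod A B' n w + c *: B (n - 1 - j0) w.
Proof.
move=> lX fA fB fB' XA XB n w; have [[lA _] [lB _]] := (fA, fB).
have XL : X (Lp A B n w) = Lp A B n (X w) + Lp A B' n w
    + (if j0 < 0 then c else 0) *: B (n - 1 - j0) w.
  rewrite (Sum_lin lX (evz_Lp n w fA fB)).
  pose g (j : nat) := (if - 1 - j%:Z == j0 then c else 0) *: B (n + j%:Z) w.
  have g0 (j : nat) : - 1 - j%:Z != j0 -> g j = 0.
    by rewrite /g => /negbTE ->; rewrite scale0r.
  have eg : evz g by exists (`|j0|.+1)%N => j hj; apply: g0; lia.
  rewrite (eq_Sum (_ : _ =1 (fun j : nat => A (- 1 - j%:Z) (B (n + j%:Z) (X w)) +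
      A (- 1 - j%:Z) (B' (n + j%:Z) w) + g j))); last first.
    by move=> j; rewrite XA XB (linD _ _ (lA _)).
  rewrite SumD// ?SumD; [|by exact: (evz_Lp _ _ fA fB)|by exact: (evz_Lp _ _ fA fB')|].
    congr (_ + _); case: ltP => hj; last by rewrite scale0r; apply: Sum0 => j; apply: g0; lia.
    rewrite (@Sum_single _ _ (`|j0|.-1)%N) /g; last by move=> j; have := g0 j; rewrite /g => h hh; apply: h; lia.
    by rewrite ifT; [congr (_ *: B _ _)|]; lia.
  by apply: evzD; [exact: (evz_Lp _ _ fA fB)|exact: (evz_Lp _ _ fA fB')].
have XR : X (Rp A B n w) = Rp A B n (X w) + Rp A B' n w
    + (if 0 <= j0 then c else 0) *: B (n - 1 - j0) w.
  rewrite (Sum_lin lX (evz_Rp n w fA fB)).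
  pose g (j : nat) := (if j%:Z == j0 then c else 0) *: B (n - 1 - j%:Z) w.
  have g0 (j : nat) : j%:Z != j0 -> g j = 0.
    by rewrite /g => /negbTE ->; rewrite scale0r.
  have eg : evz g by exists (`|j0|.+1)%N => j hj; apply: g0; lia.
  rewrite (eq_Sum (_ : _ =1 (fun j : nat => B (n - 1 - j%:Z) (A j%:Z (X w)) +
      B' (n - 1 - j%:Z) (A j%:Z w) + g j))); last first.
    by move=> j; rewrite XB XA (linD _ _ (lB _)) (linZ _ _ (lB _)) addrAC.
  rewrite SumD// ?SumD; [|by exact: (evz_Rp _ _ fA fB)|by exact: (evz_Rp _ _ fA fB')|].
    congr (_ + _); case: leP => hj; last by rewrite scale0r; apply: Sum0 => j; apply: g0; lia.
    rewrite (@Sum_single _ _ `|j0|%N) /g; last by move=> j; have := g0 j; rewrite /g => h hh; apply: h; lia.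
    by rewrite ifT; [congr (_ *: B _ _)|]; lia.
  by apply: evzD; [exact: (evz_Rp _ _ fA fB)|exact: (evz_Rp _ _ fA fB')].
rewrite /nprod (linD _ _ lX) XL XR addrACA -scalerDl; congr (_ + _ *: _).
  by rewrite addrACA.
by case: ltP; rewrite ?addr0 ?add0r.
Qed.

End Derivations.

(** * The Fock space and the Heisenberg operators *)

Section LatticeForms.
Context {l : nat} (L : even_lattice l).

Lemma ipFDl (F : comNzRingType) (x y z : 'rV[F]_l) :
  ipF L (x + y) z = ipF L x z + ipF L y z.
Proof. by rewrite /ipF !mulmxDl mxE. Qed.

Lemma ipFZl (F : comNzRingType) c (x z : 'rV[F]_l) :
  ipF L (c *: x) z = c * ipF L x z.
Proof. by rewrite /ipF -!scalemxAl mxE. Qed.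

Lemma ipFC (F : comNzRingType) (x y : 'rV[F]_l) : ipF L x y = ipF L y x.
Proof.
have G : (gramF L F)^T = gramF L F by rewrite /gramF map_trmx gram_sym.
rewrite /ipF -[in LHS](trmxK (x *m _ *m _)) [LHS]mxE trmx_mul trmxK trmx_mul G.
by rewrite mulmxA.
Qed.

Lemma ipFDr (F : comNzRingType) (x y z : 'rV[F]_l) :
  ipF L z (x + y) = ipF L z x + ipF L z y.
Proof. by rewrite ipFC ipFDl !(ipFC z). Qed.

Lemma ipFZr (F : comNzRingType) c (x z : 'rV[F]_l) :
  ipF L z (c *: x) = c * ipF L z x.
Proof. by rewrite ipFC ipFZl (ipFC z). Qed.

Lemma ipF0l (F : comNzRingType) (x : 'rV[F]_l) : ipF L 0 x = 0.
Proof. by rewrite -(scale0r 0) ipFZl mul0r. Qed.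

Lemma ipF_suml (F : comNzRingType) I (r : seq I) P (x : I -> 'rV[F]_l) y :
  ipF L (\sum_(i <- r | P i) x i) y = \sum_(i <- r | P i) ipF L (x i) y.
Proof. by elim/big_rec2: _ => [|i u v _ <-]; rewrite ?ipF0l ?ipFDl. Qed.

Lemma ipF_sumr (F : comNzRingType) I (r : seq I) P (x : I -> 'rV[F]_l) y :
  ipF L y (\sum_(i <- r | P i) x i) = \sum_(i <- r | P i) ipF L y (x i).
Proof. by rewrite ipFC ipF_suml; apply: eq_bigr => i _; rewrite ipFC. Qed.

Lemma latFD (F : comNzRingType) (a b : 'rV[int]_l) :
  latF F (a + b) = latF F a + latF F b.
Proof. by rewrite /latF map_mxD. Qed.

Lemma ipF_latF (F : comNzRingType) (a b : 'rV[int]_l) :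
  ipF L (latF F a) (latF F b) = (ip L a b)%:~R.
Proof. by rewrite /ipF /ip /latF /gramF map_trmx -!map_mxM mxE. Qed.

Lemma ipDl a b c : ip L (a + b) c = ip L a c + ip L b c.
Proof. by rewrite /ip !mulmxDl mxE. Qed.

Lemma ipC a b : ip L a b = ip L b a.
Proof.
rewrite /ip -[in LHS](trmxK (a *m _ *m _)) [LHS]mxE trmx_mul trmxK trmx_mul.
by rewrite gram_sym mulmxA.
Qed.

Lemma ipDr a b c : ip L c (a + b) = ip L c a + ip L c b.
Proof. by rewrite ipC ipDl !(ipC c). Qed.

Lemma ip0l a : ip L 0 a = 0.
Proof. by rewrite /ip !mul0mx mxE. Qed.

Lemma ipZl k a b : ip L (k *: a) b = k * ip L a b.
Proof. by rewrite /ip -!scalemxAl mxE. Qed.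

Lemma ipZr k a b : ip L a (k *: b) = k * ip L a b.
Proof. by rewrite ipC ipZl ipC. Qed.

Lemma ip_ge0 a : 0 <= ip L a a.
Proof.
have [->|/(@gram_pos _ L a)/ltW//] := eqVneq a 0.
by rewrite ip0l.
Qed.

(** Positivity is assumed on integral vectors; a singular integral matrix has an integral kernel
    vector, whose norm would be 0. *)
Lemma det_gram_neq0 : \det (gram L) != 0.
Proof.
apply/det0P => -[v v0 vG]; have := @gram_pos _ L _ v0.
by rewrite vG mul0mx mxE ltxx.
Qed.

End LatticeForms.

Section Fock.
Context {l : nat}.
Local Notation mono := (@monomial l).
Implicit Types (m : mono) (x y : 'I_l * nat).

(* Conversion on multisets is slow, hence the locked copies. *)
Definition madd : 'I_l * nat -> mono -> mono := locked (fun x m => x +` m)%mset.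
Definition mdel : 'I_l * nat -> mono -> mono := locked (fun x m => m `\ x)%mset.

Lemma maddE x m y : madd x m y = ((y == x) + m y)%N.
Proof. by rewrite /madd -lock mset1DE. Qed.
Lemma mdelE x m y : mdel x m y = (m y - (y == x))%N.
Proof. by rewrite /mdel -lock msetB1E. Qed.
Lemma madd_unlock x m : madd x m = (x +` m)%mset.
Proof. by rewrite /madd -lock. Qed.
Lemma mdel_unlock x m : mdel x m = (m `\ x)%mset.
Proof. by rewrite /mdel -lock. Qed.

Lemma mset_ind (P : mono -> Prop) : P mset0 ->
  (forall x m, P m -> P (madd x m)) -> forall m, P m.
Proof.
move=> P0 PS m; rewrite -(seq_mset_id m); elim: (enum_mset m : seq _) => [|x s IH].
  suff -> : seq_mset ([::] : seq ('I_l * nat)) = (mset0 : mono) by [].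
  by apply/msetP => x; rewrite mset_seqE mset0E.
by rewrite mset_cons -madd_unlock; apply: PS.
Qed.

Lemma maddC x y m : madd x (madd y m) = madd y (madd x m).
Proof. by apply/msetP => z; rewrite !maddE addnCA. Qed.

Lemma mdelC x y m : mdel x (mdel y m) = mdel y (mdel x m).
Proof. by apply/msetP => z; rewrite !mdelE subnAC. Qed.

Lemma mdelK x m : m x != 0%N -> madd x (mdel x m) = m.
Proof.
move=> mx; apply/msetP => z; rewrite maddE mdelE.
by case: eqP => [->|_]; rewrite ?add0n ?subn0// subnKC// lt0n.
Qed.

Lemma maddK x m : mdel x (madd x m) = m.
Proof. by apply/msetP => z; rewrite mdelE maddE addKn. Qed.

Lemma mdel_madd x y m : x != y -> mdel x (madd y m) = madd y (mdel x m).
Proof.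
move=> xy; apply/msetP => z; rewrite !(mdelE, maddE).
by case: (eqVneq z y) => [->|_]; rewrite ?add0n// eq_sym (negbTE xy) !subn0.
Qed.

Definition ebas {K : numFieldType} (j : 'I_l) : 'rV[K]_l := delta_mx 0 j.

(* The Fock space [M(1) (x) K[L]] seen through its basis [ket m a], the dual
   coordinates [cf m a], linear extension, and the Heisenberg operators. *)
Record fock_space (L : even_lattice l) (K : numFieldType) (V : lmodType K) :=
  FockSpace {
    ket : mono -> 'rV[int]_l -> V;
    cf : mono -> 'rV[int]_l -> V -> K;
    lext : (mono -> 'rV[int]_l -> V) -> V -> V;
    heis : 'rV[K]_l -> int -> V -> V;
    cf_linear : forall m a c u v,
      cf m a (c *: u + v) = c * cf m a u + cf m a v;
    cf_ext : forall u v, (forall m a, cf m a u = cf m a v) -> u = v;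
    cf_ket : forall m a m' a', cf m a (ket m' a') = ((m == m') && (a == a'))%:R;
    ket_ind : forall P : V -> Prop, P 0 ->
      (forall c m a v, cf m a v = 0 -> P v -> P (c *: ket m a + v)) ->
      forall v, P v;
    linear_lext : forall f, linear (lext f);
    lext_ket : forall f m a, lext f (ket m a) = f m a;
    linear_heis : forall h n, linear (heis h n);
    heis_neg_ket : forall h k m a,
      heis h (Negz k) (ket m a) = \sum_j h 0 j *: ket (madd (j, k) m) a;
    heis_zero_ket : forall h m a,
      heis h 0 (ket m a) = ipF L h (latF K a) *: ket m a;
    heis_pos_ket : forall h k m a, heis h k.+1 (ket m a) =
      \sum_j (k.+1%:R * ipF L h (ebas j) * (m (j, k))%:R) *: ket (mdel (j, k) m) a }.
End Fock.

Section Heisenberg.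
Context {l : nat} {L : even_lattice l} {K : numFieldType} {V : lmodType K}.
Variable S : fock_space L V.
Local Notation mono := (@monomial l).
Local Notation H := 'rV[K]_l.
Local Notation ket := (ket S).
Local Notation cf := (cf S).
Local Notation heis := (heis S).
Local Notation bas := (@ebas l K).
Implicit Types (u v w : V) (m : mono) (h : H) (x y : 'I_l * nat) (a b : 'rV[int]_l).

Lemma cf0 m a : cf m a 0 = 0.
Proof. by have := cf_linear S m a (-1) 0 0; rewrite scaler0 addr0 mulN1r addNr. Qed.

Lemma cfD m a u v : cf m a (u + v) = cf m a u + cf m a v.
Proof. by rewrite -[u]scale1r cf_linear mul1r scale1r. Qed.

Lemma cfZ m a c u : cf m a (c *: u) = c * cf m a u.
Proof. by rewrite -[c *: u]addr0 cf_linear cf0 addr0. Qed.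

Lemma cfN m a u : cf m a (- u) = - cf m a u.
Proof. by rewrite -scaleN1r cfZ mulN1r. Qed.

Lemma cfB m a u v : cf m a (u - v) = cf m a u - cf m a v.
Proof. by rewrite cfD cfN. Qed.

Lemma cf_sum m a I (r : seq I) (P : pred I) (F : I -> V) :
  cf m a (\sum_(i <- r | P i) F i) = \sum_(i <- r | P i) cf m a (F i).
Proof. by elim/big_rec2: _ => [|i y x _ <-]; rewrite ?cf0 ?cfD. Qed.

Lemma cf_eq0 v : (forall m a, cf m a v = 0) -> v = 0.
Proof. by move=> v0; apply: (@cf_ext _ _ _ _ S) => m a; rewrite v0 cf0. Qed.

Lemma linear_ket_ext (W : lmodType K) (f g : V -> W) : linear f -> linear g ->
  (forall m a, f (ket m a) = g (ket m a)) -> forall v, f v = g v.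
Proof.
move=> lf lg fg; apply: (@ket_ind _ _ _ _ S) => [|c m a v _ IH]; first by rewrite !lin0.
by rewrite (linD _ _ lf) (linD _ _ lg) (linZ _ _ lf) (linZ _ _ lg) fg IH.
Qed.

(** Multiplication by a variable and the partial derivative in it. The Heisenberg operators are
    combinations of these, and their commutation relations reduce to [ann_crt]. *)
Definition crt x : V -> V := lext S (fun m a => ket (madd x m) a).
Definition ann x : V -> V := lext S (fun m a => (m x)%:R *: ket (mdel x m) a).
Definition zmode h : V -> V := lext S (fun m a => ipF L h (latF K a) *: ket m a).

Lemma linear_crt x : linear (crt x).
Proof. exact: linear_lext. Qed.
Lemma linear_ann x : linear (ann x).
Proof. exact: linear_lext. Qed.
Lemma linear_zmode h : linear (zmode h).
Proof. exact: linear_lext. Qed.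

Lemma crt_ket x m a : crt x (ket m a) = ket (madd x m) a.
Proof. exact: lext_ket. Qed.
Lemma ann_ket x m a : ann x (ket m a) = (m x)%:R *: ket (mdel x m) a.
Proof. exact: lext_ket. Qed.
Lemma zmode_ket h m a : zmode h (ket m a) = ipF L h (latF K a) *: ket m a.
Proof. exact: lext_ket. Qed.

Lemma heis_neg h k v : heis h (Negz k) v = \sum_j h 0 j *: crt (j, k) v.
Proof.
move: v; apply: linear_ket_ext => [||m a]; first exact: linear_heis.
  by apply: linear_fsum => j; apply: linear_fscale; apply: linear_crt.
by rewrite heis_neg_ket; apply: eq_bigr => j _; rewrite crt_ket.
Qed.

Lemma heis_zero h v : heis h 0 v = zmode h v.
Proof.
move: v; apply: linear_ket_ext => [||m a]; first exact: linear_heis.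
  exact: linear_zmode.
by rewrite heis_zero_ket zmode_ket.
Qed.

Lemma heis_pos h k v : heis h k.+1 v =
  \sum_j (k.+1%:R * ipF L h (bas j)) *: ann (j, k) v.
Proof.
move: v; apply: linear_ket_ext => [||m a]; first exact: linear_heis.
  by apply: linear_fsum => j; apply: linear_fscale; apply: linear_ann.
by rewrite heis_pos_ket; apply: eq_bigr => j _; rewrite ann_ket scalerA.
Qed.

Lemma heis_linl n v : linear (fun h => heis h n v).
Proof.
move=> c h h'; case: n => [[|k]|k].
- rewrite !heis_zero; move: v; apply: linear_ket_ext => [||m a]; first exact: linear_zmode.
    by apply: linear_fadd; [apply: linear_fscale|]; exact: linear_zmode.
  by rewrite !zmode_ket ipFDl ipFZl scalerDl scalerA.
- rewrite !heis_pos scaler_sumr -big_split; apply: eq_bigr => j _.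
  by rewrite ipFDl ipFZl mulrDr scalerDl scalerA mulrCA.
- rewrite !heis_neg scaler_sumr -big_split; apply: eq_bigr => j _.
  by rewrite !mxE scalerDl scalerA.
Qed.

Lemma bas_expansion h : h = \sum_j h 0 j *: bas j.
Proof. exact: row_sum_delta. Qed.

Lemma crtC x y v : crt x (crt y v) = crt y (crt x v).
Proof.
move: v; apply: linear_ket_ext => [||m a].
- by apply: linear_fcomp; exact: linear_crt.
- by apply: linear_fcomp; exact: linear_crt.
- by rewrite !crt_ket maddC.
Qed.

Lemma annC x y v : ann x (ann y v) = ann y (ann x v).
Proof.
have [->//|xy] := eqVneq x y.
have lA x' y' := linear_fcomp (linear_ann x') (linear_ann y').
move: v; apply: linear_ket_ext => // m a.
rewrite !ann_ket !(linZ _ _ (linear_ann _)) !ann_ket !scalerA !mdelE.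
by rewrite (negbTE xy) eq_sym (negbTE xy) !subn0 mulrC mdelC.
Qed.

Lemma ann_crt x y v : ann x (crt y v) = crt y (ann x v) + (x == y)%:R *: v.
Proof.
move: v; apply: linear_ket_ext => [||m a].
- by apply: linear_fcomp; [exact: linear_ann|exact: linear_crt].
- apply: linear_fadd; first by apply: linear_fcomp; [exact: linear_crt|exact: linear_ann].
  exact: (@linear_fscale _ _ _ _ idfun).
rewrite crt_ket !ann_ket (linZ _ _ (linear_crt _)) crt_ket maddE.
have [->|xy] := eqVneq x y; last by rewrite add0n scale0r addr0 mdel_madd.
rewrite maddK natrD scalerDl addrC; congr (_ + _).
have [->|my] := eqVneq (m y) 0%N; first by rewrite !scale0r.
by rewrite mdelK.
Qed.

Lemma zmode_crt h x v : zmode h (crt x v) = crt x (zmode h v).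
Proof.
move: v; apply: linear_ket_ext => [||m a].
- by apply: linear_fcomp; [exact: linear_zmode|exact: linear_crt].
- by apply: linear_fcomp; [exact: linear_crt|exact: linear_zmode].
- by rewrite !(crt_ket, zmode_ket) (linZ _ _ (linear_crt _)) crt_ket.
Qed.

Lemma zmode_ann h x v : zmode h (ann x v) = ann x (zmode h v).
Proof.
move: v; apply: linear_ket_ext => [||m a].
- by apply: linear_fcomp; [exact: linear_zmode|exact: linear_ann].
- by apply: linear_fcomp; [exact: linear_ann|exact: linear_zmode].
- rewrite !(ann_ket, zmode_ket) (linZ _ _ (linear_ann _)) (linZ _ _ (linear_zmode _)).
  by rewrite zmode_ket ann_ket !scalerA mulrC.
Qed.

Lemma zmodeC h h' v : zmode h (zmode h' v) = zmode h' (zmode h v).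
Proof.
move: v; apply: linear_ket_ext => [||m a].
- by apply: linear_fcomp; exact: linear_zmode.
- by apply: linear_fcomp; exact: linear_zmode.
- by rewrite !(zmode_ket, linZ _ _ (linear_zmode _)) !scalerA mulrC.
Qed.

(** Only modes of opposite sign contribute. Expanding in the basis, [ann_crt] leaves the diagonal
    terms, and \sum_i (h, b_i) h'_i = (h, h'). *)
Lemma heis_comm h h' (p q : int) v : heis h p (heis h' q v) = heis h' q (heis h p v)
  + (if p + q == 0 then p%:~R * ipF L h h' else 0) *: v.
Proof.
have posneg h1 h2 (k k' : nat) : heis h1 k.+1 (heis h2 (Negz k') v) =
    heis h2 (Negz k') (heis h1 k.+1 v)
    + (if k == k' then k.+1%:R * ipF L h1 h2 else 0) *: v.
  pose g i j := k.+1%:R * ipF L h1 (bas i) * h2 0 j.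
  have -> : heis h1 k.+1 (heis h2 (Negz k') v) =
      \sum_i \sum_j g i j *: (crt (j, k') (ann (i, k) v) + ((i, k) == (j, k'))%:R *: v).
    rewrite (heis_pos h1); apply: eq_bigr => i _.
    rewrite (heis_neg h2) (lin_sum _ _ _ (linear_ann _)) scaler_sumr.
    apply: eq_bigr => j _.
    by rewrite (linZ _ _ (linear_ann _)) scalerA ann_crt.
  have -> : heis h2 (Negz k') (heis h1 k.+1 v) =
      \sum_i \sum_j g i j *: crt (j, k') (ann (i, k) v).
    rewrite exchange_big (heis_neg h2); apply: eq_bigr => j _.
    rewrite (heis_pos h1) (lin_sum _ _ _ (linear_crt _)) scaler_sumr.
    apply: eq_bigr => i _.
    by rewrite (linZ _ _ (linear_crt _)) scalerA mulrC.
  have -> : (if k == k' then k.+1%:R * ipF L h1 h2 else 0) *: v =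
      \sum_i \sum_j g i j *: (((i, k) == (j, k'))%:R *: v).
    have -> : ipF L h1 h2 = \sum_i ipF L h1 (bas i) * h2 0 i.
      rewrite [in LHS](bas_expansion h2) ipF_sumr.
      by apply: eq_bigr => i _; rewrite ipFZr mulrC.
    transitivity ((\sum_i (if k == k' then g i i else 0)) *: v).
      apply: (congr1 (fun c => c *: v)); case: eqP => _; last by rewrite big1.
      by rewrite mulr_sumr; apply: eq_bigr => i _; rewrite mulrA.
    rewrite scaler_suml; apply: eq_bigr => i _.
    rewrite (bigD1 i)//= big1 => [|j ji]; rewrite -pair_eqE /=.
      by rewrite eqxx addr0 scalerA; case: eqP; rewrite ?mulr1 ?mulr0.
    by rewrite eq_sym (negbTE ji) scale0r scaler0.
  rewrite -big_split; apply: eq_bigr => i _; rewrite -big_split.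
  by apply: eq_bigr => j _; rewrite scalerDr.
have lc x := linear_crt x; have la x := linear_ann x.
case: p q => [[|k]|k] [[|k']|k'].
- rewrite [X in _ + X](_ : _ = 0) ?addr0; last by case: (_ == 0); rewrite ?mulr0z ?mul0r scale0r.
  by rewrite !heis_zero zmodeC.
- rewrite [X in _ + X](_ : _ = 0) ?addr0; last by case: (_ == 0); rewrite ?mulr0z ?mul0r scale0r.
  rewrite !heis_zero !heis_pos (lin_sum _ _ _ (linear_zmode h)).
  apply: eq_bigr => j _.
  by rewrite (linZ _ _ (linear_zmode _)) zmode_ann.
- rewrite [X in _ + X](_ : _ = 0) ?addr0; last by case: (_ == 0); rewrite ?mulr0z ?mul0r scale0r.
  rewrite !heis_zero !heis_neg (lin_sum _ _ _ (linear_zmode h)).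
  apply: eq_bigr => j _.
  by rewrite (linZ _ _ (linear_zmode _)) zmode_crt.
- rewrite addr0 scale0r addr0 !heis_zero !heis_pos (lin_sum _ _ _ (linear_zmode h')).
  apply: eq_bigr => j _.
  by rewrite (linZ _ _ (linear_zmode _)) zmode_ann.
- rewrite [X in _ + X](_ : _ = 0) ?addr0; last first.
    by rewrite (_ : (_ == 0) = false) ?scale0r//; lia.
  have E h1 h2 k1 k2 : heis h1 k1.+1 (heis h2 k2.+1 v) = \sum_i \sum_j
      (k1.+1%:R * ipF L h1 (bas i) * (k2.+1%:R * ipF L h2 (bas j))) *:
        ann (i, k1) (ann (j, k2) v).
    rewrite (heis_pos h1); apply: eq_bigr => i _.
    rewrite (heis_pos h2) (lin_sum _ _ _ (la _)) scaler_sumr.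
    by apply: eq_bigr => j _; rewrite (linZ _ _ (la _)) scalerA.
  rewrite !E exchange_big; apply: eq_bigr => j _; apply: eq_bigr => i _.
  by rewrite annC mulrC.
- rewrite posneg; congr (_ + _ *: _).
  have -> : (k.+1%:Z + Negz k' == 0) = (k == k') by lia.
  by [].
- rewrite addr0 scale0r addr0 !heis_zero !heis_neg (lin_sum _ _ _ (linear_zmode h')).
  apply: eq_bigr => j _.
  by rewrite (linZ _ _ (linear_zmode _)) zmode_crt.
- rewrite posneg -addrA -scalerDl.
  have -> : (Negz k + k'.+1%:Z == 0) = (k' == k) by lia.
  case: eqP => [->|_]; rewrite ?addr0 ?scale0r ?addr0// ipFC.
  by rewrite NegzE mulrNz mulNr subrr scale0r addr0.
- rewrite [X in _ + X](_ : _ = 0) ?addr0; last first.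
    by rewrite (_ : (_ == 0) = false) ?scale0r//; lia.
  have E h1 h2 k1 k2 : heis h1 (Negz k1) (heis h2 (Negz k2) v) = \sum_i \sum_j
      (h1 0 i * h2 0 j) *: crt (i, k1) (crt (j, k2) v).
    rewrite (heis_neg h1); apply: eq_bigr => i _.
    rewrite (heis_neg h2) (lin_sum _ _ _ (lc _)) scaler_sumr.
    by apply: eq_bigr => j _; rewrite (linZ _ _ (lc _)) scalerA.
  rewrite !E exchange_big; apply: eq_bigr => j _; apply: eq_bigr => i _.
  by rewrite crtC mulrC.
Qed.

End Heisenberg.

Section MonomialSize.
Context {l : nat}.
Local Notation mono := (@monomial l).
Implicit Types (m : mono) (x y : 'I_l * nat).

Lemma perm_madd x m : perm_eq (enum_mset (madd x m)) (x :: enum_mset m).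
Proof.
rewrite madd_unlock -[in X in perm_eq X _](seq_mset_id m) -mset_cons.
exact: perm_eq_seq_mset.
Qed.

(** The eigenvalue of L(0) on the monomial applied to the vacuum: b_i(-n-1) raises it by n + 1. *)
Definition msize m : nat := \sum_(x <- enum_mset m) x.2.+1.

Lemma msize_madd x m : msize (madd x m) = (x.2.+1 + msize m)%N.
Proof. by rewrite /msize (perm_big _ (perm_madd x m)) big_cons. Qed.

Lemma msize0 : msize (mset0 : mono) = 0%N.
Proof. by rewrite /msize enum_mset0 big_nil. Qed.

Lemma msize_mdel x m : m x != 0%N -> msize m = (x.2.+1 + msize (mdel x m))%N.
Proof. by move=> mx; rewrite -msize_madd mdelK. Qed.

Lemma madd_neq0 x m : madd x m != mset0.
Proof. by apply/eqP => /msetP /(_ x); rewrite maddE eqxx mset0E. Qed.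

End MonomialSize.

(** * Homogeneous vectors and detection on the vacua *)

Section Detection.
Context {l : nat} {L : even_lattice l} {K : numFieldType} {V : lmodType K}.
Variable S : fock_space L V.
Local Notation mono := (@monomial l).
Local Notation H := 'rV[K]_l.
Local Notation ket := (ket S).
Local Notation cf := (cf S).
Local Notation heis := (heis S).
Local Notation bas := (@ebas l K).
Implicit Types (u v w : V) (m : mono) (h : H) (x y : 'I_l * nat) (a b : 'rV[int]_l).

Lemma gramF_unit : gramF L K \in unitmx.
Proof.
rewrite unitmxE /gramF det_map_mx unitfE intr_eq0; exact: det_gram_neq0.
Qed.

Definition dual_bas (j : 'I_l) : H := row j (invmx (gramF L K)).

Lemma ipF_dual_bas i j : ipF L (dual_bas i) (bas j) = (i == j)%:R.
Proof.
rewrite /ipF /dual_bas /ebas -row_mul mulVmx ?gramF_unit// row1 trmx_delta.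
by rewrite -colE !mxE eqxx /= eq_sym.
Qed.

(** The degree is an integer, so that operators shift it without side conditions. A negative degree
    forces v = 0, and this is the source of all truncation statements. *)
Definition homog (d : int) a v := forall m b, cf m b v != 0 -> b = a /\ (msize m)%:Z = d.

Lemma homog_ket m a : homog (msize m) a (ket m a).
Proof.
move=> m' b; rewrite cf_ket.
by case: (eqVneq m' m) => [->|_]; case: (eqVneq b a) => [->|_]//=; rewrite eqxx.
Qed.

Lemma homog0 d a : homog d a 0.
Proof. by move=> m b; rewrite cf0 eqxx. Qed.

Lemma homogD d a u v : homog d a u -> homog d a v -> homog d a (u + v).
Proof.
move=> hu hv m b; rewrite cfD; have [u0|/hu//] := eqVneq (cf m b u) 0.
by rewrite u0 add0r => /hv.
Qed.

Lemma homogZ d a c u : homog d a u -> homog d a (c *: u).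
Proof. by move=> hu m b; rewrite cfZ mulf_eq0 negb_or => /andP[_ /hu]. Qed.

Lemma homog_sum d a I (r : seq I) (P : pred I) (F : I -> V) :
  (forall i, homog d a (F i)) -> homog d a (\sum_(i <- r | P i) F i).
Proof. by move=> hF; elim/big_rec: _ => [|i u _ hu]; [exact: homog0|exact: homogD]. Qed.

Lemma homog_Sum d a (f : nat -> V) : evz f -> (forall i, homog d a (f i)) -> homog d a (Sum f).
Proof. by move=> [N fN] hf; rewrite (SumE fN); apply: homog_sum. Qed.

Lemma homog_lt0 d a v : d < 0 -> homog d a v -> v = 0.
Proof.
move=> d0 hv; apply: (cf_eq0 (S:=S)) => m b; apply/eqP/negPn/negP => /hv[_ md].
by move: d0; rewrite -md.
Qed.

(** The side condition [cf m a v = 0] of [ket_ind] serves here: nothing cancels between the new term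
    and [v], so both inherit homogeneity. *)
Lemma homog_split c m a v d b : cf m a v = 0 -> homog d b (c *: ket m a + v) ->
  homog d b v /\ (c != 0 -> b = a /\ (msize m)%:Z = d).
Proof.
move=> v0 hv; split=> [m' a' hm|c0].
  have [/andP[/eqP mm /eqP aa]|mm] := boolP ((m' == m) && (a' == a)).
    by move: hm; rewrite mm aa v0 eqxx.
  by apply: hv; rewrite cfD cfZ cf_ket (negbTE mm) mulr0 add0r.
have /hv[-> //] : cf m a (c *: ket m a + v) != 0.
by rewrite cfD cfZ cf_ket !eqxx mulr1 v0 addr0.
Qed.

Lemma homog_linear (f : V -> V) d a d' a' : linear f ->
    (forall m, (msize m)%:Z = d -> homog d' a' (f (ket m a))) ->
  forall v, homog d a v -> homog d' a' (f v).
Proof.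
move=> lf fk; apply: (@ket_ind _ _ _ _ S) => [_|c m b v v0 IH hv].
  by rewrite lin0//; exact: homog0.
have [hv' hc] := homog_split v0 hv; rewrite (linD _ _ lf) (linZ _ _ lf).
apply: homogD; last exact: IH.
have [->|/hc[<- md]] := eqVneq c 0; first by rewrite scale0r; exact: homog0.
by apply: homogZ; exact: fk.
Qed.

Lemma homog_linear_eq (f g : V -> V) d a : linear f -> linear g ->
    (forall m, f (ket m a) = g (ket m a)) ->
  forall v, homog d a v -> f v = g v.
Proof.
move=> lf lg fg; apply: (@ket_ind _ _ _ _ S) => [_|c m b v v0 IH hv].
  by rewrite !lin0.
have [hv' hc] := homog_split v0 hv.
rewrite (linD _ _ lf) (linZ _ _ lf) (linD _ _ lg) (linZ _ _ lg) IH//.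
have [->|/hc[<- _]] := eqVneq c 0; first by rewrite !scale0r.
by rewrite fg.
Qed.

Lemma homog_heis h n d a v : homog d a v -> homog (d - n) a (heis h n v).
Proof.
apply: homog_linear => [|m <-]; first exact: linear_heis.
case: n => [[|k]|k].
- by rewrite heis_zero_ket subr0; apply/homogZ/homog_ket.
- rewrite heis_pos_ket; apply: homog_sum => j.
  have [->|mx] := eqVneq (m (j, k)) 0%N; first by rewrite mulr0 scale0r; exact: homog0.
  apply: homogZ; rewrite (msize_mdel mx) (_ : _ - _ = (msize (mdel (j, k) m))%:Z) /=; last lia.
  exact: homog_ket.
- rewrite heis_neg_ket; apply: homog_sum => j; apply: homogZ.
  rewrite (_ : _ - _ = (msize (madd (j, k) m))%:Z); first exact: homog_ket.
  by rewrite msize_madd /=; lia.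
Qed.

Lemma heis_zero_homog h d a v : homog d a v -> heis h 0 v = ipF L h (latF K a) *: v.
Proof.
apply: (homog_linear_eq (f := heis h 0) (g := fun v => _ *: v)).
- exact: linear_heis.
- exact: (@linear_fscale _ _ _ _ idfun).
- by move=> m; rewrite heis_zero_ket.
Qed.

Lemma heis_cre_ket x m a : heis (bas x.1) (Negz x.2) (ket m a) = ket (madd x m) a.
Proof.
rewrite heis_neg_ket (bigD1 x.1)//= big1 => [|j jx].
  by rewrite !mxE !eqxx scale1r addr0 -surjective_pairing.
by rewrite !mxE (negbTE jx) andbF scale0r.
Qed.

Lemma heis_pos_vac h k a : heis h k.+1 (ket mset0 a) = 0.
Proof. by rewrite heis_pos_ket big1 // => j _; rewrite mset0E mulr0 scale0r. Qed.

Lemma isfield_ket (F : int -> V -> V) : (forall n, linear (F n)) ->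
    (forall m a, exists N : int, forall n, N <= n -> F n (ket m a) = 0) ->
  isfield F.
Proof.
move=> lF tF; split => //; apply: (@ket_ind _ _ _ _ S) => [|c m a v _ [N hN]].
  by exists 0 => n _; rewrite lin0.
have [M hM] := tF m a; exists (Num.max M N) => n; rewrite ge_max => /andP[? ?].
by rewrite (linD _ _ (lF n)) (linZ _ _ (lF n)) hM ?hN// scaler0 addr0.
Qed.

Lemma isfield_heis h : isfield (heis h).
Proof.
apply: isfield_ket => [n|m a]; first exact: linear_heis.
exists (msize m + 1)%N%:Z => n hn.
by apply: (homog_lt0 _ (@homog_heis h n _ _ _ (@homog_ket m a))); lia.
Qed.

Lemma cf_vac_heis_neg h k a v : cf mset0 a (heis h (Negz k) v) = 0.
Proof.
move: v; apply: (@ket_ind _ _ _ _ S) => [|c m b v _ IH].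
  by rewrite (lin0 (linear_heis _ _ _)) cf0.
have lh := linear_heis S h (Negz k).
rewrite (linD _ _ lh) (linZ _ _ lh) cfD cfZ IH addr0 heis_neg_ket cf_sum.
rewrite big1 ?mulr0// => j _; rewrite cfZ cf_ket eq_sym.
by rewrite (negbTE (madd_neq0 _ _)) mulr0.
Qed.

(** On polynomials this operator is k + 1 times the derivative in the variable (j, k), so it reads
    off the coordinate one variable higher, with a factor that is nonzero in characteristic 0. *)
Lemma cf_dual_heis j k m a v : cf m a (heis (dual_bas j) k.+1 v) =
  k.+1%:R * (m (j, k)).+1%:R * cf (madd (j, k) m) a v.
Proof.
move: v; apply: (@ket_ind _ _ _ _ S) => [|c m' b v _ IH].
  by rewrite (lin0 (linear_heis _ _ _)) !cf0 mulr0.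
have lh := linear_heis S (dual_bas j) k.+1.
rewrite (linD _ _ lh) (linZ _ _ lh) !cfD !cfZ IH mulrDr; congr (_ + _).
rewrite mulrCA; congr (_ * _); rewrite heis_pos_ket (bigD1 j)//= big1 => [|i ij].
  rewrite addr0 cfZ !cf_ket ipF_dual_bas eqxx mulr1 -!mulrA; congr (_ * _).
  have [m0|m0] := eqVneq (m' (j, k)) 0%N.
    rewrite m0 mul0r; case: eqP => [mm|]; last by rewrite mulr0.
    by move: m0; rewrite -mm maddE eqxx.
  have -> : (m == mdel (j, k) m') = (madd (j, k) m == m').
    apply/eqP/eqP => [->|<-]; first exact: mdelK.
    by rewrite maddK.
  by case: eqP => [<-|]; rewrite ?mulr0 //= maddE eqxx add1n.
by rewrite ipF_dual_bas eq_sym (negbTE ij) mulr0 mul0r scale0r.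
Qed.

(** By [cf_dual_heis], a coordinate at [madd (j, k) m] is a nonzero multiple of a coordinate at [m]
    of another combination of the family. Two summands are allowed because commuting past two vertex
    operators can shift either index. *)
Lemma vacuum_detection I (v : I -> V) :
    (forall i a, cf mset0 a (v i) = 0) ->
    (forall i h k, exists i1 i2 c1 c2, heis h k.+1 (v i) = c1 *: v i1 + c2 *: v i2) ->
  forall i, v i = 0.
Proof.
move=> v0 vh i; apply: (cf_eq0 (S:=S)) => m a; move: m i.
apply: mset_ind => [//|[j k] m IH] i.
have [i1 [i2 [c1 [c2 e]]]] := vh i (dual_bas j) k.
have := cf_dual_heis j k m a (v i); rewrite e cfD !cfZ !IH !mulr0 addr0 => /esym/eqP.
by rewrite mulf_eq0 mulf_eq0 !pnatr_eq0 /= => /eqP.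
Qed.

(** The common kernel of the family contains the vacua and is stable under the creation operators,
    which generate every basis vector from them. *)
Lemma creation_ext I (X : I -> V -> V) : (forall i, linear (X i)) ->
    (forall i a, X i (ket mset0 a) = 0) ->
    (forall h n w, (forall i, X i w = 0) -> forall i, X i (heis h n w) = 0) ->
  forall i w, X i w = 0.
Proof.
move=> lX X0 Xh i w; apply: (linear_ket_ext (S:=S) (g := fun=> 0)) => //.
  by move=> c u v; rewrite scaler0 addr0.
move=> m a; move: m i.
apply: mset_ind => [//|x m IH] i.
by rewrite -heis_cre_ket Xh.
Qed.

End Detection.

Arguments homog_ket {l L K V} S m a.
Arguments homog_heis {l L K V S} h n {d a v}.
Arguments isfield_heis {l L K V} S h.

(** * Vertex operators *)

Section Exponentials.
Context {K : numFieldType} {V : lmodType K}.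
Implicit Types (A : nat -> V -> V) (w : V).

(* [series_pow] and [exp_coef] over an arbitrary module. *)
Fixpoint spow A (j k : nat) : V -> V :=
  match j with
  | 0 => fun w => if k == 0%N then w else 0
  | j'.+1 => fun w => \sum_(1 <= n < k.+1) A n (spow A j' (k - n) w)
  end.

Definition expc A k w : V := \sum_(j < k.+1) (j`!%:R^-1 : K) *: spow A j k w.

Lemma linear_spow A j k : (forall n, linear (A n)) -> linear (spow A j k).
Proof.
move=> lA; elim: j k => [|j IH] k /=.
  by case: eqP => _ c u v; rewrite ?scaler0 ?addr0.
by apply: linear_fsum => n; apply: linear_fcomp.
Qed.

Lemma linear_expc A k : (forall n, linear (A n)) -> linear (expc A k).
Proof.
by move=> lA; apply: linear_fsum => j; apply: linear_fscale; apply: linear_spow.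
Qed.

(** The series starts in degree 1, so its j-th power starts in degree j. Hence the sum defining
    [expc] may be extended to any larger range. *)
Lemma spow_gt A j k w : (forall n, linear (A n)) -> (k < j)%N -> spow A j k w = 0.
Proof.
move=> lA; elim: j k => //= j IH k kj; rewrite big_nat big1// => n hn.
by rewrite IH ?lin0//; lia.
Qed.

Lemma expc_widen A k M w : (forall n, linear (A n)) -> (k < M)%N ->
  expc A k w = \sum_(j < M) (j`!%:R^-1 : K) *: spow A j k w.
Proof.
move=> lA kM; rewrite /expc (big_ord_widen M (fun j => (j`!%:R^-1 : K) *: spow A j k w))//.
rewrite big_mkcond; apply: eq_bigr => j _; case: ltnP => // kj.
by rewrite spow_gt// scaler0.
Qed.

Lemma expc0 A w : expc A 0 w = w.
Proof. by rewrite /expc big_ord1 /= fact0 invr1 scale1r. Qed.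

(** Leibniz rule for the j + 1 factors: the scalar c z^m0 is pulled out of each of them. *)
Lemma spow_commutator (X : V -> V) A (c : K) m0 : linear X ->
    (forall n, linear (A n)) -> (0 < m0)%N ->
    (forall n w, X (A n w) = A n (X w) + (if n == m0 then c else 0) *: w) ->
  forall j k w, X (spow A j.+1 k w) = spow A j.+1 k (X w)
    + (j.+1%:R * c) *: (if (m0 <= k)%N then spow A j (k - m0) w else 0).
Proof.
move=> lX lA m0_gt0 XA; have lS j k := linear_spow j k lA.
have delta j k w : \sum_(1 <= n < k.+1) (if n == m0 then c else 0) *: spow A j (k - n) w
    = c *: (if (m0 <= k)%N then spow A j (k - m0) w else 0).
  case: leqP => mk; last first.
    rewrite scaler0 big_nat big1// => n hn; rewrite ifF ?scale0r//.
    by apply/eqP => nm; move: hn mk; rewrite nm; lia.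
  rewrite (bigD1_seq m0) ?iota_uniq ?mem_index_iota ?m0_gt0 ?ltnS//= eqxx.
  by rewrite big1 ?addr0// => n /negbTE ->; rewrite scale0r.
elim=> [|j IH] k w; rewrite [spow A _ k w]/= [spow A _ k (X w)]/= (lin_sum _ _ _ lX).
  rewrite mul1r -(delta 0%N k w) -big_split; apply: eq_bigr => n _ /=.
  rewrite XA; congr (A n _ + _); case: ifP => // _; exact: lin0.
rewrite [RHS](_ : _ = \sum_(1 <= n < k.+1) (A n (spow A j.+1 (k - n) (X w))
   + A n ((j.+1%:R * c) *: (if (m0 <= k - n)%N then spow A j (k - n - m0) w else 0))
   + (if n == m0 then c else 0) *: spow A j.+1 (k - n) w)).
  by apply: eq_bigr => n _; rewrite XA IH (linD _ _ (lA n)).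
have bs (F G : nat -> V) : \sum_(1 <= n < k.+1) (F n + G n)
    = \sum_(1 <= n < k.+1) F n + \sum_(1 <= n < k.+1) G n by rewrite big_split.
rewrite !bs delta -addrA; cbv beta; congr (_ + _).
rewrite -[j.+2]addn1 natrD mulrDl mul1r scalerDl; congr (_ + _).
case: leqP => mk; last first.
  rewrite scaler0 big_nat big1// => n hn; rewrite ifF ?scaler0 ?lin0//.
  by apply/negbTE; lia.
pose F n := A n ((j.+1%:R * c) *: (if (m0 <= k - n)%N then spow A j (k - n - m0) w else 0)).
(* For n > k - m0 the test m0 <= k - n fails, so the second sum is 0. *)
symmetry; transitivity (\sum_(1 <= n < (k - m0).+1) F n + \sum_((k - m0).+1 <= n < k.+1) F n).
  by rewrite -big_cat_nat//; lia.
rewrite [X in _ + X = _]big_nat [X in _ + X = _]big1 ?addr0; last first.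
  by move=> n hn; rewrite /F ifF ?scaler0 ?lin0//; apply/negbTE; lia.
rewrite [spow A j.+1 _ w]/= scaler_sumr big_nat [RHS]big_nat; apply: eq_bigr => n hn.
rewrite /F ifT; last by lia.
by rewrite (linZ _ _ (lA n)); congr (_ *: A n (spow A j _ w)); lia.
Qed.

(** Since (j+1)/(j+1)! = 1/j!, the Leibniz rule for powers sums to [X, exp A] = c z^m0 exp A. *)
Lemma expc_commutator (X : V -> V) A (c : K) m0 : linear X ->
    (forall n, linear (A n)) -> (0 < m0)%N ->
    (forall n w, X (A n w) = A n (X w) + (if n == m0 then c else 0) *: w) ->
  forall k w, X (expc A k w) = expc A k (X w)
    + c *: (if (m0 <= k)%N then expc A (k - m0) w else 0).
Proof.
move=> lX lA m0_gt0 XA k w.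
rewrite !(expc_widen _ lA (ltnSn k)) (lin_sum _ _ _ lX) !big_ord_recl.
rewrite (linZ _ _ lX) -addrA; congr (_ + _).
  by congr (_ *: _) => /=; case: eqP; rewrite ?lin0.
rewrite (eq_bigr (fun j : 'I_k => ((j.+1)`!%:R^-1 : K) *: spow A j.+1 k (X w)
   + c *: ((j`!%:R^-1 : K) *: (if (m0 <= k)%N then spow A j (k - m0) w else 0)))).
  rewrite big_split -scaler_sumr; congr (_ + _ *: _); case: leqP => mk.
    by rewrite (@expc_widen _ _ k)//; lia.
  by rewrite big1// => j _; rewrite scaler0.
move=> j _; rewrite (linZ _ _ lX) (spow_commutator lX lA m0_gt0 XA) scalerDr !scalerA.
congr (_ + _ *: _); rewrite /bump /= ?add1n factS natrM invfM.
have j0 : j.+1%:R != 0 :> K by rewrite pnatr_eq0.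
by rewrite mulrACA mulVf// mul1r mulrC.
Qed.

Lemma expc_commute (X : V -> V) A : linear X -> (forall n, linear (A n)) ->
    (forall n w, X (A n w) = A n (X w)) ->
  forall k w, X (expc A k w) = expc A k (X w).
Proof.
move=> lX lA XA k w; rewrite (@expc_commutator X A 0 1)//.
  by rewrite scale0r addr0.
by move=> n u; rewrite if_same scale0r addr0.
Qed.

End Exponentials.

Lemma Sum_shift (K : comNzRingType) (V : lmodType K) (f : nat -> V) s : evz f ->
  Sum (fun q => if (s <= q)%N then f (q - s)%N else 0) = Sum f.
Proof.
move=> [N fN]; rewrite (SumE fN) (@SumE _ _ (N + s)); last first.
  by move=> j hj; case: ifP => // _; apply: fN; lia.
rewrite addnC big_split_ord /= big1 ?add0r => [|i _]; last by rewrite leqNgt ltn_ord.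
by apply: eq_bigr => i _; rewrite leq_addr addKn.
Qed.

Section VertexOperators.
Context {l : nat} {L : even_lattice l} {K : numFieldType} {V : lmodType K}.
Variable S : fock_space L V.
Variable eps : 'rV[int]_l -> 'rV[int]_l -> int.
Local Notation mono := (@monomial l).
Local Notation H := 'rV[K]_l.
Local Notation ket := (ket S).
Local Notation heis := (heis S).
Local Notation lat := (latF K).
Local Notation homog := (homog S).
Implicit Types (u v w : V) (m : mono) (h : H) (x y : 'I_l * nat) (a b : 'rV[int]_l).

Definition em_arg a n w : V := n%:R^-1 *: heis (lat a) (- n%:Z) w.
Definition ep_arg a n w : V := - n%:R^-1 *: heis (lat a) n%:Z w.
Definition em a := expc (em_arg a).
Definition ep a := expc (ep_arg a).
(** Extended by 0 to negative exponents, so that index shifts need no case distinction. *)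
Definition emz a (z : int) w : V := if z is Posz k then em a k w else 0.

Let lin_em_arg a n : linear (em_arg a n).
Proof. by apply: linear_fscale; exact: linear_heis. Qed.
Let lin_ep_arg a n : linear (ep_arg a n).
Proof. by apply: linear_fscale; exact: linear_heis. Qed.

Lemma linear_ep a q : linear (ep a q).
Proof. exact: linear_expc. Qed.

Lemma linear_emz a z : linear (emz a z).
Proof.
case: z => k; first exact: linear_expc.
by move=> c u v; rewrite /= scaler0 addr0.
Qed.

(** h(k+1) meets only the term a(-k-1)/(k+1) of the exponent, and (k+1)(h,a)/(k+1) = (h,a). *)
Lemma heis_emz_pos a h k z w : heis h k.+1 (emz a z w) =
  emz a z (heis h k.+1 w) + ipF L h (lat a) *: emz a (z - k.+1%:Z) w.
Proof.
have c n u : heis h k.+1 (em_arg a n u) = em_arg a n (heis h k.+1 u)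
    + (if n == k.+1 then ipF L h (lat a) else 0) *: u.
  rewrite /em_arg (linZ _ _ (linear_heis _ _ _)) heis_comm scalerDr scalerA; congr (_ + _ *: _).
  have -> : (k.+1%:Z - n%:Z == 0) = (n == k.+1) by lia.
  case: eqP => [->|_]; last by rewrite mulr0.
  by rewrite mulrA mulVf ?mul1r// pnatr_eq0.
case: z => z; last first.
  rewrite (lin0 (linear_heis _ _ _)) (_ : Negz z - k.+1%:Z = Negz (z + k.+1)); last lia.
  by rewrite scaler0 addr0.
rewrite [LHS](expc_commutator (linear_heis S h k.+1) (lin_em_arg a) (ltn0Sn k) c).
congr (_ + _ *: _); case: ltnP => hz; first by rewrite subzn.
by rewrite (_ : z%:Z - k.+1%:Z = Negz (k - z)); last lia.
Qed.

Lemma heis_ep_neg a h k q w : heis h (Negz k) (ep a q w) =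
  ep a q (heis h (Negz k) w)
  + ipF L h (lat a) *: (if (k < q)%N then ep a (q - k.+1) w else 0).
Proof.
apply: (expc_commutator (linear_heis S h (Negz k)) (lin_ep_arg a) (ltn0Sn k)) => n u.
rewrite /ep_arg (linZ _ _ (linear_heis _ _ _)) heis_comm scalerDr scalerA; congr (_ + _ *: _).
have -> : (Negz k + n%:Z == 0) = (n == k.+1) by lia.
case: eqP => [->|_]; last by rewrite mulr0.
by rewrite NegzE mulrNz mulrA mulrNN mulVf ?mul1r// pnatr_eq0.
Qed.

Lemma heis_emz_npos a h n z w : n <= 0 -> heis h n (emz a z w) = emz a z (heis h n w).
Proof.
move=> n0; case: z => z; last by rewrite (lin0 (linear_heis _ _ _)).
apply: expc_commute => // [|k u]; first exact: linear_heis.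
rewrite /em_arg (linZ _ _ (linear_heis _ _ _)) heis_comm.
(* [expc_commute] asks for every k; at k = 0 the exponent term is 0 because 0^-1 = 0. *)
have [->|k0] := eqVneq k 0%N; first by rewrite invr0 !scale0r.
by rewrite (_ : (n - k%:Z == 0) = false) ?scale0r ?addr0//; lia.
Qed.

Lemma heis_ep_nneg a h n q w : 0 <= n -> heis h n (ep a q w) = ep a q (heis h n w).
Proof.
move=> n0; apply: expc_commute => // [|k u]; first exact: linear_heis.
rewrite /ep_arg (linZ _ _ (linear_heis _ _ _)) heis_comm.
have [->|k0] := eqVneq k 0%N; first by rewrite invr0 oppr0 !scale0r.
by rewrite (_ : (n + k%:Z == 0) = false) ?scale0r ?addr0//; lia.
Qed.

Lemma homog_expc (A : nat -> V -> V) (s : int) b :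
    (forall n d w, homog d b w -> homog (d + s * n%:Z) b (A n w)) ->
  forall k d w, homog d b w -> homog (d + s * k%:Z) b (expc A k w).
Proof.
move=> hA k d w hw; apply: homog_sum => j; apply: homogZ.
move: (nat_of_ord j) => {j} i; elim: i k => [|i IH] k /=.
  by case: eqP => [->|_]; [rewrite mulr0 addr0|exact: homog0].
rewrite big_nat; elim/big_rec: _ => [|n u hn hu]; first exact: homog0.
apply: homogD => //.
rewrite (_ : d + s * k%:Z = d + s * (k - n)%N%:Z + s * n%:Z); first exact: hA.
by rewrite -addrA -mulrDr -PoszD subnK//; lia.
Qed.

Lemma homog_emz a z d b w : homog d b w -> homog (d + z) b (emz a z w).
Proof.
move=> hw; case: z => z; last exact: homog0.
rewrite -[X in d + X]mul1r; apply: (@homog_expc (em_arg a)) => // n d' u hu.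
apply: homogZ; rewrite mul1r -[X in d' + X]opprK; exact: homog_heis.
Qed.

Arguments homog_emz a z {d b w}.

Lemma homog_ep a q d b w : homog d b w -> homog (d - q%:Z) b (ep a q w).
Proof.
move=> hw; rewrite -[q%:Z]mul1r -mulNr.
apply: (@homog_expc (ep_arg a)) => // n d' u hu.
by apply: homogZ; rewrite mulN1r; exact: homog_heis.
Qed.

Arguments homog_ep a q {d b w}.

Lemma emz0 a w : emz a 0 w = w. Proof. exact: expc0. Qed.
Lemma ep0 a w : ep a 0 w = w. Proof. exact: expc0. Qed.

Lemma ep_ket_eq0 a q m b : (msize m < q)%N -> ep a q (ket m b) = 0.
Proof. by move=> mq; apply: (homog_lt0 _ (homog_ep a q (homog_ket S m b))); lia. Qed.

Lemma evz_ep a w : evz (fun q => ep a q w).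
Proof.
move: w; apply: (@ket_ind _ _ _ _ S) => [|c m b v _ [N hN]].
  by exists 0%N => j _; rewrite lin0//; exact: linear_ep.
exists (maxn (msize m).+1 N) => j; rewrite geq_max => /andP[h1 h2].
have le := linear_ep a j.
by rewrite (linD _ _ le) (linZ _ _ le) ep_ket_eq0// hN// scaler0 addr0.
Qed.

Definition shift a : V -> V := lext S (fun m b => ket m (a + b)).

Lemma linear_shift a : linear (shift a).
Proof. exact: linear_lext. Qed.

Lemma shift_ket a m b : shift a (ket m b) = ket m (a + b).
Proof. exact: lext_ket. Qed.

Lemma heis_shift a h n w : n != 0 -> heis h n (shift a w) = shift a (heis h n w).
Proof.
move=> n0; have ls := linear_shift a; have lh := linear_heis S h n.
move: w; apply: (linear_ket_ext (S := S)) => [||m b]; try exact: linear_fcomp.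
rewrite shift_ket; case: n n0 {lh} => [[//|k]|k] _.
  rewrite !heis_pos_ket (lin_sum _ _ _ ls); apply: eq_bigr => j _.
  by rewrite (linZ _ _ ls) shift_ket.
rewrite !heis_neg_ket (lin_sum _ _ _ ls); apply: eq_bigr => j _.
by rewrite (linZ _ _ ls) shift_ket.
Qed.

(* The mode n of Y(e^a,z) on the sector of weight b, up to the cocycle. *)
Definition vop a b (n : int) w : V :=
  Sum (fun q : nat => emz a (q%:Z - ip L a b - n - 1) (ep a q (shift a w))).

Definition vex a (n : int) : V -> V :=
  lext S (fun m b => (eps a b)%:~R *: vop a b n (ket m b)).

Lemma evz_vop a b n w :
  evz (fun q : nat => emz a (q%:Z - ip L a b - n - 1) (ep a q (shift a w))).
Proof.
have [N hN] := evz_ep a (shift a w); exists N => j /hN ->.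
by rewrite lin0//; exact: linear_emz.
Qed.

Lemma linear_vop a b n : linear (vop a b n).
Proof.
suff: forall (c : K) u v, vop a b n (c *: u + v) = c *: vop a b n u + vop a b n v by [].
move=> c u v; rewrite /vop -SumZ; last exact: evz_vop.
rewrite -SumD; [|by apply: evzZ; exact: evz_vop|exact: evz_vop].
by apply: eq_Sum => q; rewrite linear_shift linear_ep linear_emz.
Qed.

Lemma linear_vex a n : linear (vex a n).
Proof. exact: linear_lext. Qed.

Lemma vex_ket a n m b : vex a n (ket m b) = (eps a b)%:~R *: vop a b n (ket m b).
Proof. exact: lext_ket. Qed.

Lemma vex_homog a n d b w : homog d b w -> vex a n w = (eps a b)%:~R *: vop a b n w.
Proof.
apply: (homog_linear_eq (linear_vex a n) (g := fun w => (eps a b)%:~R *: vop a b n w)) => [|m].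
  exact/linear_fscale/linear_vop.
by rewrite vex_ket.
Qed.

Lemma homog_vop a b n d w : homog d b w ->
  homog (d - ip L a b - n - 1) (a + b) (vop a b n w).
Proof.
move=> hw; apply: homog_Sum => [|q]; first exact: evz_vop.
have -> : d - ip L a b - n - 1 = d - q%:Z + (q%:Z - ip L a b - n - 1) by lia.
apply/homog_emz/homog_ep; move: w hw; apply: homog_linear => [|m <-].
  exact: linear_shift.
by rewrite shift_ket; exact: homog_ket.
Qed.

Arguments homog_vop a b n {d w}.

Lemma isfield_vex a : isfield (vex a).
Proof.
apply: (isfield_ket (S := S)) => [n|m b]; first exact: linear_vex.
exists ((msize m)%:Z - ip L a b) => n hn; rewrite vex_ket.
rewrite [vop _ _ _ _](homog_lt0 _ (homog_vop a b n (homog_ket S m b))) ?scaler0//.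
by lia.
Qed.

(** The source of (h,a) depends on the sign of p: annihilation modes meet the exponential of
    creation modes, creation modes meet the other exponential, and h(0) sees the change of sector
    from b to a + b. *)
Lemma heis_vex a h p n w : heis h p (vex a n w) =
  vex a n (heis h p w) + ipF L h (lat a) *: vex a (n + p) w.
Proof.
have lh := linear_heis S h p; have lv n' := linear_vex a n'.
move: w; apply: (linear_ket_ext (S := S)).
- exact: linear_fcomp.
- by apply: linear_fadd; [exact: linear_fcomp|exact: linear_fscale].
move=> m b; rewrite (vex_homog a n (homog_heis h p (homog_ket S m b))) !vex_ket.
rewrite (linZ _ _ lh) scalerA [_ * (eps a b)%:~R]mulrC -scalerA -scalerDr.
apply: (congr1 (fun v => _ *: v)).
have [-> {p lh}|p0] := eqVneq p 0.
  rewrite addr0 (heis_zero_homog h (homog_vop a b n (homog_ket S m b))) latFD ipFDr scalerDl addrC.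
  by rewrite heis_zero_ket (linZ _ _ (linear_vop _ _ _)).
rewrite /vop (Sum_lin lh (evz_vop a b n (ket m b))) -SumZ; last exact: evz_vop.
rewrite -heis_shift//; case: p p0 lh => [[//|k]|k] p0 lh.
  rewrite -SumD; [|by rewrite heis_shift//; exact: evz_vop|by apply: evzZ; exact: evz_vop].
  apply: eq_Sum => q; rewrite heis_emz_pos heis_ep_nneg//.
  by congr (_ + _ *: emz a _ _); lia.
pose f (q : nat) := ipF L h (lat a) *:
  emz a (q%:Z - ip L a b - (n + Negz k) - 1) (ep a q (shift a (ket m b))).
have ef : evz f by apply: evzZ; exact: evz_vop.
(* Commuting past the annihilation exponential lowers q by k + 1, so the second sum is shifted to
   match. *)
rewrite -[Sum (fun j => _ *: _)]/(Sum f) -(Sum_shift k.+1 ef) -SumD; last first.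
- have [N hN] := ef; exists (N + k.+1)%N => j hj; case: ifP => // _; rewrite hN//; lia.
- by rewrite heis_shift//; exact: evz_vop.
apply: eq_Sum => q; rewrite heis_emz_npos// heis_ep_neg.
have le := linear_emz a (q%:Z - ip L a b - n - 1).
rewrite (linD _ _ le) (linZ _ _ le); congr (_ + _); case: ltnP => kq.
  by congr (_ *: emz a _ _); lia.
by rewrite (lin0 le) scaler0.
Qed.

Definition evac a b z : V := emz a z (ket mset0 b).

Lemma homog_evac a b z : homog z b (evac a b z).
Proof. by have := homog_emz a z (homog_ket S mset0 b); rewrite msize0 add0r. Qed.

(** Annihilation modes kill e^(a+b), so only q = 0 survives. *)
Lemma vex_vac a n b : vex a n (ket mset0 b)
  = (eps a b)%:~R *: evac a (a + b) (- ip L a b - n - 1).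
Proof.
rewrite vex_ket; congr (_ *: _); rewrite /vop (@Sum_single _ _ 0%N) => [|q q0].
  by rewrite ep0 shift_ket add0r.
by rewrite shift_ket ep_ket_eq0 ?msize0 ?lt0n// lin0//; exact: linear_emz.
Qed.

Lemma evac_lt0 a b z : z < 0 -> evac a b z = 0.
Proof. by case: z. Qed.

(** A coherent state: the generating series is an eigenvector of the annihilation operators up to
    powers of z. This gives the stability that [vacuum_detection] requires. *)
Lemma heis_pos_evac a b h k z : heis h k.+1 (evac a b z) =
  ipF L h (lat a) *: evac a b (z - k.+1%:Z).
Proof.
by rewrite /evac heis_emz_pos heis_pos_vac (lin0 (linear_emz _ _)) add0r.
Qed.

Lemma evac_evz a b h z :
  evz (fun j : nat => heis h (- 1 - j%:Z) (evac a b (z - 1 - j%:Z))).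
Proof.
exists `|z|%N => j hj; rewrite evac_lt0; last by lia.
by rewrite (lin0 (linear_heis _ _ _)).
Qed.

(* Coefficientwise form of z E'(z) = (\sum_(n > 0) a(-n) z^n) E(z) for the
   exponential E(z) = exp(\sum_(n > 0) a(-n)/n z^n) e^b. *)
Lemma evac_rec a b z : z%:~R *: evac a b z =
  Sum (fun j : nat => heis (lat a) (- 1 - j%:Z) (evac a b (z - 1 - j%:Z))).
Proof.
apply/eqP; rewrite -subr_eq0; apply/eqP; move: z.
apply: (vacuum_detection (S := S)) => [z c|z h k].
  rewrite cfB cfZ; have [M hM] := evac_evz a b (lat a) z.
  rewrite (SumE hM) cf_sum big1 ?subr0 => [|j _]; last first.
    by rewrite (_ : - 1 - j%:Z = Negz j) ?cf_vac_heis_neg//; lia.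
  (* The vacuum coordinate of [evac a b z] can be nonzero only for z = 0, where the factor z
     vanishes. *)
  apply/eqP; rewrite mulf_eq0 orbC -implyNb; apply/implyP => /(homog_evac (a := a)) [_].
  by rewrite msize0 => <-.
exists (z - k.+1%:Z), (z - k.+1%:Z), (ipF L h (lat a)), 0; rewrite scale0r addr0.
have lh := linear_heis S h k.+1.
rewrite (linB _ _ lh) (linZ _ _ lh) heis_pos_evac (Sum_lin lh (evac_evz a b (lat a) z)).
(* The contraction of h(k+1) with a(-k-1); it accounts for the change of the factor z into z -
   (k+1). *)
pose g (j : nat) := (if j == k then k.+1%:R * ipF L h (lat a) else 0) *: evac a b (z - 1 - j%:Z).
rewrite [X in _ *: _ - X](_ : _ = ipF L h (lat a) *: Sum (fun j : nat =>
   heis (lat a) (- 1 - j%:Z) (evac a b (z - k.+1%:Z - 1 - j%:Z))) + Sum g).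
  rewrite (@Sum_single _ _ k g) /g ?eqxx; last by move=> j /negbTE ->; rewrite scale0r.
  rewrite [z - 1 - k%:Z](_ : _ = z - k.+1%:Z); last by lia.
  rewrite scalerBr opprD addrCA [RHS]addrC; congr (_ + _).
  rewrite !scalerA -scalerBl; congr (_ *: _).
  by rewrite intrD mulrNz -pmulrn; ring.
rewrite -SumZ; last exact: evac_evz.
rewrite -SumD; last first.
- by exists k.+1 => j hj; rewrite /g gtn_eqF// scale0r.
- by apply: evzZ; exact: evac_evz.
apply: eq_Sum => j; rewrite heis_comm heis_pos_evac (linZ _ _ (linear_heis _ _ _)).
congr (_ *: heis _ _ (evac _ _ _) + _); first by lia.
rewrite /g; congr (_ *: _).
have -> : (k.+1%:Z + (- 1 - j%:Z) == 0) = (j == k) by lia.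
by case: eqP.
Qed.

Lemma nprod_shift (A B : int -> V -> V) p n w :
  nprod A (fun n => B (n + p)) n w = nprod A B (n + p) w.
Proof.
by rewrite /nprod /Lp /Rp; congr (_ + _); apply: eq_Sum => j;
  [congr (A _ (B _ _))|congr (B _ _)]; lia.
Qed.

Lemma nprod_vex_commutator h h' a p n w :
  heis h p (nprod (heis h') (vex a) n w) = nprod (heis h') (vex a) n (heis h p w)
  + ipF L h (lat a) *: nprod (heis h') (vex a) (n + p) w
  + (p%:~R * ipF L h h') *: vex a (n - 1 + p) w.
Proof.
have fv := isfield_vex a; have fh := isfield_heis S h'.
have fv' : isfield (fun n w => ipF L h (lat a) *: vex a (n + p) w).
  have [lv tv] := fv; split=> [k|u]; first by apply: linear_fscale; exact: lv.
  have [N hN] := tv u; exists (N - p) => k hk; rewrite hN ?scaler0//; lia.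
have fs : isfield (fun n w => vex a (n + p) w).
  have [lv tv] := fv; split=> [k|u]; first exact: lv.
  have [N hN] := tv u; exists (N - p) => k hk; rewrite hN//; lia.
rewrite (@nprod_commutator _ _ _ _ _ _ (p%:~R * ipF L h h') (- p) (linear_heis S h p) fh fv fv').
- rewrite opprK; congr (_ + _ + _).
  have f0 : isfield (fun (n : int) (w : V) => 0 : V).
    by split=> [k c u v|u]; [rewrite scaler0 addr0|exists 0].
  transitivity (nprod (heis h') (fun n w => ipF L h (lat a) *: vex a (n + p) w + 0) n w).
    by apply: eq_nprod => k u; rewrite addr0.
  rewrite (nprod_lin (ipF L h (lat a)) fh fs f0) nprod_shift [X in _ + X](_ : _ = 0) ?addr0//.
  by rewrite /nprod /Lp /Rp !Sum0 ?addr0// => j; rewrite lin0//; exact: linear_heis.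
- move=> j u; rewrite heis_comm; congr (_ + _ *: _).
  by have -> : (p + j == 0) = (j == - p) by lia.
- by move=> k u; rewrite heis_vex.
Qed.

(** Both sides have the same commutators with the h(p), and they agree on the vacua by
    [evac_rec]. *)
Lemma fderiv_vex a n w : fderiv (vex a) n w = nprod (heis (lat a)) (vex a) n w.
Proof.
apply/eqP; rewrite -subr_eq0; apply/eqP; move: n w.
have fv := isfield_vex a; have fh := isfield_heis S (lat a).
have [ld _] := isfield_fderiv fv; have [ln _] := isfield_nprod fh fv.
apply: (creation_ext (S := S)) => [n|n b|h p w IH n].
- by apply: linear_fsub.
- rewrite /fderiv vex_vac /nprod.
  (* The factor -n arises as (-(a,b) - n) + (a,b): the creation half gives the degree of [evac], and
     the zero mode gives (a,b). *)
  rewrite [Lp _ _ _ _](_ : _ = (eps a b)%:~R *: ((- ip L a b - n)%:~R *: evac a (a + b) (- ip L a b - n))).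
    rewrite [Rp _ _ _ _](_ : _ = (ip L a b)%:~R *: vex a (n - 1) (ket mset0 b)).
      rewrite vex_vac (_ : - ip L a b - (n - 1) - 1 = - ip L a b - n); last by lia.
      rewrite !scalerA -scalerDl -scalerBl [X in X *: _](_ : _ = 0) ?scale0r//.
      by rewrite intrD !mulrNz; ring.
    rewrite /Rp (@Sum_single _ _ 0%N) => [|[//|j] _].
      by rewrite subr0 heis_zero_ket ipF_latF (linZ _ _ (linear_vex _ _)).
    by rewrite heis_pos_vac (lin0 (linear_vex _ _)).
  rewrite evac_rec -SumZ; last exact: evac_evz.
  apply: eq_Sum => j; rewrite vex_vac (linZ _ _ (linear_heis _ _ _)).
  by congr (_ *: heis _ _ (evac _ _ _)); lia.
- have e k := subr0_eq (IH k).
  (* The derivative contributes -n(h,a); the normal product contributes -(n+p)(h,a) + p(h,a), the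
     last term being the contraction of h(p) with a(z). *)
  have dE : fderiv (vex a) n (heis h p w) = heis h p (fderiv (vex a) n w)
      - (- n%:~R * ipF L h (lat a)) *: vex a (n - 1 + p) w.
    rewrite {2}/fderiv (linZ _ _ (linear_heis _ _ _)) heis_vex scalerDr scalerA addrK.
    by [].
  have := nprod_vex_commutator h (lat a) a p n w; rewrite -!e => /eqP.
  rewrite -subr_eq -subr_eq => /eqP <-; rewrite dE.
  rewrite /fderiv (_ : n + p - 1 = n - 1 + p); last by lia.
  rewrite !scalerA; move: (heis h p _) (vex a (n - 1 + p) w) => D u.
  have aux (x y z t : V) : x - y - (x - z - t) = z + t - y.
    by rewrite -(addrA x (- z)) opprD addrACA subrr add0r opprD !opprK addrC.
  rewrite aux -scalerDl -scalerBl [X in X *: _](_ : _ = 0) ?scale0r//.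
  by rewrite intrD; ring.
Qed.

End VertexOperators.

(** * The coefficients of (1 - x)^s for integral s *)

Section SignedBinomials.
Context {K : numFieldType}.

(* Coefficients of (1 - x)^s, extended by zero to negative degrees. *)
Fixpoint gamn (s : int) (k : nat) : K :=
  if k is k'.+1 then gamn s k' * (k'%:Z - s)%:~R / k'.+1%:R else 1.
Definition gam (s k : int) : K := if k is Posz n then gamn s n else 0.

(** Coefficient form of x f' = - s x f / (1 - x) for f = (1 - x)^s. It is the recursion that
    [evac_rec] imposes on vacuum coordinates. *)
Lemma gamn_sum s k : k%:R * gamn s k = - s%:~R * \sum_(i < k) gamn s i.
Proof.
elim: k => [|k IH]; first by rewrite big_ord0 mul0r mulr0.
rewrite big_ord_recr /= mulrDr -IH -mulrDl.
have k0 : k.+1%:R != 0 :> K by rewrite pnatr_eq0.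
by rewrite mulrC divfK// mulrC intrB.
Qed.

Lemma gam_pascal s k : gam s k - gam s (k - 1) = gam (s + 1) k.
Proof.
case: k => [[|k]|k]; [by rewrite /= subr0| |by rewrite /= subrr].
rewrite (_ : k.+1%:Z - 1 = k); last by lia.
rewrite /gam; elim: k => [|k IH].
  by rewrite /= !mul1r !divr1 !sub0r !intrN intrD opprD.
have k0 : k.+1%:R != 0 :> K by rewrite pnatr_eq0.
have k1 : k.+2%:R != 0 :> K by rewrite pnatr_eq0.
have k1' : 1 + k.+1%:R != 0 :> K by rewrite addrC natr1.
rewrite [RHS]/= -/(gamn (s + 1) k.+1) -IH.
have e : gamn s k.+1 = gamn s k * (k%:Z - s)%:~R / k.+1%:R by [].
have e' : gamn s k.+2 = gamn s k.+1 * (k.+1%:Z - s)%:~R / k.+2%:R by [].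
rewrite e' e !intrB !intrD -!pmulrn -[in k.+2%:R]natr1 addrC.
have -> : (k%:R : K) = k.+1%:R - 1 by rewrite -natr1 addrK.
move: (gamn s k) (k.+1%:R : K) k0 k1' => g x x0 x1.
by field; rewrite ?x0 ?x1 ?(addrC x) ?x1 ?x0.
Qed.

Lemma gam0 k : gam 0 k = (k == 0)%:R.
Proof.
case: k => [[|k]|k] //; rewrite /gam.
elim: k => [|k IH]; first by rewrite /= subr0 mulr0z mulr0 mul0r.
have -> : gamn 0 k.+2 = gamn 0 k.+1 * (k.+1%:Z - 0)%:~R / k.+2%:R by [].
by rewrite IH !mul0r.
Qed.

(** (1 - x)^M is a polynomial of degree M, and substituting 1/x reverses its coefficients up to the
    sign (-1)^M. *)
Lemma gam_sym (M : nat) k : gam M (M%:Z - k) = (-1) ^+ M * gam M k.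
Proof.
elim: M k => [|M IH] k; first by rewrite sub0r !gam0 oppr_eq0 mul1r.
have -> : M.+1%:Z = M%:Z + 1 by lia.
rewrite -!gam_pascal (_ : M%:Z + 1 - k - 1 = M%:Z - k); last by lia.
rewrite (_ : M%:Z + 1 - k = M%:Z - (k - 1)); last by lia.
by rewrite !IH -mulrBr exprS mulN1r mulNr -mulrN opprB.
Qed.

Local Notation D2K := (@D2 K K^o).

(** With x = z2/z1 these are the coefficients of a monomial times (1 - x)^s, and z1 - z2 = z1 (1 -
    x). *)
Lemma iterD2_gam_right N s T kap p q :
  iter N D2K (fun p q => (p + q == T)%:R * gam s (kap - q)) p q
  = (p + q == T - N%:Z)%:R * gam (s + N%:Z) (kap - q).
Proof.
elim: N p q => [|N IH] p q; first by rewrite subr0 addr0.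
rewrite iterS {1}/D2 !IH.
have -> : (p + 1 + q == T - N%:Z) = (p + q == T - N.+1%:Z) by lia.
have -> : (p + (q + 1) == T - N%:Z) = (p + q == T - N.+1%:Z) by lia.
rewrite -mulrBr (_ : kap - (q + 1) = kap - q - 1); last by lia.
by rewrite gam_pascal; congr (_ * gam _ _); lia.
Qed.

(** Here x = z1/z2, and z1 - z2 = - z2 (1 - x) accounts for the sign. *)
Lemma iterD2_gam_left N s T kap p q :
  iter N D2K (fun p q => (p + q == T)%:R * gam s (kap - p)) p q
  = (-1) ^+ N * ((p + q == T - N%:Z)%:R * gam (s + N%:Z) (kap - p)).
Proof.
elim: N p q => [|N IH] p q; first by rewrite subr0 addr0 mul1r.
rewrite iterS {1}/D2 !IH.
have -> : (p + 1 + q == T - N%:Z) = (p + q == T - N.+1%:Z) by lia.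
have -> : (p + (q + 1) == T - N%:Z) = (p + q == T - N.+1%:Z) by lia.
rewrite -!mulrBr (_ : kap - (p + 1) = kap - p - 1); last by lia.
rewrite -[gam _ _ - gam _ _]opprB gam_pascal mulrN exprS mulN1r mulrN mulNr.
by congr (- (_ * (_ * gam _ _))); lia.
Qed.

End SignedBinomials.

(** * Locality of the vertex operators *)

Section VertexLocality.
Context {l : nat} {L : even_lattice l} {K : numFieldType} {V : lmodType K}.
Variable S : fock_space L V.
Variable eps : 'rV[int]_l -> 'rV[int]_l -> int.
Local Notation mono := (@monomial l).
Local Notation H := 'rV[K]_l.
Local Notation ket := (ket S).
Local Notation cf := (cf S).
Local Notation heis := (heis S).
Local Notation lat := (latF K).
Local Notation vex := (vex S eps).
Local Notation evac := (evac S).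
Implicit Types (u v w : V) (m : mono) (h : H) (a b c d : 'rV[int]_l).

(** The commutator is supported on p + q = 0 and is linear in p there, so a second difference kills
    it. *)
Lemma local_heis h h' : local (heis h) (heis h').
Proof.
exists 2%N => w p q; rewrite /= /D2 /comm.
have e p' q' : heis h p' (heis h' q' w) - heis h' q' (heis h p' w)
   = (if p' + q' == 0 then p'%:~R * ipF L h h' else 0) *: w.
  by rewrite heis_comm addrAC subrr add0r.
rewrite !e.
have -> : (p + 1 + 1 + q == 0) = (p + q == - 2%:R) by lia.
have -> : (p + 1 + (q + 1) == 0) = (p + q == - 2%:R) by lia.
have -> : (p + (q + 1 + 1) == 0) = (p + q == - 2%:R) by lia.
case: eqP => _; last by rewrite !scale0r !subr0.
rewrite -!scalerBl [X in X *: _](_ : _ = 0) ?scale0r//.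
by rewrite !intrD; ring.
Qed.

(** The commutator depends on p + q only, so a first difference kills it. *)
Lemma local_heis_vex h a : local (heis h) (vex a).
Proof.
exists 1%N => w p q; rewrite /= /D2 /comm.
have e p' q' : heis h p' (vex a q' w) - vex a q' (heis h p' w)
   = ipF L h (lat a) *: vex a (q' + p') w.
  by rewrite heis_vex addrAC subrr add0r.
by rewrite !e (_ : q + (p + 1) = q + 1 + p) ?subrr//; lia.
Qed.

Lemma evac_zero a b : evac a b 0 = ket mset0 b.
Proof. exact: emz0. Qed.

Lemma cf_vac_evac a b c z : cf mset0 c (evac a b z) = ((z == 0) && (c == b))%:R.
Proof.
have [->|z0] := eqVneq z 0; first by rewrite evac_zero cf_ket eqxx.
apply/eqP; apply/negPn/negP => /homog_evac[_ ]; rewrite msize0 => z0'.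
by rewrite -z0' eqxx in z0.
Qed.

(** For a = 0 the operators commute with the h(p), and the right side of [evac_rec] is 0, which
    kills [evac] in every nonzero degree. *)
Lemma vex0 n w : (forall b, eps 0 b = 1) -> vex 0 n w = if n == -1 then w else 0.
Proof.
move=> e0; have -> : (if n == -1 then w else 0) = (n == -1)%:R *: w.
  by case: eqP; rewrite ?scale1r ?scale0r.
apply/eqP; rewrite -subr_eq0; apply/eqP; move: n w.
have l0 : lat (0 : 'rV[int]_l) = 0 by apply: map_mx0.
apply: (creation_ext (S := S)) => [n|n b|h p w IH n].
- by apply: linear_fsub; [exact: linear_vex|exact: (@linear_fscale _ _ _ _ idfun)].
- rewrite vex_vac e0 scale1r add0r ip0l oppr0 sub0r.
  have -> : (n == -1) = (- n - 1 == 0) by lia.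
  have [->|z0] := eqVneq (- n - 1) 0; first by rewrite evac_zero scale1r subrr.
  rewrite scale0r subr0; have := evac_rec S 0 b (- n - 1).
  rewrite Sum0 => [/eqP|j]; last by rewrite l0 (lin0 (heis_linl _ _ _)).
  by rewrite scaler_eq0 intr_eq0 (negbTE z0) => /eqP.
- have := heis_vex S eps 0 h p n w; rewrite l0 ipFC ipF0l scale0r addr0 => <-.
  rewrite -(linZ _ _ (linear_heis _ _ _)) -(linB _ _ (linear_heis _ _ _)) IH.
  by rewrite (lin0 (linear_heis _ _ _)).
Qed.

(** Exchanging the annihilation exponential of a with the creation exponential of b produces the
    factor (1 - z2/z1)^(a,b). Its coefficients are found by induction on k, through [evac_rec] and
    [gamn_sum]. *)
Lemma cf_vac_vex_evac a b c d p k : cf mset0 c (vex a p (evac b d k)) =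
  (eps a d)%:~R * (c == a + d)%:R * ((p - k == - 1 - ip L a d)%:R * gam (ip L a b) k).
Proof.
case: k => [k|k]; last by rewrite (lin0 (linear_vex _ _ _ _)) cf0 !mulr0.
elim/ltn_ind: k p => k IH p; have [->|k0] := eqVneq k 0%N.
  rewrite evac_zero vex_vac cfZ cf_vac_evac /= mulr1 subr0 -mulrA; congr (_ * _).
  have -> : (- ip L a d - p - 1 == 0) = (p == - 1 - ip L a d) by lia.
  by case: eqP; rewrite ?mulr1 ?mulr0//=.
have kK : k%:R != 0 :> K by rewrite pnatr_eq0.
apply: (mulfI kK); rewrite -cfZ -(linZ _ _ (linear_vex _ _ _ _)).
have := evac_rec S b d k; rewrite -pmulrn => ->.
rewrite (@SumE _ _ k) => [|j jk]; last first.
  by rewrite evac_lt0 ?(lin0 (linear_heis _ _ _))//; lia.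
rewrite (lin_sum _ _ _ (linear_vex _ _ _ _)) cf_sum.
rewrite (eq_bigr (fun j : 'I_k => - (ip L a b)%:~R * ((eps a d)%:~R * (c == a + d)%:R *
    ((p - k%:Z == - 1 - ip L a d)%:R * gamn (ip L a b) (rev_ord j))))); last first.
  (* Moved to the left of Y(e^a), the creation operator b(-1-j) leaves no vacuum coordinate; what
     remains is -(a,b) times a shifted mode. *)
  move=> j _; have := heis_vex S eps a (lat b) (- 1 - j%:Z) p (evac b d (k%:Z - 1 - j%:Z)).
  move/(congr1 (cf mset0 c)); rewrite cfD cfZ.
  rewrite {1}(_ : - 1 - j%:Z = Negz j) ?cf_vac_heis_neg; last by lia.
  move/esym/eqP; rewrite addr_eq0 => /eqP ->; rewrite ipF_latF ipC -mulNr; congr (_ * _).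
  have jk := ltn_ord j; have -> : k%:Z - 1 - j%:Z = (k - j.+1)%N by lia.
  rewrite IH; last by lia.
  by have -> : (p + (- 1 - j%:Z) - (k - j.+1)%N%:Z == - 1 - ip L a d)
             = (p - k%:Z == - 1 - ip L a d) by lia.
rewrite -mulr_sumr -mulr_sumr -mulr_sumr.
have -> : \sum_(i < k) gamn (ip L a b) (rev_ord i) = \sum_(i < k) gamn (ip L a b) i :> K.
  by rewrite (reindex_inj rev_ord_inj); apply: eq_bigr => i _; rewrite rev_ordK.
have /esym := @gamn_sum K (ip L a b) k; rewrite [gam _ _]/= => g.
by rewrite mulrCA [RHS]mulrCA; congr (_ * _); rewrite mulrCA [RHS]mulrCA g.
Qed.

(* Coefficients of (z1 - z2)^N [Y(e^a,z1), Y(e^b,z2)]. *)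
Definition vexcomm a b N (i : int * int) w : V :=
  iter N D2 (comm (vex a) (vex b) w) i.1 i.2.

Lemma linear_vexcomm a b N i : linear (vexcomm a b N i).
Proof.
case: i => p q; rewrite /vexcomm /=; elim: N p q => [|N IH] p q.
  by apply: linear_fsub; apply: linear_fcomp; exact: linear_vex.
by apply: linear_fsub; exact: IH.
Qed.

Lemma heis_vexcomm a b N h n p q w : heis h n (vexcomm a b N (p, q) w) =
  vexcomm a b N (p, q) (heis h n w)
  + (ipF L h (lat a) *: vexcomm a b N (p + n, q) w
     + ipF L h (lat b) *: vexcomm a b N (p, q + n) w).
Proof.
have lh := linear_heis S h n; rewrite /vexcomm /=; elim: N p q => [|N IH] p q /=.
  rewrite /comm (linB _ _ lh) !heis_vex.
  rewrite !(linD _ _ (linear_vex _ _ _ _)) !(linZ _ _ (linear_vex _ _ _ _)).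
  have aux (x1 y1 z1 x2 z2 y2 : V) : x1 + y1 + z1 - (x2 + z2 + y2)
      = x1 - x2 + (z1 - z2 + (y1 - y2)).
    by rewrite (addrAC x1) opprD addrACA opprD [X in X + _]addrACA -addrA.
  by rewrite aux !scalerBr.
have D2E (F : int -> int -> V) r t : D2 F r t = F (r + 1) t - F r (t + 1) by [].
rewrite !D2E (linB _ _ lh) !IH.
rewrite (addrAC p n 1) (addrAC q n 1) !scalerBr.
move: (iter N D2 _ (p + 1) q) => x; move: (iter N D2 _ p (q + 1)) => y.
by rewrite opprD addrACA; congr (_ + _); rewrite opprD addrACA.
Qed.

Lemma cf_iterD2 m a N (F : int -> int -> V) p q :
  cf m a (iter N D2 F p q) = iter N (@D2 K K^o) (fun p q => cf m a (F p q)) p q.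
Proof. by elim: N p q => //= N IH p q; rewrite {1}/D2 cfB !IH. Qed.

Hypothesis heps : lattice_cocycle L eps.

Lemma local_vex a b : local (vex a) (vex b).
Proof.
have [_ _ cocy skew] := heps; pose s := ip L a b.
(* With N = |s| the exponent s + N is 0 or 2s: both expansions become polynomials, and its parity
   fixes the sign. *)
have [N Ns] : exists N, `|s|%N = N by exists `|s|%N.
exists N => w p q.
suff X0 : forall i w, vexcomm a b N i w = 0 by exact: (X0 (p, q) w).
apply: (creation_ext (S := S)) => [i|i c|h n {}w IH [p' q']]; first exact: linear_vexcomm.
  move: i; apply: (vacuum_detection (S := S)) => [[p' q'] c'|[p' q'] h k].
    rewrite /vexcomm /= cf_iterD2.
    pose T := - 2%:R - s - ip L b c - ip L a c.
    pose e1 : K := (eps b c)%:~R * (eps a (b + c))%:~R.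
    pose e2 : K := (eps a c)%:~R * (eps b (a + c))%:~R.
    pose x : K := (c' == a + (b + c))%:R.
    have -> : (fun p q => cf mset0 c' (comm (vex a) (vex b) (ket mset0 c) p q)) =
        (fun p q => ((x * e1) *: ((p + q == T)%:R * gam s (- ip L b c - 1 - q) : K^o)
         - (x * e2) *: ((p + q == T)%:R * gam s (- ip L a c - 1 - p) : K^o))).
      apply/funext => r; apply/funext => t; rewrite /comm cfB !vex_vac.
      rewrite !(linZ _ _ (linear_vex _ _ _ _)) !cfZ !cf_vac_vex_evac.
      have -> : (r - (- ip L b c - t - 1) == - 1 - ip L a (b + c)) = (r + t == T).
        by rewrite ipDr /T -/s; lia.
      have -> : (t - (- ip L a c - r - 1) == - 1 - ip L b (a + c)) = (r + t == T).
        by rewrite ipDr (ipC L b a) /T -/s; lia.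
      rewrite (ipC L b a) -/s (addrCA b a c) -/x /e1 /e2 /GRing.scale /=.
      rewrite (addrAC _ (- t)) (addrAC _ (- r)); congr (_ - _).
        by rewrite !mulrA; congr (_ * _ * _); rewrite mulrC mulrA.
      by rewrite !mulrA; congr (_ * _ * _); rewrite mulrC mulrA.
    rewrite iterD2B !iterD2Z iterD2_gam_right iterD2_gam_left.
    have [M sM] : exists M : nat, s + N%:Z = M by exists (absz (s + N%:Z)); lia.
    case: (eqVneq (p' + q') (T - N%:Z)) => [pq|_]; last first.
      by rewrite /GRing.scale /= !mul0r !mulr0 subrr.
    (* On the line p' + q' = T - N the arguments of the two coefficients add up to M, so [gam_sym]
       relates them. *)
    rewrite !mul1r sM (_ : - ip L a c - 1 - p' = M%:Z - (- ip L b c - 1 - q')); last first.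
      by rewrite -sM; rewrite /T in pq; lia.
    rewrite gam_sym mulrA -exprD.
    (* As M is even the sign is (-1)^N, with N = |(a,b)|: the commutator of the cocycle. *)
    have -> : e1 = (-1) ^+ (N + M) * e2.
      have -> : (-1) ^+ (N + M) = (-1) ^+ N :> K.
        rewrite -signr_odd oddD (_ : odd M = false) ?addbF ?signr_odd//.
        by apply: negbTE; move: sM; lia.
      rewrite /e1 /e2 -!intrM -cocy (addrC a b) -cocy skew -/s Ns.
      by rewrite -mulrA intrM rmorphXn.
    have aux (x1 x2 x3 x4 : K) : x1 * (x2 * x3) * x4 - x1 * x3 * (x2 * x4) = 0.
      by ring.
    exact: aux.
  exists (p' + k.+1%:Z, q'), (p', q' + k.+1%:Z), (ipF L h (lat a)), (ipF L h (lat b)).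
  by rewrite heis_vexcomm heis_pos_vac (lin0 (linear_vexcomm _ _ _ _)) add0r.
have := heis_vexcomm a b N h n p' q' w.
by rewrite !IH !scaler0 !addr0 (lin0 (linear_heis _ _ _)).
Qed.

End VertexLocality.

(** * The state-field correspondence *)

Section StateField.
Context {l : nat} {L : even_lattice l} {K : numFieldType} {V : lmodType K}.
Variable S : fock_space L V.
Variable eps : 'rV[int]_l -> 'rV[int]_l -> int.
Hypothesis heps : lattice_cocycle L eps.
Local Notation mono := (@monomial l).
Local Notation H := 'rV[K]_l.
Local Notation ket := (ket S).
Local Notation heis := (heis S).
Local Notation bas := (@ebas l K).
Local Notation lat := (latF K).
Local Notation vex := (vex S eps).
Implicit Types (u v w : V) (m : mono) (h : H) (a b c d : 'rV[int]_l) (x y : 'I_l * nat).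

Definition ddf (k : nat) (F : int -> V -> V) n w : V := (k`!%:R^-1 : K) *: iter k fderiv F n w.

Lemma isfield_ddf k F : isfield F -> isfield (ddf k F).
Proof. by move=> fF; apply: isfieldZ; exact: isfield_iter_fderiv. Qed.

Lemma local_scale (c : K) (A B : int -> V -> V) : isfield B ->
  local A B -> local (fun n w => c *: A n w) B.
Proof.
move=> [lB _] [N hN]; exists N => w p q.
have -> : comm (fun n w => c *: A n w) B w = fun p q => c *: comm A B w p q.
  apply/funext => r; apply/funext => t.
  by rewrite /comm (linZ _ _ (lB _)) scalerBr.
by rewrite iterD2Z hN scaler0.
Qed.

Lemma local_add (A A' B : int -> V -> V) : isfield B ->
  local A B -> local A' B -> local (fun n w => A n w + A' n w) B.
Proof.
move=> [lB _] [N hN] [N' hN']; exists (maxn N N') => w p q.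
have -> : comm (fun n w => A n w + A' n w) B w
    = fun p q => comm A B w p q + comm A' B w p q.
  apply/funext => r; apply/funext => t.
  by rewrite /comm (linD _ _ (lB _)) opprD addrACA.
rewrite iterD2D (iterD2_ge _ (hN w)) ?leq_maxl// (iterD2_ge _ (hN' w)) ?leq_maxr//.
by rewrite addr0.
Qed.

Lemma local_ddf k A B : isfield B -> local A B -> local (ddf k A) B.
Proof. by move=> fB AB; apply: local_scale => //; exact: local_iter_fderiv. Qed.

Definition dcoef (k : nat) (n : int) : K := \prod_(i < k) (i%:Z - n)%:~R.

Lemma iter_fderiv k F n w :
  iter k fderiv F n w = dcoef k n *: (F (n - k%:Z) w : V).
Proof.
elim: k n => [|k IH] n; first by rewrite /dcoef big_ord0 scale1r subr0.
rewrite iterS /fderiv IH scalerA /dcoef big_ord_recl sub0r intrN.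
rewrite (_ : n - 1 - k%:Z = n - k.+1%:Z); last by lia.
congr ((_ * _) *: _); apply: eq_bigr => i _; congr (_%:~R).
by rewrite lift0; lia.
Qed.

(** Hence the nonnegative modes of a derivative of h(z) involve only nonnegative modes of h, so
    derivatives of Heisenberg fields satisfy the sign conditions of [nprodC]. *)
Lemma dcoef_vanish k (n : nat) : (n < k)%N -> dcoef k n = 0.
Proof. by move=> nk; rewrite /dcoef (bigD1 (Ordinal nk))//= subrr mul0r. Qed.

(** The reason for divided powers: mode -1 of the k-th divided derivative of h(z) is then h(-k-1)
    itself. *)
Lemma dcoef_neg1 k : dcoef k (- 1) = k`!%:R.
Proof.
elim: k => [|k IH]; first by rewrite /dcoef big_ord0 fact0.
rewrite /dcoef big_ord_recr /= -/(dcoef k (- 1)) IH factS natrM mulrC.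
by congr (_ * _); rewrite pmulrn; congr (_%:~R); lia.
Qed.

Definition dh x := ddf x.2 (heis (bas x.1)).

Lemma isfield_dh x : isfield (dh x).
Proof. exact/isfield_ddf/isfield_heis. Qed.

Lemma heis_commute h h' p q w : p + q != 0 \/ p = 0 ->
  heis h p (heis h' q w) = heis h' q (heis h p w).
Proof.
rewrite heis_comm => -[/negbTE -> |->]; first by rewrite scale0r addr0.
by case: (0 + q == 0); rewrite ?mulr0z ?mul0r scale0r addr0.
Qed.

Lemma ddf_heisE k h n w :
  ddf k (heis h) n w = (k`!%:R^-1 * dcoef k n) *: heis h (n - k%:Z) w.
Proof. by rewrite /ddf iter_fderiv scalerA. Qed.

Lemma ddf_heis_neg1 k h w : ddf k (heis h) (- 1) w = heis h (Negz k) w.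
Proof.
rewrite ddf_heisE dcoef_neg1 mulVf ?pnatr_eq0 -?lt0n ?fact_gt0// scale1r.
by congr (heis _ _ _); lia.
Qed.

Lemma ddf_heis_nneg k h (n : nat) w : ddf k (heis h) n w =
  if (k <= n)%N then (k`!%:R^-1 * dcoef k n) *: heis h (n - k)%N w else 0.
Proof.
rewrite ddf_heisE; case: leqP => kn; first by rewrite subzn.
by rewrite dcoef_vanish// mulr0 scale0r.
Qed.

Lemma ddf_heisC k k' h h' i j w : (i < 0 /\ j < 0) \/ (0 <= i /\ 0 <= j) ->
  ddf k (heis h) i (ddf k' (heis h') j w) = ddf k' (heis h') j (ddf k (heis h) i w).
Proof.
have lh h1 n := linear_heis S h1 n; move=> [[i0 j0]|[]].
  rewrite !ddf_heisE (linZ _ _ (lh _ _)) (linZ _ _ (lh _ _)) !scalerA mulrC.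
  by rewrite heis_commute//; left; lia.
case: i => // i _; case: j => // j _; rewrite !ddf_heis_nneg.
case: leqP => ki; case: leqP => kj; rewrite ?(lin0 (lh _ _))//.
- rewrite !(linZ _ _ (lh _ _)) ?scalerA mulrC heis_commute//.
  by have [|] := eqVneq (i - k)%N 0%N => h0; [right; rewrite h0|left; lia].
- by rewrite scaler0.
- by rewrite scaler0.
Qed.

Definition Yb m a : int -> V -> V :=
  foldr (fun x F => nprod (dh x) F) (vex a) (enum_mset m).

Let Yl (s : seq ('I_l * nat)) a := foldr (fun x F => nprod (dh x) F) (vex a) s.

Let isfield_Yl s a : isfield (Yl s a).
Proof.
elim: s => [|x s IH]; first exact: isfield_vex.
exact: (isfield_nprod (isfield_dh x) IH).
Qed.

Let Yl_move s1 s2 x a : Yl (s1 ++ x :: s2) a = Yl (x :: s1 ++ s2) a.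
Proof.
elim: s1 => [//|y s1 IH]; rewrite cat_cons.
have -> : Yl (y :: s1 ++ x :: s2) a = nprod (dh y) (Yl (s1 ++ x :: s2) a) by [].
rewrite IH; apply/funext => n; apply/funext => w.
apply: (nprodC (isfield_dh y) (isfield_dh x) (isfield_Yl _ _)) => i j hi hj u.
  by apply: ddf_heisC; left.
by apply: ddf_heisC; right.
Qed.

Let Yl_perm s t a : perm_eq s t -> Yl s a = Yl t a.
Proof.
elim: s t => [|x s IH] t st; first by rewrite perm_sym in st; move/perm_nilP: st => ->.
have xt : x \in t by rewrite -(perm_mem st) mem_head.
case/splitPr: xt st => t1 t2 st; rewrite Yl_move.
have /IH e : perm_eq s (t1 ++ t2).
  by rewrite -(perm_cons x) (perm_trans st)// perm_catC /= perm_cons perm_catC.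
by rewrite /Yl /= -!/(Yl _ _) e.
Qed.

Lemma isfield_Yb m a : isfield (Yb m a).
Proof. exact: isfield_Yl. Qed.

(** [enum_mset] lists the factors of [madd x m] only up to permutation of x followed by those of m;
    by [nprodC] the order is immaterial. *)
Lemma Yb_madd x m a : Yb (madd x m) a = nprod (dh x) (Yb m a).
Proof. exact: (Yl_perm a (perm_madd x m)). Qed.

Lemma Yb0 a : Yb mset0 a = vex a.
Proof. by rewrite /Yb enum_mset0. Qed.

Definition Y v n w : V := lext S (fun m a => Yb m a n w) v.

Lemma linear_Yl n w : linear (fun v => Y v n w).
Proof. exact: linear_lext. Qed.

Lemma Y_ket m a n w : Y (ket m a) n w = Yb m a n w.
Proof. exact: lext_ket. Qed.

Lemma Y_ketE m a : Y (ket m a) = Yb m a.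
Proof. by apply/funext => n; apply/funext => w; exact: Y_ket. Qed.

Lemma Y_lin (c : K) u v : Y (c *: u + v) = fun n w => c *: Y u n w + Y v n w.
Proof. by apply/funext => n; apply/funext => w; exact: linear_Yl. Qed.

Lemma Y0 : Y 0 = fun n w => 0.
Proof. by apply/funext => n; apply/funext => w; exact: (lin0 (linear_Yl n w)). Qed.

Lemma isfield_zero : isfield (fun (n : int) (w : V) => 0 : V).
Proof. by split=> [n c u v|u]; [rewrite scaler0 addr0|exists 0]. Qed.

Lemma isfield_Y v : isfield (Y v).
Proof.
move: v; apply: (@ket_ind _ _ _ _ S) => [|c m a v _ IH].
  by rewrite Y0; exact: isfield_zero.
rewrite Y_lin Y_ketE; apply: isfieldD => //.
by apply: isfieldZ; exact: isfield_Yb.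
Qed.

Lemma linear_Y v n : linear (Y v n).
Proof. by have [] := isfield_Y v. Qed.

Lemma nprod_zero (A : int -> V -> V) n w : isfield A ->
  nprod A (fun _ _ => 0) n w = 0.
Proof.
by move=> [lA _]; rewrite /nprod /Lp /Rp !Sum0 ?addr0// => j; rewrite lin0.
Qed.

Lemma ddf_linl k (c : K) h h' : ddf k (heis (c *: h + h'))
  = fun n w => c *: ddf k (heis h) n w + ddf k (heis h') n w.
Proof.
apply/funext => n; apply/funext => w; rewrite !ddf_heisE heis_linl scalerDr.
by rewrite !scalerA mulrC.
Qed.

Lemma nprod_ddf_linl k F n w : isfield F ->
  linear (fun h => nprod (ddf k (heis h)) F n w).
Proof.
move=> fF c h h'; rewrite ddf_linl nprod_linl//; apply: isfield_ddf; exact: isfield_heis.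
Qed.

(** Frees the recursion from the chosen basis: both sides are linear in h and in v. *)
Lemma Y_heis h k v n w :
  Y (heis h (Negz k) v) n w = nprod (ddf k (heis h)) (Y v) n w.
Proof.
have fh : isfield (ddf k (heis h)) by apply: isfield_ddf; exact: isfield_heis.
have lh := linear_heis S h (Negz k); have lY := linear_Yl n w.
move: v; apply: (@ket_ind _ _ _ _ S) => [|c m a v _ IH].
  by rewrite (lin0 lh) Y0 nprod_zero.
rewrite (linD _ _ lh) (linZ _ _ lh) (linD _ _ lY) (linZ _ _ lY) Y_lin.
rewrite nprod_lin//; [|exact: isfield_Y|exact: isfield_Y].
rewrite IH Y_ketE; congr (_ *: _ + _).
rewrite heis_neg_ket (lin_sum _ _ _ lY) [in RHS](bas_expansion h).
rewrite (lin_sum _ _ _ (nprod_ddf_linl k n w (isfield_Yb m a))).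
apply: eq_bigr => j _; rewrite (linZ _ _ lY) Y_ket Yb_madd.
by rewrite (linZ _ _ (nprod_ddf_linl k n w (isfield_Yb m a))).
Qed.

(** Nonnegative modes of each factor kill the vacuum, so [Rp] drops out. In [Lp] the induction
    hypothesis leaves at most j = 0, where mode -1 of the factor is the creation operator. *)
Lemma Yb_creation m a : Yb m a (- 1) (ket mset0 0) = ket m a
  /\ forall n : int, 0 <= n -> Yb m a n (ket mset0 0) = 0.
Proof.
have [_ eps0 _ _] := heps.
have dh0 x (j : nat) : dh x j (ket mset0 0) = 0.
  rewrite /dh ddf_heis_nneg; case: ifP => // _; case: (j - x.2)%N => [|k].
    rewrite heis_zero_ket ipFC (_ : lat (0 : 'rV[int]_l) = 0) ?ipF0l ?scale0r ?scaler0//.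
    exact: map_mx0.
  by rewrite heis_pos_vac scaler0.
have Rp0 x F n : (forall n, linear (F n)) -> Rp (dh x) F n (ket mset0 0) = 0.
  by move=> lF; rewrite /Rp Sum0// => j; rewrite dh0 lin0.
move: m; apply: mset_ind => [|x m [IH1 IH2]].
  rewrite Yb0; split=> [|n n0]; rewrite vex_vac (proj1 (eps0 a)) scale1r addr0.
    have -> : - ip L a 0 - -1 - 1 = 0 by rewrite ipC ip0l; lia.
    exact: evac_zero.
  by rewrite evac_lt0// ipC ip0l; lia.
have [ld _] := isfield_dh x.
rewrite Yb_madd /nprod; split=> [|n n0].
  rewrite Rp0; last by have [] := isfield_Yb m a.
  rewrite addr0 /Lp (@Sum_single _ _ 0%N) => [|[//|j] _].
    rewrite subr0 ?addr0 IH1 /dh ddf_heis_neg1.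
    by rewrite -heis_cre_ket.
  by rewrite IH2 ?lin0//; lia.
rewrite Rp0; last by have [] := isfield_Yb m a.
by rewrite addr0 /Lp Sum0// => j; rewrite IH2 ?lin0//; lia.
Qed.

Lemma Y_creation v : Y v (- 1) (ket mset0 0) = v
  /\ forall n : int, 0 <= n -> Y v n (ket mset0 0) = 0.
Proof.
move: v; apply: (@ket_ind _ _ _ _ S) => [|c m a v _ [IH1 IH2]].
  by rewrite Y0.
have [h1 h2] := Yb_creation m a; rewrite Y_lin Y_ketE.
by rewrite h1 IH1; split=> // n n0; rewrite h2// IH2// scaler0 addr0.
Qed.

Lemma local_dh_Yb y m a : local (dh y) (Yb m a).
Proof.
have dhdh x z : local (dh x) (dh z).
  apply: local_ddf; first exact: isfield_dh.
  apply: local_sym; apply: local_ddf; first exact: isfield_heis.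
  exact: local_heis.
move: m y; apply: mset_ind => [|x m IH] y.
  by rewrite Yb0; apply: local_ddf; [exact: isfield_vex|exact: local_heis_vex].
rewrite Yb_madd; apply: local_sym.
apply: local_nprod => //; [exact: isfield_dh|exact: isfield_Yb|exact: isfield_dh|].
exact/local_sym/IH.
Qed.

Lemma local_Yb m a C : isfield C -> (forall x, local (dh x) C) ->
  local (vex a) C -> local (Yb m a) C.
Proof.
move=> fC dC vC; move: m; apply: mset_ind => [|x m IH]; first by rewrite Yb0.
rewrite Yb_madd; apply: local_nprod => //; [exact: isfield_dh|exact: isfield_Yb|].
exact: local_dh_Yb.
Qed.

(** Dong's lemma is used on each side in turn; [step] passes from basis vectors to combinations,
    where the order is a maximum over finitely many terms. *)
Lemma local_Y u v : local (Y u) (Y v).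
Proof.
have YbYb m a m' a' : local (Yb m a) (Yb m' a').
  apply: local_Yb; [exact: isfield_Yb|by move=> x; exact: local_dh_Yb|].
  apply: local_sym; apply: local_Yb; first exact: isfield_vex.
    by move=> x; apply: local_ddf; [exact: isfield_vex|exact: local_heis_vex].
  exact: local_vex.
have step A : isfield A -> (forall m a, local (Yb m a) A) -> forall u, local (Y u) A.
  move=> fA YA; apply: (@ket_ind _ _ _ _ S) => [|c m a v' _ IH].
    by rewrite Y0; apply: local_commutator0 => p q w; rewrite (lin0 (proj1 fA q)).
  rewrite Y_lin; apply: local_add => //; apply: local_scale => //.
  by rewrite Y_ketE.
apply: (step _) => [|m a]; first exact: isfield_Y.
apply: local_sym; apply: (step _) => [|m' a']; first exact: isfield_Yb.
exact: YbYb.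
Qed.

Lemma fderiv_ddf k F n w :
  fderiv (ddf k F) n w = (k.+1%:R : K) *: (ddf k.+1 F n w : V).
Proof.
rewrite /ddf iterS {1 3}/fderiv !scalerA factS natrM invfM mulrA mulfV ?pnatr_eq0//.
by rewrite mul1r mulrC.
Qed.

(** [D] stands for L(-1). Its commutator with h(-k-1) matches the derivative of a divided power, so
    the Leibniz rule carries the claim from e^a, where it is [fderiv_vex], to all monomials. *)
Lemma Y_translation (D : V -> V) : linear D ->
    (forall a, D (ket mset0 a) = heis (lat a) (- 1) (ket mset0 a)) ->
    (forall h k v, D (heis h (Negz k) v) =
       heis h (Negz k) (D v) + k.+1%:R *: heis h (Negz k.+1) v) ->
  forall v n w, Y (D v) n w = fderiv (Y v) n w.
Proof.
move=> lD Dvac Dh; apply: (@ket_ind _ _ _ _ S) => [|c m a v _ IH] n w.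
  by rewrite (lin0 lD) !Y0 /fderiv scaler0.
rewrite (linD _ _ lD) (linZ _ _ lD) !Y_lin IH /fderiv scalerDr scalerA mulrC -scalerA.
congr (_ *: _ + _); move: m n w {v IH}; apply: mset_ind => [|x m IH] n w.
  have -> : Y (D (ket mset0 a)) n w = nprod (heis (lat a)) (vex a) n w.
    rewrite Dvac (_ : - 1 = Negz 0)// Y_heis Y_ketE Yb0.
    have -> : ddf 0 (heis (lat a)) = heis (lat a) :> (int -> V -> V); last by [].
    by apply/funext => k; apply/funext => u; rewrite /ddf fact0 invr1 scale1r.
  by rewrite -fderiv_vex Y_ket Yb0.
have fY v := isfield_Y v; have fd := isfield_dh x.
rewrite -heis_cre_ket Dh (linD _ _ (linear_Yl n w)) (linZ _ _ (linear_Yl n w)) !Y_heis.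
have -> : Y (D (ket m a)) = fderiv (Y (ket m a)).
  by apply/funext => k; apply/funext => u; exact: IH.
rewrite [RHS](_ : _ = fderiv (nprod (dh x) (Y (ket m a))) n w); last by [].
rewrite nprod_fderiv// addrC; congr (_ + _).
have -> : fderiv (dh x) = fun n w => x.2.+1%:R *: ddf x.2.+1 (heis (bas x.1)) n w + 0.
  by apply/funext => k; apply/funext => u; rewrite addr0 -fderiv_ddf.
have fd' : isfield (ddf x.2.+1 (heis (bas x.1))).
  by apply: isfield_ddf; exact: isfield_heis.
rewrite (nprod_linl _ fd' isfield_zero (fY _)) [X in _ = _ + X](_ : _ = 0) ?addr0//.
by rewrite /nprod /Lp /Rp !Sum0 ?addr0// => j; rewrite (lin0 (linear_Y _ _)).
Qed.

End StateField.

(** * The Virasoro algebra *)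

Section Virasoro.
Context {l : nat} {L : even_lattice l} {K : numFieldType} {V : lmodType K}.
Variable S : fock_space L V.
Variable eps : 'rV[int]_l -> 'rV[int]_l -> int.
Hypothesis heps : lattice_cocycle L eps.
Local Notation mono := (@monomial l).
Local Notation H := 'rV[K]_l.
Local Notation ket := (ket S).
Local Notation cf := (cf S).
Local Notation heis := (heis S).
Local Notation bas := (@ebas l K).
Local Notation lat := (latF K).
Local Notation Y := (Y S eps).
Local Notation vac := (ket mset0 (0 : 'rV[int]_l)).
Local Notation G1 := (invmx (gramF L K)).
Implicit Types (u v w : V) (m : mono) (h : H) (a b : 'rV[int]_l) (x y : 'I_l * nat).

Lemma invmx_gramF_sym i j : G1 i j = G1 j i.
Proof.
have G : (gramF L K)^T = gramF L K by rewrite /gramF map_trmx gram_sym.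
by rewrite -[in LHS]G -trmx_inv mxE.
Qed.

Lemma dual_bas_sum h : \sum_i \sum_j (G1 i j * ipF L h (bas i)) *: bas j = h.
Proof.
rewrite exchange_big [RHS]bas_expansion; apply: eq_bigr => j _; rewrite -scaler_suml.
congr (_ *: _); transitivity ((h *m gramF L K *m G1) 0 j); last first.
  by rewrite mulmxK// gramF_unit.
rewrite [RHS]mxE; apply: eq_bigr => i _; rewrite mulrC; congr (_ * _).
by rewrite /ipF /ebas trmx_delta -colE mxE.
Qed.

(** The trace through which the rank enters the central charge. *)
Lemma dual_bas_trace : \sum_i \sum_j G1 i j * ipF L (bas i) (bas j) = l%:R.
Proof.
transitivity (\tr (1%:M : 'M[K]_l)); last by rewrite mxtrace1.
rewrite -(mulVmx (gramF_unit (L := L) (K := K))); apply: eq_bigr => i _.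
rewrite mxE; apply: eq_bigr => j _; congr (_ * _).
by rewrite ipFC /ipF /ebas trmx_delta -colE -rowE !mxE.
Qed.

Definition idfield (n : int) (w : V) : V := if n == -1 then w else 0.

Lemma isfield_idfield : isfield idfield.
Proof.
split=> [n c u v|w]; first by rewrite /idfield; case: eqP; rewrite ?scaler0 ?addr0.
by exists 0 => n n0; rewrite /idfield; case: eqP => // h; lia.
Qed.

Lemma nprod_idfield A n w : isfield A -> nprod A idfield n w = A n w.
Proof.
move=> [lA _]; rewrite /nprod /Lp /Rp; case: n => n.
  rewrite Sum0 ?add0r => [|j]; last by rewrite /idfield (_ : (_ == _) = false) ?lin0//; lia.
  rewrite (@Sum_single _ _ n) => [|j jn]; last by rewrite /idfield ifF//; lia.
  by rewrite /idfield ifT//; lia.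
rewrite [X in _ + X]Sum0 ?addr0 => [|j]; last by rewrite /idfield ifF//; lia.
rewrite (@Sum_single _ _ n) => [|j jn]; last first.
  by rewrite /idfield (_ : (_ == _) = false) ?lin0//; lia.
rewrite /idfield (_ : (_ == _) = true); last by lia.
by congr (A _ _); lia.
Qed.

Lemma Y_vac : Y vac = idfield.
Proof.
have [_ eps0 _ _] := heps.
apply/funext => n; apply/funext => w; rewrite Y_ket Yb0 vex0// => b.
by have [] := eps0 b.
Qed.

Lemma Y_heis_vac h k n w : Y (heis h (Negz k) vac) n w = ddf k (heis h) n w.
Proof.
rewrite Y_heis Y_vac nprod_idfield//; apply: isfield_ddf; exact: isfield_heis.
Qed.

Lemma ddf0 F : ddf (K := K) (V := V) 0 F = F.
Proof. by apply/funext => k; apply/funext => u; rewrite /ddf fact0 invr1 scale1r. Qed.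

Definition omega0 : V := 2%:R^-1 *: \sum_(i < l) \sum_(j < l)
  G1 i j *: heis (bas i) (- 1) (heis (bas j) (- 1) vac).

Definition Lv (n : int) w : V := Y omega0 (n + 1) w.

Lemma LvE n w : Lv n w = 2%:R^-1 *: \sum_i \sum_j
  G1 i j *: nprod (heis (bas i)) (heis (bas j)) (n + 1) w.
Proof.
have lY := linear_Yl S eps (n + 1) w; rewrite /Lv /omega0 (linZ _ _ lY).
congr (_ *: _); rewrite (lin_sum _ _ _ lY); apply: eq_bigr => i _.
rewrite (lin_sum _ _ _ lY); apply: eq_bigr => j _; rewrite (linZ _ _ lY).
apply: (congr1 (fun u => _ *: u)); rewrite [LHS](Y_heis S eps (bas i) 0) ddf0.
apply: eq_nprod => k u; rewrite -[RHS]/(heis (bas j) k u) -[in RHS](ddf0 (heis (bas j))).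
exact: (Y_heis_vac (bas j) 0).
Qed.

Lemma linear_Lv n : linear (Lv n).
Proof. exact: linear_Y. Qed.

(** In [nprod_commutator] the field B' is here a multiple of a shifted identity field, and the
    normal product with it returns h1. *)
Lemma nprod_heis_commutator h h1 h2 p n w :
  heis h p (nprod (heis h1) (heis h2) n w) = nprod (heis h1) (heis h2) n (heis h p w)
  + ((p%:~R * ipF L h h2) *: heis h1 (n - 1 + p) w
     + (p%:~R * ipF L h h1) *: heis h2 (n - 1 + p) w).
Proof.
have fh h' := isfield_heis S h'.
have fs : isfield (fun n => idfield (n + (p - 1))).
  split=> [k|u]; first by have [] := isfield_idfield.
  by exists (2%:R - p) => k hk; rewrite /idfield ifF//; lia.
have fB : isfield (fun n w => (p%:~R * ipF L h h2) *: idfield (n + (p - 1)) w).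
  exact: isfieldZ.
rewrite (@nprod_commutator _ _ _ _ _ _ (p%:~R * ipF L h h1) (- p) (linear_heis S h p) (fh h1) (fh h2) fB).
- rewrite opprK [RHS]addrA.
  have -> : nprod (heis h1) (fun n w => (p%:~R * ipF L h h2) *: idfield (n + (p - 1)) w) n w
      = (p%:~R * ipF L h h2) *: heis h1 (n - 1 + p) w; last by [].
  transitivity (nprod (heis h1) (fun n w => (p%:~R * ipF L h h2) *: idfield (n + (p - 1)) w + 0) n w).
    by apply: eq_nprod => k u; rewrite addr0.
  rewrite (nprod_lin _ (fh h1) fs (isfield_zero (V := V))) nprod_zero// addr0.
  by rewrite nprod_shift nprod_idfield// (_ : n + (p - 1) = n - 1 + p)//; lia.
- move=> j u; rewrite heis_comm; congr (_ + _ *: _).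
  by have -> : (p + j == 0) = (j == - p) by lia.
- move=> k u; rewrite heis_comm; congr (_ + _).
  rewrite /idfield (_ : (k + (p - 1) == -1) = (p + k == 0)); last by lia.
  by case: eqP; rewrite ?scale0r ?scaler0.
Qed.

(** Contracting h with either factor of omega_L gives the same sum, as the inverse Gram matrix is
    symmetric; the two copies cancel the factor 1/2. *)
Lemma heis_Lv h p n w : heis h p (Lv n w) = Lv n (heis h p w)
  + p%:~R *: heis h (n + p) w.
Proof.
have lh := linear_heis S h p; rewrite !LvE (linZ _ _ lh).
rewrite (lin_sum _ _ _ lh).
rewrite (eq_bigr (fun i => \sum_j (G1 i j *: nprod (heis (bas i)) (heis (bas j)) (n + 1) (heis h p w))
   + \sum_j (G1 i j *: ((p%:~R * ipF L h (bas j)) *: heis (bas i) (n + p) w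
     + (p%:~R * ipF L h (bas i)) *: heis (bas j) (n + p) w)))); last first.
  move=> i _; rewrite (lin_sum _ _ _ lh) -big_split; apply: eq_bigr => j _.
  by rewrite (linZ _ _ lh) nprod_heis_commutator scalerDr addrK.
rewrite big_split scalerDr; congr (_ + _).
have e : \sum_i \sum_j G1 i j *: ((p%:~R * ipF L h (bas i)) *: heis (bas j) (n + p) w)
    = p%:~R *: heis h (n + p) w.
  have lw := heis_linl S (n + p) w.
  rewrite -[in RHS](dual_bas_sum h) (lin_sum _ _ _ lw) scaler_sumr; apply: eq_bigr => i _.
  rewrite (lin_sum _ _ _ lw) scaler_sumr; apply: eq_bigr => j _.
  by rewrite (linZ _ _ lw) !scalerA mulrCA.
have e' : \sum_i \sum_j G1 i j *: ((p%:~R * ipF L h (bas j)) *: heis (bas i) (n + p) w)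
    = p%:~R *: heis h (n + p) w.
  rewrite -e exchange_big; apply: eq_bigr => i _; apply: eq_bigr => j _.
  by rewrite invmx_gramF_sym.
rewrite (eq_bigr (fun i => \sum_j G1 i j *: ((p%:~R * ipF L h (bas j)) *: heis (bas i) (n + p) w)
  + \sum_j G1 i j *: ((p%:~R * ipF L h (bas i)) *: heis (bas j) (n + p) w))); last first.
  by move=> i _; rewrite -big_split; apply: eq_bigr => j _; rewrite scalerDr.
have bs (F F' : 'I_l -> V) : \sum_i (F i + F' i) = \sum_i F i + \sum_i F' i.
  by rewrite big_split.
rewrite bs e e'; move: (p%:~R *: _) => u.
by rewrite -mulr2n -scaler_nat scalerA mulVf ?scale1r// pnatr_eq0.
Qed.

Lemma Lv_heis h p n w : Lv n (heis h p w) = heis h p (Lv n w) - p%:~R *: heis h (n + p) w.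
Proof. by rewrite heis_Lv addrK. Qed.

Lemma heis_nprod_vac h1 h2 n a : nprod (heis h1) (heis h2) (n + 1) (ket mset0 a) =
  Sum (fun j : nat => heis h1 (- 1 - j%:Z) (heis h2 (n + 1 + j%:Z) (ket mset0 a)))
  + ipF L h1 (lat a) *: heis h2 n (ket mset0 a).
Proof.
rewrite /nprod; congr (_ + _); rewrite /Rp (@Sum_single _ _ 0%N) => [|[//|j] _].
  by rewrite heis_zero_ket (linZ _ _ (linear_heis _ _ _)) subr0 addrK.
by rewrite heis_pos_vac (lin0 (linear_heis _ _ _)).
Qed.

Lemma dual_bas_heis a n w :
  \sum_i \sum_j G1 i j *: (ipF L (bas i) (lat a) *: heis (bas j) n w) = heis (lat a) n w.
Proof.
have lw := heis_linl S n w.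
rewrite -[in RHS](dual_bas_sum (lat a)) (lin_sum _ _ _ lw); apply: eq_bigr => i _.
rewrite (lin_sum _ _ _ lw); apply: eq_bigr => j _.
by rewrite (linZ _ _ lw) scalerA ipFC.
Qed.

Lemma Lv_nneg_vac (n : nat) a :
  Lv n (ket mset0 a) = 2%:R^-1 *: heis (lat a) n (ket mset0 a).
Proof.
rewrite LvE -dual_bas_heis; congr (_ *: _); apply: eq_bigr => i _; apply: eq_bigr => j _.
rewrite heis_nprod_vac Sum0 ?add0r// => k.
have -> : n%:Z + 1 + k%:Z = (n + k).+1 by lia.
by rewrite heis_pos_vac (lin0 (linear_heis _ _ _)).
Qed.

Lemma Lv_pos_vac (n : nat) a : Lv n.+1 (ket mset0 a) = 0.
Proof. by rewrite Lv_nneg_vac heis_pos_vac scaler0. Qed.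

Lemma Lv_zero_vac a : Lv 0 (ket mset0 a) = (2%:R^-1 * (ip L a a)%:~R) *: ket mset0 a.
Proof. by rewrite Lv_nneg_vac heis_zero_ket ipF_latF scalerA. Qed.

(** On e^a a pair of modes survives if both are negative or one of them is 0. The two zero-mode sums
    agree and cancel the factor 1/2. *)
Lemma Lv_neg_vac (n : nat) a : Lv (Negz n) (ket mset0 a) = heis (lat a) (Negz n) (ket mset0 a)
  + 2%:R^-1 *: \sum_i \sum_j G1 i j *:
      \sum_(k < n) heis (bas i) (Negz k) (heis (bas j) (Negz (n - k.+1)) (ket mset0 a)).
Proof.
rewrite LvE.
pose Z i j := \sum_(k < n) heis (bas i) (Negz k) (heis (bas j) (Negz (n - k.+1)) (ket mset0 a)).
pose A i j := ipF L (bas j) (lat a) *: heis (bas i) (Negz n) (ket mset0 a).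
have e i j : nprod (heis (bas i)) (heis (bas j)) (Negz n + 1) (ket mset0 a)
    = A i j + A j i + Z i j.
  rewrite heis_nprod_vac (@SumE _ _ n.+1) => [|k nk]; last first.
    have -> : Negz n + 1 + k%:Z = (k - n.+1).+1 by lia.
    by rewrite heis_pos_vac (lin0 (linear_heis _ _ _)).
  rewrite big_ord_recr /= (_ : Negz n + 1 + n%:Z = 0); last by lia.
  rewrite heis_zero_ket (linZ _ _ (linear_heis _ _ _)) (_ : - 1 - n%:Z = Negz n); last by lia.
  rewrite -/(A i j) -/(A j i) -addrA [in RHS]addrC; congr (_ + _).
  apply: eq_bigr => k _; have kn := ltn_ord k.
  by congr (heis _ _ (heis _ _ _)); lia.
have sA : \sum_i \sum_j G1 i j *: A j i = heis (lat a) (Negz n) (ket mset0 a).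
  exact: dual_bas_heis.
have sA' : \sum_i \sum_j G1 i j *: A i j = heis (lat a) (Negz n) (ket mset0 a).
  rewrite -sA exchange_big; apply: eq_bigr => i _; apply: eq_bigr => j _.
  by rewrite invmx_gramF_sym.
have bs (F F' : 'I_l -> V) : \sum_i (F i + F' i) = \sum_i F i + \sum_i F' i.
  by rewrite big_split.
rewrite (eq_bigr (fun i => \sum_j G1 i j *: A i j + \sum_j G1 i j *: A j i
   + \sum_j G1 i j *: Z i j)); last first.
  by move=> i _; rewrite -!bs; apply: eq_bigr => j _; rewrite e !scalerDr.
rewrite !bs sA sA' scalerDr; congr (_ + _).
by rewrite -mulr2n -scaler_nat scalerA mulVf ?scale1r// pnatr_eq0.
Qed.

Lemma homog_nprod h1 h2 n d a v : homog S d a v ->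
  homog S (d - n + 1) a (nprod (heis h1) (heis h2) n v).
Proof.
have fh h' := isfield_heis S h'; move=> hv; apply: homogD.
  apply: homog_Sum => [|j]; first exact: (evz_Lp _ _ (fh h1) (fh h2)).
  have -> : d - n + 1 = d - (n + j%:Z) - (- 1 - j%:Z) by lia.
  by apply: homog_heis; apply: homog_heis.
apply: homog_Sum => [|j]; first exact: (evz_Rp _ _ (fh h1) (fh h2)).
have -> : d - n + 1 = d - j%:Z - (n - 1 - j%:Z) by lia.
by apply: homog_heis; apply: homog_heis.
Qed.

Lemma homog_Lv n d a v : homog S d a v -> homog S (d - n) a (Lv n v).
Proof.
move=> hv; rewrite LvE; apply: homogZ; apply: homog_sum => i; apply: homog_sum => j.
apply: homogZ; have -> : d - n = d - (n + 1) + 1 by lia.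
exact: homog_nprod.
Qed.

Arguments homog_Lv n {d a v}.

Lemma cf_vac_homog d a b v : homog S d a v -> d != 0 -> cf mset0 b v = 0.
Proof.
move=> hv d0; apply/eqP; apply/negPn/negP => /hv[_]; rewrite msize0 => dd.
by rewrite -dd eqxx in d0.
Qed.

(** With m = n + 1 the value is (m^3 - m)/6; the factor 1/2 of omega_L turns it into the (m^3 -
    m)/12 of the central term. *)
Lemma sum_conv (n : nat) :
  \sum_(k < n) (k.+1%:R * (n - k)%:R) = (n%:R * (n%:R + 1) * (n%:R + 2%:R)) / 6%:R :> K.
Proof.
have tri M : \sum_(k < M) k.+1%:R = M%:R * (M%:R + 1) / 2%:R :> K.
  elim: M => [|M IH]; first by rewrite big_ord0 !mul0r.
  by rewrite big_ord_recr /= IH -natr1; field.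
elim: n => [|n IH]; first by rewrite big_ord0 !mul0r.
rewrite big_ord_recr /= subSnn mulr1.
rewrite (eq_bigr (fun k : 'I_n => k.+1%:R * (n - k)%:R + k.+1%:R)); last first.
  by move=> k _; rewrite subSn 1?ltnW// -[(n - k).+1]addn1 natrD mulrDr mulr1.
by rewrite big_split /= IH tri -natr1; field.
Qed.

Definition central (m n : int) (c : K) : K :=
  if m == - n then (m ^+ 3 - m)%:~R / 12%:R * c else 0.

(* The defect in the Virasoro relation. It commutes with the Heisenberg operators,
   so it vanishes as soon as it kills the vectors e^a. *)
Definition virdef (i : int * int) w : V :=
  Lv i.1 (Lv i.2 w) - Lv i.2 (Lv i.1 w) - (i.1 - i.2)%:~R *: Lv (i.1 + i.2) w
  - central i.1 i.2 l%:R *: w.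

Lemma linear_virdef i : linear (virdef i).
Proof.
apply: linear_fsub; last exact: (@linear_fscale _ _ _ _ idfun).
apply: linear_fsub; last by apply: linear_fscale; exact: linear_Lv.
by apply: linear_fsub; apply: linear_fcomp; exact: linear_Lv.
Qed.

Lemma heis_virdef i h p w : virdef i (heis h p w) = heis h p (virdef i w).
Proof.
case: i => m n; rewrite /virdef /=; have lh := linear_heis S h p.
have LL r s : Lv r (Lv s (heis h p w)) = heis h p (Lv r (Lv s w))
    - p%:~R *: heis h (r + p) (Lv s w) - p%:~R *: heis h (s + p) (Lv r w)
    + (p * (s + p))%:~R *: heis h (r + s + p) w.
  rewrite Lv_heis (linB _ _ (linear_Lv _)) (linZ _ _ (linear_Lv _)) !Lv_heis.
  rewrite scalerBr opprB scalerA -intrM addrA addrAC.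
  by rewrite (_ : r + (s + p) = r + s + p)//; lia.
rewrite !LL !(linB _ _ lh) !(linZ _ _ lh) Lv_heis scalerBr scalerA -intrM.
have -> : n + m + p = m + n + p by lia.
move: (heis h p (Lv m (Lv n w))) (heis h p (Lv n (Lv m w))) (heis h (m + p) (Lv n w))
  (heis h (n + p) (Lv m w)) (heis h (m + n + p) w) (heis h p (Lv (m + n) w)) => A B C D E F.
congr (_ - _).
(* The difference (m - n)p of the two coefficients is exactly what L(m+n) contributes. *)
have -> : (p * (n + p))%:~R = (p * (m + p))%:~R - ((m - n) * p)%:~R :> K.
  by rewrite -intrB; congr (_%:~R); lia.
rewrite scalerBl !opprB.
move: (p%:~R *: C) (p%:~R *: D) ((p * (m + p))%:~R *: E) (((m - n) * p)%:~R *: E)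
  ((m - n)%:~R *: F) => c d e f g.
have -> : B - d - c + e = B + (- c - d + e).
  by rewrite -!addrA; congr (_ + _); rewrite addrCA.
have -> : A - c - d + (e - f) = A + (- c - d + e) - f by rewrite !addrA.
move: (- c - d + e) => x.
have e1 : A + x - (B + x) = A - B by rewrite opprD addrACA subrr addr0.
by rewrite (addrAC _ (- f)) e1 addrA subrK.
Qed.

Lemma central_anti (r s : int) c : central r s c = - central s r c.
Proof.
rewrite /central (_ : (s == - r) = (r == - s)); last by lia.
case: eqP => [->|_]; last by rewrite oppr0.
by rewrite -!mulNr -intrN; congr (_%:~R / _ * _); ring.
Qed.

Lemma virdef_anti (r s : int) w : virdef (r, s) w = - virdef (s, r) w.
Proof.
rewrite /virdef /= (addrC s r) central_anti.
have -> : (r - s)%:~R = - (s - r)%:~R :> K by rewrite -intrN opprB.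
by rewrite !scaleNr !opprK !opprD !opprK (addrC (- Lv s _)).
Qed.

(** L(M+1) turns h1(-k-1) into (k+1) h1(M-k), which contracts with h2(-(M-k)); the uncommuted term
    begins with a creation operator. *)
Lemma Lv_sugawara_vac (M k : nat) h1 h2 a b : (k < M)%N ->
  cf mset0 b (Lv M.+1 (heis h1 (Negz k) (heis h2 (Negz (M - k.+1)) (ket mset0 a))))
  = k.+1%:R * (M - k)%:R * ipF L h1 h2 * (b == a)%:R.
Proof.
move=> kM; rewrite Lv_heis cfB cf_vac_heis_neg sub0r cfZ.
have -> : M.+1%:Z + Negz k = (M - k.+1).+1 by lia.
rewrite heis_comm heis_pos_vac (lin0 (linear_heis _ _ _)) add0r ifT; last by lia.
rewrite cfZ cf_ket eqxx NegzE mulrNz mulNr opprK -!mulrA; congr (_ * (_ * _)).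
by rewrite -pmulrn; congr (_%:R); lia.
Qed.

Lemma virdef_vac (m n : int) a : virdef (m, n) (ket mset0 a) = 0.
Proof.
suff : forall i b, cf mset0 b (virdef i (ket mset0 a)) = 0.
  move=> h; move: (m, n); apply: (vacuum_detection (S := S)) => [i b|i h' k]; first exact: h.
  exists i, i, 0, 0; rewrite !scale0r addr0 -heis_virdef heis_pos_vac.
  exact: (lin0 (linear_virdef i)).
move=> {m n} [m n] b.
have hk := homog_ket S mset0 a; rewrite msize0 in hk.
(* If m + n is nonzero, the vector has degree -(m + n), hence no vacuum coordinate. *)
have [mn|mn] := eqVneq (m + n) 0; last first.
  have hL r s : homog S (- (r + s)) a (Lv r (Lv s (ket mset0 a))).
    by have := homog_Lv r (homog_Lv s hk); rewrite sub0r -opprD addrC.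
  have mn' : - (m + n) != 0 by rewrite oppr_eq0.
  rewrite /virdef /= !cfB !cfZ (cf_vac_homog _ (hL m n))// (cf_vac_homog _ (hL n m)); last first.
    by rewrite addrC.
  have := homog_Lv (m + n) hk; rewrite sub0r => hmn; rewrite (cf_vac_homog _ hmn)//.
  rewrite /central ifF ?mul0r ?mulr0 ?subr0//.
  by apply/eqP => e; rewrite e addNr eqxx in mn.
have {n mn}-> : n = - m by lia.
wlog m0 : m / 0 <= m => [wl|].
  have [/wl//|m0] := leP 0 m.
  have := wl (- m); rewrite oppr_ge0 opprK => /(_ (ltW m0)) h.
  by rewrite virdef_anti cfN h oppr0.
case: m m0 => [[|M]|//] _.
  have c0 : central 0%Z (- 0%Z) l%:R = 0.
    by rewrite /central (_ : 0%Z ^+ 3 - 0%Z = 0)// mulr0z !mul0r; case: (_ == _).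
  by rewrite /virdef /= c0 !subrr mulr0z !scale0r !subr0 cf0.
rewrite /virdef /= Lv_pos_vac (lin0 (linear_Lv _)) subr0 opprK subrr Lv_zero_vac.
rewrite (_ : - M.+1%:Z = Negz M) ?NegzE// Lv_neg_vac !cfB !cfZ cf_ket eqxx /=.
have lL := linear_Lv M.+1.
(* With m = M + 1, the term a(-m) of L(-m)e^a gives m(a,a), which balances 2m L(0); the quadratic
   term gives the central term. *)
rewrite (linD _ _ lL) (linZ _ _ lL) cfD cfZ Lv_heis cfB cf_vac_heis_neg sub0r.
rewrite (_ : M.+1%:Z + Negz M = 0); last by lia.
rewrite heis_zero_ket ipF_latF !cfZ cf_ket eqxx /=.
rewrite (lin_sum _ _ _ lL) cf_sum.
rewrite (eq_bigr (fun i => \sum_j G1 i j * ipF L (bas i) (bas j) *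
    ((M%:R * (M%:R + 1) * (M%:R + 2%:R)) / 6%:R * (b == a)%:R))); last first.
  move=> i _; rewrite (lin_sum _ _ _ lL) cf_sum; apply: eq_bigr => j _.
  rewrite (linZ _ _ lL) cfZ (lin_sum _ _ _ lL) cf_sum -mulrA; congr (_ * _).
  rewrite (eq_bigr (fun k : 'I_M => k.+1%:R * (M - k)%:R * (ipF L (bas i) (bas j) * (b == a)%:R))).
    by rewrite -mulr_suml sum_conv mulrCA mulrA.
  by move=> k _; rewrite Lv_sugawara_vac// mulrA.
under eq_bigr do rewrite -mulr_suml.
rewrite -mulr_suml dual_bas_trace /central NegzE eqxx.
move: (b == a)%:R (ip L a a)%:~R (l%:R : K) => d x y.
rewrite -[M.+1]addn1 PoszD !(intrD, intrB, intrN, rmorphXn) /= -!pmulrn.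
by field.
Qed.

Lemma virasoro_commutator (m n : int) w :
  Lv m (Lv n w) - Lv n (Lv m w)
  = (m - n)%:~R *: Lv (m + n) w + central m n l%:R *: w.
Proof.
suff : virdef (m, n) w = 0.
  by move/eqP; rewrite subr_eq0 subr_eq => /eqP ->; rewrite addrC.
move: (m, n) w; apply: (creation_ext (S := S)) => [i|[r s] a|h p w IH i].
- exact: linear_virdef.
- exact: virdef_vac.
- by rewrite heis_virdef IH (lin0 (linear_heis _ _ _)).
Qed.

Definition omegah h : V := omega0 + heis h (- 2%:R) vac.
Definition Lh h (n : int) w : V := Y (omegah h) (n + 1) w.

(** The field of h(-2)1 is the derivative of h(z), whose mode n + 1 is -(n+1)h(n). *)
Lemma LhE h n w : Lh h n w = Lv n w - (n + 1)%:~R *: heis h n w.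
Proof.
rewrite /Lh /omegah (linD _ _ (linear_Yl S eps (n + 1) w)) -/(Lv n w); congr (_ + _).
have -> : - 2%:R = Negz 1 by [].
rewrite Y_heis_vac /ddf (_ : 1`!%:R = 1 :> K)// invr1 scale1r.
by rewrite -[LHS]/(fderiv (heis h) (n + 1) w) /fderiv addrK scaleNr.
Qed.

(** The shift of c comes from (m+1)(n+1)[h(m), h(n)]: at n = -m it equals -(m^3 - m)(h,h), that is
    (m^3 - m)/12 times -12(h,h). *)
Lemma Lh_virasoro h (m n : int) w :
  Lh h m (Lh h n w) - Lh h n (Lh h m w) = (m - n)%:~R *: Lh h (m + n) w
  + central m n (l%:R - 12%:R * ipF L h h) *: w.
Proof.
have E r s : Lh h r (Lh h s w) = Lv r (Lv s w)
    - (s + 1)%:~R *: heis h s (Lv r w) - (r + 1)%:~R *: heis h r (Lv s w)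
    + ((s + 1) * s)%:~R *: heis h (r + s) w
    + ((r + 1) * (s + 1))%:~R *: heis h r (heis h s w).
  rewrite !LhE (linB _ _ (linear_Lv _)) (linZ _ _ (linear_Lv _)) Lv_heis.
  rewrite (linB _ _ (linear_heis _ _ _)) (linZ _ _ (linear_heis _ _ _)).
  rewrite !scalerBr !scalerA -!intrM.
  have e z t u : z - (t - u) = z - t + u :> V by rewrite opprB addrA addrAC.
  by rewrite !e; congr (_ + _); rewrite addrAC.
have aux (x y A B c d c' d' : V) :
    x - A - B + c + d - (y - B - A + c' + d') = (x - y) + (c - c') + (d - d').
  rewrite (addrAC y); have e z : z - A - B = z - (A + B) by rewrite opprD addrA.
  rewrite !e; move: (A + B) => X.
  rewrite opprD addrACA; congr (_ + _); rewrite opprD addrACA; congr (_ + _).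
  by rewrite opprB addrA subrK.
rewrite !E LhE aux virasoro_commutator scalerBr scalerA -intrM (addrC n m).
rewrite (mulrC (n + 1) (m + 1)).
rewrite -!scalerBl -scalerBr (heis_comm S h h m n) [heis h n _ + _ - _]addrAC subrr add0r.
rewrite -addrA addrACA scalerA -scalerDl -scaleNr.
(* The terms linear in h combine into the correction -(m+n+1)h(m+n) carried by L_h(m+n), times m -
   n. *)
have -> : ((n + 1) * n)%:~R - ((m + 1) * m)%:~R = - ((m - n) * (m + n + 1))%:~R :> K.
  by rewrite -intrB -intrN; congr (_%:~R); ring.
congr (_ + _ *: _); rewrite /central (_ : (m + n == 0) = (m == - n)); last by lia.
case: eqP => [->|_]; last by rewrite mulr0 addr0.
rewrite mulrBr; congr (_ + _); rewrite !intrM.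
have k3 : (n * n * n)%:~R = n%:~R * n%:~R * n%:~R :> K by rewrite !intrM.
rewrite !(intrD, intrN) (_ : (- n) ^+ 3 = - (n * n * n)); last by ring.
by rewrite !intrN k3; field.
Qed.

Lemma Lv_ket m a : Lv 0 (ket m a) = ((msize m)%:R + 2%:R^-1 * (ip L a a)%:~R) *: ket m a.
Proof.
move: m; apply: mset_ind => [|x m IH]; first by rewrite msize0 add0r Lv_zero_vac.
rewrite -heis_cre_ket Lv_heis IH (linZ _ _ (linear_heis _ _ _)) add0r heis_cre_ket.
rewrite -scalerBl msize_madd natrD NegzE intrN opprK -pmulrn.
by congr (_ *: _); rewrite addrC addrA.
Qed.

Lemma Lh_ket h m a : Lh h 0 (ket m a) =
  ((msize m)%:R + 2%:R^-1 * (ip L a a)%:~R - ipF L h (lat a)) *: ket m a.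
Proof. by rewrite LhE Lv_ket add0r scale1r heis_zero_ket -scalerBl. Qed.

(** The correction (n+1)h(n) vanishes at n = -1, so L(-1) is unchanged. *)
Lemma Lh_translation h v n w : Y (Lh h (- 1) v) n w = - n%:~R *: Y v (n - 1) w.
Proof.
have -> : Lh h (- 1) v = Lv (- 1) v by rewrite LhE addNr scale0r subr0.
rewrite -[RHS]/(fderiv (Y v) n w); apply: Y_translation => [|a|h' k u].
- exact: linear_Lv.
- rewrite [LHS](Lv_neg_vac 0 a) big1 ?scaler0 ?addr0// => i _.
  by rewrite big1// => j _; rewrite big_ord0 scaler0.
- rewrite Lv_heis (_ : - 1 + Negz k = Negz k.+1); last by lia.
  by rewrite NegzE intrN scaleNr opprK -pmulrn.
Qed.

End Virasoro.

(** * The grading *)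

Section Coercivity.
Context {l : nat} (L : even_lattice l).
Implicit Types (a b u : 'rV[int]_l).

(** The norm of (u,u)a - (a,u)u is (u,u) times the defect; this form needs no division. *)
Lemma ip_cauchy a u : (ip L a u) ^+ 2 <= ip L a a * ip L u u.
Proof.
have [->|u0] := eqVneq u 0; first by rewrite ipC ip0l ip0l mulr0 expr0n.
have uu : 0 < ip L u u by exact: gram_pos.
have := ip_ge0 L (ip L u u *: a - ip L a u *: u).
have -> : - (ip L a u *: u) = (- ip L a u) *: u by rewrite scaleNr.
rewrite !(ipDl, ipDr, ipZl, ipZr) (ipC L u a).
rewrite (_ : _ + _ = ip L u u * (ip L a a * ip L u u - (ip L a u) ^+ 2)); last by ring.
by rewrite pmulr_rge0// subr_ge0.
Qed.

(* Cauchy-Schwarz against the rows of the adjugate of the Gram matrix, whose inner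
   products with [a] are the multiples \det (gram L) * a_i of its coordinates. *)
Lemma coord_bound : exists k : nat, (0 < k)%N /\
  forall a i, (a ord0 i) ^+ 2 <= k%:Z * ip L a a.
Proof.
pose u i : 'rV[int]_l := row i (\adj (gram L)).
have au a i : ip L a (u i) = \det (gram L) * a ord0 i.
  have -> : ip L a (u i) = (a *m gram L *m (\adj (gram L))^T) 0 i.
    by rewrite /ip /u !mxE; apply: eq_bigr => j _; rewrite !mxE.
  rewrite trmx_adj gram_sym -mulmxA mul_mx_adj mul_mx_scalar.
  by rewrite mxE.
exists (\sum_i `|ip L (u i) (u i)|).+1; split=> // a i.
have d0 := det_gram_neq0 L.
have h1 := ip_cauchy a (u i); rewrite au exprMn in h1.
have d1 : 1 <= \det (gram L) ^+ 2.
  by have : 0 < \det (gram L) ^+ 2; [rewrite exprn_even_gt0|lia].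
have h2 : (a ord0 i) ^+ 2 <= ip L a a * ip L (u i) (u i).
  by apply: le_trans h1; rewrite ler_peMl// sqr_ge0.
apply: le_trans h2 _; rewrite mulrC ler_wpM2r ?ip_ge0//.
have : (`|ip L (u i) (u i)| <= \sum_i `|ip L (u i) (u i)|)%N.
  by rewrite (bigD1 i)//= leq_addr.
have := ip_ge0 L (u i); lia.
Qed.

Lemma coercive (R : realType) (M T : R) : 0 <= M -> exists B : nat, forall a,
  (exists i, (B < `|a ord0 i|)%N) ->
  T <= (ip L a a)%:~R / 2%:R - M * \sum_i `|a ord0 i|%N%:R.
Proof.
move=> M0; have [k [k0 hk]] := coord_bound.
(* For the largest coordinate x one has x^2 <= k(a,a) and \sum_i |a_i| <= l x. If x >= X and x >= 1,
   then (a,a)/2 >= x^2/(2k) >= (M l + |T|) x, as required. *)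
pose X : R := 2%:R * k%:R * (M * l%:R + `|T|).
exists (Num.truncn X).+1 => a [i0 hi0].
pose i := [arg max_(j > i0) `|a ord0 j|%N].
have imax j : (`|a ord0 j| <= `|a ord0 i|)%N.
  by rewrite /i; case: arg_maxnP => // j' _ h; exact: h.
pose x : R := `|a ord0 i|%N%:R.
have kR : 0 < k%:R :> R by rewrite ltr0n.
have x1 : 1 <= x by rewrite /x ler1n; have := imax i0; lia.
have xX : X <= x.
  have hX : X < (Num.truncn X).+1%:R.
    exact: truncnS_gt.
  apply: le_trans (ltW hX) _; rewrite /x ler_nat; have := imax i0; lia.
have sx : \sum_j `|a ord0 j|%N%:R <= l%:R * x.
  rewrite -[l in l%:R]card_ord mulrC mulr_natr -sumr_const.
  by apply: ler_sum => j _; rewrite ler_nat.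
have ix : x ^+ 2 <= k%:R * (ip L a a)%:~R.
  have := hk a i; rewrite -(ler_int R) intrM => h; apply: le_trans h.
  rewrite rmorphXn /= /x -[X in _ <= X]real_normK ?num_real//.
  by rewrite -intr_norm -abszE -pmulrn.
have Ml : M * \sum_j `|a ord0 j|%N%:R <= M * (l%:R * x) by rewrite ler_wpM2l.
have hx : 2%:R * k%:R * (M * l%:R + `|T|) * x <= x * x by rewrite ler_wpM2r//; lra.
have hT : T <= `|T| * x.
  apply: le_trans (ler_norm T) _; rewrite ler_peMr//.
have key : (M * l%:R + `|T|) * x <= (ip L a a)%:~R / 2%:R.
  rewrite ler_pdivlMr ?ltr0n// -(ler_pM2l kR); apply: le_trans ix.
  by rewrite expr2; apply: le_trans hx; rewrite le_eqVlt; apply/orP; left; apply/eqP; ring.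
have e : (M * l%:R + `|T|) * x = M * (l%:R * x) + `|T| * x by ring.
by move: key Ml hT; rewrite e; lra.
Qed.

End Coercivity.

Section FiniteEnumerations.
Context {l : nat}.
Local Notation mono := (@monomial l).

Lemma box_finite (B : nat) : exists s : seq 'rV[int]_l,
  forall a : 'rV[int]_l, (forall i, (`|a ord0 i| <= B)%N) -> a \in s.
Proof.
pose f (g : {ffun 'I_l -> 'I_(B + B).+1}) : 'rV[int]_l := \row_i ((g i : nat)%:Z - B%:Z).
exists (codom f) => a ha.
suff -> : a = f [ffun i => inord (absz (a ord0 i + B%:Z))] by exact: codom_f.
apply/rowP => i; rewrite mxE ffunE inordK; last by have := ha i; lia.
by have := ha i; rewrite (ord1 ord0); lia.
Qed.

Lemma mset_case (m : mono) : m = mset0 \/ exists x m', m = madd x m'.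
Proof. by move: m; apply: mset_ind => [|x m _]; [left|right; exists x, m]. Qed.

(** Each factor has degree at least 1, so removing one lowers the bound and leaves finitely many
    choices for it. *)
Lemma msize_finite (N : nat) : exists s : seq mono, forall m, (msize m <= N)%N -> m \in s.
Proof.
elim: N => [|N [s IH]].
  exists [:: mset0] => m; case: (mset_case m) => [->|[x [m' ->]]].
    by rewrite mem_head.
  by rewrite msize_madd.
pose xs : seq ('I_l * nat) := [seq (j, k) | j <- enum 'I_l, k <- iota 0 N.+1].
exists ((mset0 : mono) :: [seq madd x m | x <- xs, m <- s]) => m.
case: (mset_case m) => [->|[[j k] [m' ->]]]; first by rewrite mem_head.
rewrite msize_madd /= => hN; rewrite in_cons; apply/orP; right.
apply: allpairs_f; last by apply: IH; lia.
by apply: allpairs_f; rewrite ?mem_enum// mem_iota; lia.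
Qed.

End FiniteEnumerations.

Lemma additive_subgroup_mulz (F : nzRingType) (k : set F) x (z : int) :
  additive_subgroup k -> k x -> k (x * z%:~R).
Proof.
move=> [k0 kB] kx; have kN y : k y -> k (- y) by rewrite -sub0r; exact: kB.
have kn (n : nat) : k (x *+ n).
  elim: n => [|n IH]; first by rewrite mulr0n.
  by rewrite mulrS -[x *+ n]opprK; apply: kB => //; exact: kN.
case: z => n; first by rewrite mulr_natr.
by rewrite NegzE intrN mulrN mulr_natr; exact: kN.
Qed.

(** * Eigenspaces of L(0) and the values of the weights *)

Section Weights.
Context {l : nat} {L : even_lattice l} {K : numFieldType} {V : lmodType K}.
Variable S : fock_space L V.
Variable eps : 'rV[int]_l -> 'rV[int]_l -> int.
Hypothesis heps : lattice_cocycle L eps.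
Variable h : 'rV[K]_l.
Local Notation mono := (@monomial l).
Local Notation ket := (ket S).
Local Notation cf := (cf S).
Local Notation lat := (latF K).
Local Notation L0 := (Lh S eps h 0).
Implicit Types (u v w : V) (m : mono) (a : 'rV[int]_l) (c r : K).

Definition weight m a : K := (msize m)%:R + 2%:R^-1 * (ip L a a)%:~R - ipF L h (lat a).

Lemma linear_L0 : linear L0.
Proof. exact: linear_Y. Qed.

Lemma cf_L0 m a v : cf m a (L0 v) = weight m a * cf m a v.
Proof.
have lL := linear_L0.
move: v; apply: (@ket_ind _ _ _ _ S) => [|c m' a' v _ IH].
  by rewrite (lin0 lL) cf0 mulr0.
rewrite (linD _ _ lL) (linZ _ _ lL) !cfD !cfZ IH mulrDr; congr (_ + _).
rewrite (Lh_ket S heps h m' a') cfZ cf_ket mulrCA.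
case: eqP => [->|_]; last by rewrite !mulr0.
by case: eqP => [->|_]; rewrite ?mulr0.
Qed.

Lemma L0_eigenP r v : L0 v = r *: v <-> forall m a, cf m a v != 0 -> weight m a = r.
Proof.
split=> [Lv m a v0|hv].
  by apply: (mulIf v0); rewrite -cf_L0 Lv cfZ.
apply: (@cf_ext _ _ _ _ S) => m a; rewrite cf_L0 cfZ.
by have [->|/hv ->//] := eqVneq (cf m a v) 0; rewrite !mulr0.
Qed.

Lemma L0_eigenvalue r v : L0 v = r *: v -> v <> 0 -> exists m a, weight m a = r.
Proof.
move=> /L0_eigenP hv v0; apply: contrapT => nex; apply: v0.
apply: (cf_eq0 (S := S)) => m a; apply/eqP/negPn/negP => /hv e.
by apply: nex; exists m, a.
Qed.

Definition wproj r v : V := lext S (fun m a => if weight m a == r then ket m a else 0) v.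

Lemma linear_wproj r : linear (wproj r).
Proof. exact: linear_lext. Qed.

Lemma wproj_ket r m a : wproj r (ket m a) = if weight m a == r then ket m a else 0.
Proof. exact: lext_ket. Qed.

Lemma L0_wproj r v : L0 (wproj r v) = r *: wproj r v.
Proof.
have lp := linear_wproj r; move: v; apply: (linear_ket_ext (S := S)).
- exact: (linear_fcomp linear_L0 lp).
- exact: linear_fscale.
move=> m a; rewrite wproj_ket; case: eqP => [<-|_].
  exact: (Lh_ket S heps h m a).
by rewrite (lin0 linear_L0) scaler0.
Qed.

Lemma wproj_sum v : exists s : seq K, uniq s /\ v = \sum_(r <- s) wproj r v.
Proof.
(* Quantifying over all larger lists lets the induction add a weight that may already occur. *)
suff [s hs] : exists s : seq K, forall s', uniq s' -> {subset s <= s'} ->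
    v = \sum_(r <- s') wproj r v.
  exists (undup s); split; first exact: undup_uniq.
  by apply: hs; [exact: undup_uniq|move=> r; rewrite mem_undup].
have lp := linear_wproj.
move: v; apply: (@ket_ind _ _ _ _ S) => [|c m a v _ [s IH]].
  by exists [::] => s' _ _; rewrite big1// => r _; exact: (lin0 (lp r)).
exists (weight m a :: s) => s' us' ss'.
rewrite (eq_bigr (fun r => c *: wproj r (ket m a) + wproj r v)); last first.
  by move=> r _; rewrite (linD _ _ (lp r)) (linZ _ _ (lp r)).
rewrite big_split /= -IH//; last by move=> r rs; apply: ss'; rewrite in_cons rs orbT.
rewrite -scaler_sumr; congr (_ *: _ + _).
rewrite (bigD1_seq (weight m a))//=; last by apply: ss'; exact: mem_head.
rewrite wproj_ket eqxx big1 ?addr0// => r hr.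
by rewrite wproj_ket eq_sym (negbTE hr).
Qed.

(** A basis vector has one weight, so at most one summand has a nonzero coordinate on it. *)
Lemma L0_independent (s : seq K) (f : K -> V) : uniq s ->
    (forall r, L0 (f r) = r *: f r) ->
  \sum_(r <- s) f r = 0 -> forall r, r \in s -> f r = 0.
Proof.
move=> us Wf f0 r rs; apply: (cf_eq0 (S := S)) => m a.
have Wr r' := (L0_eigenP _ _).1 (Wf r').
apply/eqP/negPn/negP => fr; have wr := Wr _ _ _ fr.
have := congr1 (cf m a) f0; rewrite cf0 cf_sum (bigD1_seq r)//= big1 ?addr0.
  by move=> e; rewrite e eqxx in fr.
move=> r' r'r; apply/eqP/negPn/negP => fr'.
by rewrite -(Wr _ _ _ fr') wr eqxx in r'r.
Qed.

Lemma L0_eigenspace_basis r (s : seq (mono * 'rV[int]_l)) :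
    (forall m a, weight m a = r -> (m, a) \in s) ->
  exists e : seq V, forall v, L0 v = r *: v ->
    exists c : nat -> K, v = \sum_(i < size e) c i *: e`_i.
Proof.
move=> hs; pose s' := undup s; exists [seq ket b.1 b.2 | b <- s'] => v /L0_eigenP hv.
pose b0 : mono * 'rV[int]_l := (mset0, 0).
exists (fun i => cf (nth b0 s' i).1 (nth b0 s' i).2 v).
rewrite size_map (eq_bigr (fun i : 'I_(size s') =>
   (fun b => cf b.1 b.2 v *: ket b.1 b.2) (nth b0 s' i))); last first.
  by move=> i _; rewrite (nth_map b0).
rewrite -(big_mkord xpredT (fun i => (fun b => cf b.1 b.2 v *: ket b.1 b.2) (nth b0 s' i))).
rewrite -(big_nth b0 xpredT (fun b => cf b.1 b.2 v *: ket b.1 b.2)).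
apply: (@cf_ext _ _ _ _ S) => m a; rewrite cf_sum.
have E (b : mono * 'rV[int]_l) : cf m a (cf b.1 b.2 v *: ket b.1 b.2)
    = if b == (m, a) then cf m a v else 0.
  case: b => m' a'; rewrite cfZ cf_ket -pair_eqE /= [m' == _]eq_sym [a' == _]eq_sym.
  by case: eqP => [->|_]; case: eqP => [->|_]; rewrite ?mulr1 ?mulr0.
have [v0|v0] := eqVneq (cf m a v) 0.
  by rewrite v0 big1// => b _; rewrite E v0 if_same.
have ms : (m, a) \in s' by rewrite mem_undup hs// (hv _ _ v0).
rewrite (bigD1_seq (m, a))//=; last exact: undup_uniq.
rewrite cfZ cf_ket !eqxx mulr1 big1 ?addr0// => b bm.
by rewrite E (negbTE bm).
Qed.

(** Evenness of the lattice makes (a,a)/2 an integer, so only (h,a) can leave the integers. *)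
Lemma weight_half_norm m a : exists z : int,
  ip L a a = z * 2%:R /\ weight m a = (msize m)%:R + z%:~R - ipF L h (lat a).
Proof.
have /dvdzP[z hz] := gram_even L a; exists z; split; first exact: hz.
rewrite /weight [ip L a a]hz intrM [2%:R^-1 * _]mulrC mulfK// pnatr_eq0//.
Qed.

(** The hypothesis [k 1] places the integral part of the weight in k. For l > 0 it is forced, since
    b_i(-1)1 has weight 1. *)
Lemma weight_in_subgroup (k : set K) m a : additive_subgroup k -> k 1 ->
  k (ipF L h (lat a)) -> k (weight m a).
Proof.
move=> sk k1 kh; have [k0 kB] := sk.
have kz (z : int) : k z%:~R by rewrite -[_%:~R]mul1r; exact: additive_subgroup_mulz.
have kD x y : k x -> k y -> k (x + y).
  by move=> kx ky; rewrite -[y]opprK -[- y]sub0r; apply: (kB _ _) => //; exact: kB.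
have [z [_ ->]] := weight_half_norm m a; apply: (kB _ _) => //; apply: kD; last exact: kz.
exact: (kz (msize m)).
Qed.

Lemma ipF_lat_expansion a : ipF L h (lat a) = \sum_i ipF L h (ebas i) * (a ord0 i)%:~R.
Proof.
rewrite [X in ipF L h X](bas_expansion (lat a)) ipF_sumr; apply: eq_bigr => i _.
by rewrite ipFZr mulrC /latF mxE.
Qed.

End Weights.

Section Grading.
Context {l : nat} {L : even_lattice l} {R : realType}.
Local Notation C := R[i].
Context {V : lmodType C}.
Variable S : fock_space L V.
Variable eps : 'rV[int]_l -> 'rV[int]_l -> int.
Hypothesis heps : lattice_cocycle L eps.
Variable h : 'rV[C]_l.
Local Notation mono := (@monomial l).
Local Notation ket := (ket S).
Local Notation lat := (latF C).
Local Notation Y := (Y S eps).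
Local Notation vac := (ket mset0 (0 : 'rV[int]_l)).
Local Notation omega := (omegah S h).
Local Notation wt := (@weight l L C h).
Implicit Types (u v w : V) (m : mono) (a : 'rV[int]_l).

Lemma Re_int (z : int) : complex.Re (z%:~R : C) = z%:~R.
Proof. by have := rmorph_int (real_complex R) z => /(congr1 (@complex.Re R)) /= <-. Qed.

Lemma Im_int (z : int) : complex.Im (z%:~R : C) = 0.
Proof. by have := rmorph_int (real_complex R) z => /(congr1 (@complex.Im R)) /= <-. Qed.

Lemma ReImM_int (c : C) (z : int) :
  complex.Re (c * z%:~R) = complex.Re c * z%:~R /\ complex.Im (c * z%:~R) = complex.Im c * z%:~R.
Proof.
have := Re_int z; have := Im_int z; case: c => x y; case: (z%:~R : C) => p q /= -> ->.
by rewrite !mulr0 subr0 add0r.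
Qed.

Lemma ReImB (x y : C) : complex.Re (x - y) = complex.Re x - complex.Re y
  /\ complex.Im (x - y) = complex.Im x - complex.Im y.
Proof. by case: x => a b; case: y => c d. Qed.

Lemma ReImD (x y : C) : complex.Re (x + y) = complex.Re x + complex.Re y
  /\ complex.Im (x + y) = complex.Im x + complex.Im y.
Proof. by case: x => a b; case: y => c d. Qed.

Lemma ReIm_sum n (f : 'I_n -> C) : complex.Re (\sum_i f i) = \sum_i complex.Re (f i)
  /\ complex.Im (\sum_i f i) = \sum_i complex.Im (f i).
Proof.
elim: n f => [|n IH] f; first by rewrite !big_ord0.
by rewrite !big_ord_recl; have [<- <-] := IH (fun i => f (lift ord0 i)); exact: ReImD.
Qed.

(** Gives both finiteness conditions: finite-dimensional weight spaces, and Re(r) >= |Im(r)| up to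
    finitely many weights. *)
Lemma weight_bound (T : R) : exists s : seq (mono * 'rV[int]_l), forall m a,
  complex.Re (wt m a) - `|complex.Im (wt m a)| < T -> (m, a) \in s.
Proof.
pose c i : C := ipF L h (ebas i).
have hE a := ipF_lat_expansion (L := L) h a.
(* Chosen so that Re(h,a) + |Im(h,a)| <= M \sum_i |a_i|. *)
pose M : R := \sum_i (`|complex.Re (c i)| + `|complex.Im (c i)|).
have M0 : 0 <= M by apply: sumr_ge0 => i _; apply: addr_ge0.
pose q a : R := (ip L a a)%:~R / 2%:R - M * \sum_i `|a ord0 i|%N%:R.
have wq m a : (msize m)%:R + q a <= complex.Re (wt m a) - `|complex.Im (wt m a)|.
  have [z [zz wE]] := weight_half_norm (L := L) h m a.
  have z2' : (ip L a a)%:~R / 2%:R = z%:~R :> R.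
    by rewrite zz intrM mulfK// pnatr_eq0.
  have rE : complex.Re (wt m a)
      = (msize m)%:R + z%:~R - \sum_i complex.Re (c i) * (a ord0 i)%:~R.
    rewrite wE hE (proj1 (ReImB _ _)) (proj1 (ReImD _ _)) Re_int (Re_int (msize m)).
    rewrite (proj1 (ReIm_sum _)); congr (_ - _).
    by apply: eq_bigr => i _; exact: (proj1 (ReImM_int _ _)).
  have iE : complex.Im (wt m a) = - \sum_i complex.Im (c i) * (a ord0 i)%:~R.
    rewrite wE hE (proj2 (ReImB _ _)) (proj2 (ReImD _ _)) Im_int (Im_int (msize m)).
    rewrite add0r sub0r (proj2 (ReIm_sum _)); congr (- _).
    by apply: eq_bigr => i _; exact: (proj2 (ReImM_int _ _)).
  have b : \sum_i complex.Re (c i) * (a ord0 i)%:~R + `|\sum_i complex.Im (c i) * (a ord0 i)%:~R|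
      <= M * \sum_i `|a ord0 i|%N%:R.
    apply: (@le_trans _ _ (\sum_i (`|complex.Re (c i)| + `|complex.Im (c i)|) * `|a ord0 i|%N%:R)).
      under [leRHS]eq_bigr do rewrite mulrDl.
      rewrite big_split /=; apply: lerD.
        apply: ler_sum => i _; apply: le_trans (ler_norm _) _.
        by rewrite normrM -intr_norm -abszE -pmulrn.
      apply: le_trans (ler_norm_sum _ _ _) _; apply: ler_sum => i _.
      by rewrite normrM -intr_norm -abszE -pmulrn.
    rewrite mulr_sumr; apply: ler_sum => i _; rewrite ler_wpM2r//.
    by rewrite /M (bigD1 i)//= lerDl; apply: sumr_ge0 => j _; apply: addr_ge0.
  rewrite rE iE normrN /q z2'; lra.
have [B hB] := coercive L T M0.
have [sa hsa] := box_finite (l := l) B.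
(* Inside the box \sum_i |a_i| <= l B and (a,a) >= 0, so |m| is at most X. *)
pose X : R := T + M * (l%:R * B%:R).
have [sm hsm] := msize_finite (l := l) (Num.truncn X).
exists [seq (m, a) | m <- sm, a <- sa] => m a hT.
have qT : (msize m)%:R + q a < T by apply: le_lt_trans hT.
have aB i : (`|a ord0 i| <= B)%N.
  rewrite leqNgt; apply/negP => Bi.
  have := hB a (ex_intro _ i Bi); rewrite -/(q a) => Tq.
  by have : 0 <= (msize m)%:R :> R by []; lra.
apply: allpairs_f; last exact: hsa.
apply: hsm; suff mX : (msize m)%:R <= X by rewrite truncn_ge_nat// (le_trans _ mX).
have : M * \sum_i `|a ord0 i|%N%:R <= M * (l%:R * B%:R).
  rewrite ler_wpM2l// -[l in l%:R]card_ord mulrC mulr_natr -sumr_const.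
  by apply: ler_sum => j _; rewrite ler_nat.
have : 0 <= (ip L a a)%:~R / 2%:R :> R by rewrite divr_ge0// ler0z ip_ge0.
by move: qT; rewrite /q /X; lra.
Qed.

Lemma omegah_graded_voa : graded_voa Y vac omega (l%:R - 12%:R * ipF L h h).
Proof.
split.
- split=> [v n|n w]; first exact: linear_Y.
  exact: linear_Yl.
- split=> [v|s f us Wf]; last exact: (L0_independent heps us Wf).
  have [s [_ vs]] := wproj_sum S h v; exists s, (fun r => wproj S h r v).
  by split=> // r; exact: (L0_wproj S heps h r v).
- by move=> u v; have [_ /(_ v)] := isfield_Y S eps u.
- split=> [r|].
    (* The added 1 makes the strict bound hold for vectors of weight exactly r. *)
    have [s hs] := weight_bound (complex.Re r - `|complex.Im r| + 1).
    apply: (@L0_eigenspace_basis _ _ _ _ S eps heps h r s) => m a wr.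
    by apply: hs; rewrite -/(weight _ _ _) wr ltrDl ltr01.
  have [s hs] := weight_bound 0; exists [seq wt b.1 b.2 | b <- s] => r rs.
  move=> [v Lv v0]; have [m [a wr]] := L0_eigenvalue heps Lv v0.
  rewrite leNgt; apply/negP => hlt; move/negP: rs; apply; apply/mapP.
  by exists (m, a) => //; apply: hs; rewrite -wr in hlt; rewrite subr_lt0.
- move=> u v; have [N hN] := local_Y S heps u v; exists N => p q w.
  by have := hN w p q; rewrite iterD2_binomial.
- exact: Y_creation.
- by move=> m n w; exact: (Lh_virasoro S heps h m n w).
- by move=> v n w; exact: (Lh_translation S heps h v n w).
Qed.

Lemma omegah_k_graded_voa (k : set C) : additive_subgroup k -> k 1 ->
    (forall a, k (ipF L h (lat a))) ->
  k_graded_voa k Y vac omega (l%:R - 12%:R * ipF L h h).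
Proof.
move=> sk k1 kh; split; first exact: omegah_graded_voa.
move=> r [v Lv v0]; have [m [a <-]] := L0_eigenvalue heps Lv v0.
exact: weight_in_subgroup.
Qed.

End Grading.

(** * The lattice vertex operator algebra *)

Section MalgFock.
Context {l : nat} (L : even_lattice l) {R : realType}.
Local Notation C := R[i].
Local Notation V := (@V_ l R).
Local Notation fock := (@fock_basis l).
Local Notation mono := (@monomial l).
Implicit Types (u v w : V) (m : mono) (a : 'rV[int]_l).

Definition mket : mono -> 'rV[int]_l -> V := locked (@Defs.ket l R).
Definition mcf : mono -> 'rV[int]_l -> V -> C :=
  locked (fun m a (v : V) => mcoeff ((m, a) : fock) (v : {malg C[fock]})).
Definition mlext : (mono -> 'rV[int]_l -> V) -> V -> V :=
  locked (fun f => lin_ext (fun b => f b.1 b.2)).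
Definition mheis : 'rV[C]_l -> int -> V -> V := locked (@Defs.heis l L R).

Lemma mketE : @Defs.ket l R = mket.
Proof. by rewrite /mket -lock. Qed.
Lemma mcfE (b : fock) v : mcf b.1 b.2 v = mcoeff b (v : {malg C[fock]}).
Proof. by rewrite /mcf -lock; case: b. Qed.
Lemma mheisE : @Defs.heis l L R = mheis.
Proof. by rewrite /mheis -lock. Qed.

Lemma mcf_linear m a c u v : mcf m a (c *: u + v) = c * mcf m a u + mcf m a v.
Proof.
have E := mcfE (m, a); rewrite (E (c *: u + v)) (E u) (E v).
by rewrite -mcoeffZ; exact: mcoeffD.
Qed.

Lemma mcf_ext u v : (forall m a, mcf m a u = mcf m a v) -> u = v.
Proof. by move=> uv; apply/malgP => b; rewrite -!mcfE; exact: uv. Qed.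

Lemma mcf_ket m a m' a' : mcf m a (mket m' a') = ((m == m') && (a == a'))%:R.
Proof.
rewrite (mcfE (m, a)) -mketE /Defs.ket mcoeffU eq_sym.
by rewrite -pair_eqE.
Qed.

Lemma mcf0 m a : mcf m a 0 = 0.
Proof. by rewrite (mcfE (m, a)); exact: mcoeff0. Qed.

Lemma mcf_outside (b : fock) v :
  b \notin msupp (v : {malg C[fock]}) -> mcf b.1 b.2 v = 0.
Proof. by rewrite mcfE; exact: mcoeff_outdom. Qed.

Lemma mcf_sum m a (s : seq fock) (c : fock -> C) (f : fock -> V) :
  mcf m a (\sum_(b <- s) c b *: f b) = \sum_(b <- s) c b * mcf m a (f b).
Proof.
elim: s => [|b s IH]; first by rewrite !big_nil mcf0.
by rewrite !big_cons mcf_linear IH.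
Qed.

Lemma fock_eqE (b b0 : fock) : (b == b0) = (b0.1 == b.1) && (b0.2 == b.2).
Proof. by rewrite [b == b0]eq_sym; case: b0 => ? ?; case: b => ? ?; rewrite xpair_eqE. Qed.

Lemma mcf_ket_sum (s : seq fock) (c : fock -> C) (b0 : fock) : uniq s ->
  mcf b0.1 b0.2 (\sum_(b <- s) c b *: mket b.1 b.2) = if b0 \in s then c b0 else 0.
Proof.
move=> us; rewrite mcf_sum.
have E b : c b * mcf b0.1 b0.2 (mket b.1 b.2) = if b == b0 then c b0 else 0.
  have -> : mcf b0.1 b0.2 (mket b.1 b.2) = (b == b0)%:R.
    by rewrite mcf_ket -fock_eqE.
  case: eqP => [->|_]; first exact: mulr1.
  exact: mulr0.
rewrite (eq_bigr _ (fun b _ => E b)) -big_mkcond /=.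
case: ifP => h0; last first.
  rewrite big1_seq// => b /andP[/eqP -> hb]; by rewrite hb in h0.
by rewrite -big_filter filter_pred1_uniq// big_seq1.
Qed.

Lemma mket_expansion v :
  v = \sum_(b <- msupp (v : {malg C[fock]})) mcf b.1 b.2 v *: mket b.1 b.2.
Proof.
apply: mcf_ext => m a; rewrite (mcf_ket_sum (fun b => mcf b.1 b.2 v) (m, a) (fset_uniq _)).
by case: ifP => // /negbT /mcf_outside.
Qed.

(** The support is removed one basis vector at a time; its list has no repetition, hence the zero
    coordinate. *)
Lemma mket_ind (P : V -> Prop) : P 0 ->
  (forall c m a v, mcf m a v = 0 -> P v -> P (c *: mket m a + v)) -> forall v, P v.
Proof.
move=> P0 PS v; rewrite (mket_expansion v).
elim: (msupp (v : {malg C[fock]}) : seq fock) (fset_uniq (msupp (v : {malg C[fock]}))) => [|b s IH].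
  by rewrite big_nil.
rewrite cons_uniq big_cons => /andP[bs us]; apply: PS; last exact: IH.
by rewrite (mcf_ket_sum (fun b => mcf b.1 b.2 v) b us) (negbTE bs).
Qed.

Lemma lin_ext_fset (f : fock -> V) (D : {fset fock}) v :
  (msupp (v : {malg C[fock]}) `<=` D)%fset ->
  lin_ext f v = \sum_(b <- D) mcf b.1 b.2 v *: f b.
Proof.
move=> vD; rewrite /lin_ext (big_fset_incl _ vD) => [|b _ hb].
  by apply: eq_bigr => b _; rewrite mcfE.
by rewrite -mcfE mcf_outside// scale0r.
Qed.

(** The three supports differ, so all sums are first extended to the union of those of u and v. *)
Lemma linear_lin_ext (f : fock -> V) : linear (lin_ext f).
Proof.
move=> c u v.
pose D : {fset fock} := (msupp (u : {malg C[fock]}) `|` msupp (v : {malg C[fock]}))%fset.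
rewrite (@lin_ext_fset _ D u) ?fsubsetUl// (@lin_ext_fset _ D v) ?fsubsetUr//.
rewrite (@lin_ext_fset _ D); last first.
  by apply: fsubset_trans (msuppD_le _ _) _; apply: fsetSU; apply: msuppZ_le.
rewrite scaler_sumr -big_split; apply: eq_bigr => b _.
by rewrite mcf_linear scalerDl scalerA.
Qed.

Lemma lin_ext_ket (f : fock -> V) m a : lin_ext f (mket m a) = f (m, a).
Proof.
have vD : (msupp (Defs.ket R m a : {malg C[fock]}) `<=` [fset ((m, a) : fock)])%fset.
  exact: msuppU_le.
rewrite -mketE (lin_ext_fset _ vD) mketE big_seq_fset1 /fst /snd mcf_ket.
by rewrite !eqxx scale1r.
Qed.

Lemma linear_mlext f : linear (mlext f).
Proof. by rewrite /mlext -lock; exact: linear_lin_ext. Qed.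

Lemma mlext_ket f m a : mlext f (mket m a) = f m a.
Proof. by rewrite /mlext -lock; exact: lin_ext_ket. Qed.

Lemma linear_mheis h n : linear (mheis h n).
Proof. by rewrite /mheis -lock; exact: linear_lin_ext. Qed.

Lemma mheis_neg_ket h k m a :
  mheis h (Negz k) (mket m a) = \sum_j h 0 j *: mket (madd (j, k) m) a.
Proof.
rewrite /mheis -lock /Defs.heis lin_ext_ket mketE.
by apply: eq_bigr => j _; rewrite madd_unlock.
Qed.

Lemma mheis_zero_ket h m a : mheis h 0 (mket m a) = ipF L h (latF C a) *: mket m a.
Proof. by rewrite /mheis -lock /Defs.heis lin_ext_ket mketE. Qed.

Lemma mheis_pos_ket h k m a : mheis h k.+1 (mket m a) =
  \sum_j (k.+1%:R * ipF L h (ebas j) * (m (j, k))%:R) *: mket (mdel (j, k) m) a.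
Proof.
rewrite /mheis -lock /Defs.heis lin_ext_ket mketE.
by apply: eq_bigr => j _; rewrite mdel_unlock.
Qed.

Definition malg_fock : fock_space L V :=
  FockSpace mcf_linear mcf_ext mcf_ket mket_ind linear_mlext mlext_ket linear_mheis
    mheis_neg_ket mheis_zero_ket mheis_pos_ket.

End MalgFock.

(** * Comparison with the defining formulas *)

Section FiniteSupportSums.
Context {K : numFieldType} {V : lmodType K}.

Lemma fsum_neg (F : int -> V) :
  \sum_(j \in [set j : int | j < 0]) F j = Sum (fun j : nat => F (- 1 - j%:Z)).
Proof.
apply: (@reindex_fsbig _ _ _ _ _ (fun j : nat => - 1 - j%:Z : int) [set: nat]).
split=> [j _ /=|i j _ _ /= e|j /= j0]; [lia|lia|].
by exists (absz (- 1 - j)%R) => //; lia.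
Qed.

Lemma fsum_nneg (F : int -> V) :
  \sum_(j \in [set j : int | 0 <= j]) F j = Sum (fun j : nat => F j%:Z).
Proof.
apply: (@reindex_fsbig _ _ _ _ _ (fun j : nat => j%:Z : int) [set: nat]).
split=> [j _ /=|i j _ _ /= e|j /= j0]; [lia|lia|].
by exists (absz j) => //; lia.
Qed.

(** A pair is determined by q, with p = q + t; the match discards the q for which this is
    negative. *)
Lemma fsum_pairs (t : int) (F : nat -> nat -> V) :
  \sum_(pq \in [set pq : nat * nat | pq.1%:Z - pq.2%:Z = t]) F pq.1 pq.2
  = Sum (fun q => if q%:Z + t is Posz p then F p q else 0).
Proof.
pose P : set nat := [set q | 0 <= q%:Z + t].
pose f (q : nat) : V := if q%:Z + t is Posz p then F p q else 0.
rewrite (@reindex_fsbig _ _ _ _ _ (fun q : nat => (absz (q%:Z + t)%R, q)) P); last first.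
  split=> [q /= q0|i j _ _ [_ ->]//|[p q] /= e]; first by rewrite /P /= in q0; lia.
  by exists q; rewrite /P /=; [lia|congr (_, _); lia].
transitivity (\sum_(q \in P) f q).
  apply: eq_fsbigr => q; rewrite inE /P /f /=.
  by case: (q%:Z + t).
apply: fsbig_widen => // q [_] /=; rewrite /P /f /=.
by case: (q%:Z + t).
Qed.

Lemma normal_productE (A B : int -> V -> V) n w :
  \sum_(j \in [set j : int | j < 0]) A j (B (n - j - 1) w)
  + \sum_(j \in [set j : int | 0 <= j]) B (n - j - 1) (A j w) = nprod A B n w.
Proof.
rewrite fsum_neg fsum_nneg /nprod /Lp /Rp; congr (_ + _); apply: eq_Sum => j.
  by congr (A _ (B _ _)); lia.
by congr (B _ _); lia.
Qed.

End FiniteSupportSums.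

Section Comparison.
Context {l : nat} (L : even_lattice l) {R : realType}.
Local Notation C := R[i].
Local Notation V := (@V_ l R).
Local Notation fock := (@fock_basis l).
Local Notation mono := (@monomial l).
Local Notation S := (malg_fock L (R := R)).
Variable eps : 'rV[int]_l -> 'rV[int]_l -> int.
Hypothesis heps : lattice_cocycle L eps.
Implicit Types (u v w : V) (m : mono) (a b : 'rV[int]_l).

Lemma exp_coefE (A : nat -> V -> V) : exp_coef A = expc A.
Proof. reflexivity. Qed.

Lemma exp_minusE a p : @exp_minus l L R a p = em S a p.
Proof. by rewrite /exp_minus mheisE exp_coefE. Qed.

Lemma exp_plusE a p : @exp_plus l L R a p = ep S a p.
Proof. by rewrite /exp_plus mheisE exp_coefE. Qed.

Lemma ddfieldE k (F : @field l R) : ddfield k F = ddf k F.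
Proof. reflexivity. Qed.

Lemma normal_product_nprod (A B : @field l R) : normal_product A B = nprod A B.
Proof. by apply/funext => n; apply/funext => w; exact: normal_productE. Qed.

Lemma ket_malg m a : ket S m a = mket m a.
Proof. by []. Qed.

Lemma vertex_expE a : vertex_exp L eps a = vex S eps a :> @field l R.
Proof.
apply/funext => n; apply/funext => v; move: v; apply: (linear_ket_ext (S := S)).
- exact: linear_lin_ext.
- exact: linear_vex.
move=> m b; rewrite vex_ket /vop shift_ket.
rewrite /vertex_exp [X in lin_ext _ X]ket_malg lin_ext_ket mketE -[mket m _]ket_malg.
apply: (congr1 (fun u => _ *: u)).
pose u := ket S m (a + b); pose t : int := - ip L a b - n - 1.
transitivity (\sum_(pq \in [set pq : nat * nat | pq.1%:Z - pq.2%:Z = t])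
    em S a pq.1 (ep S a pq.2 u)).
  rewrite (_ : [set pq : nat * nat | _ = - n - 1] = [set pq | pq.1%:Z - pq.2%:Z = t]).
    by apply: eq_fsbigr => pq _; rewrite exp_plusE exp_minusE.
  by apply/seteqP; split=> pq /=; rewrite /t; lia.
rewrite (fsum_pairs t (fun p q => em S a p (ep S a q u))); apply: eq_Sum => q.
by rewrite /emz (_ : q%:Z + t = q%:Z - ip L a b - n - 1)//; rewrite /t; lia.
Qed.

Lemma Y_basisE m a : @Y_basis l L R eps (m, a) = Yb S eps m a.
Proof.
rewrite /Y_basis /Yb vertex_expE; elim: (enum_mset m : seq _) => [//|x s /= ->].
rewrite normal_product_nprod ddfieldE mheisE.
by [].
Qed.

Lemma Y_LE : @Y_L l L R eps = Y S eps.
Proof.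
apply/funext => v; apply/funext => n; apply/funext => w.
transitivity (lin_ext (fun x : fock => Y_basis L eps x n w) v); first by [].
move: v; apply: (linear_ket_ext (S := S)).
- exact: linear_lin_ext.
- exact: linear_Yl.
by move=> m a; rewrite Y_ket [X in lin_ext _ X]ket_malg lin_ext_ket Y_basisE.
Qed.

Lemma vac_LE : @vac_L l R = ket S mset0 0.
Proof. by rewrite /vac_L mketE. Qed.

Lemma omega_hE h : @omega_h l L R h = omegah S h.
Proof. by rewrite /omega_h /omega_L vac_LE mheisE. Qed.

Lemma ipF_complexify (f : 'rV[R]_l) a :
  ipF L (complexify f) (latF C a) = real_complex R (ipF L f (latF R a)).
Proof.
have iE (z : int) : real_complex R z%:~R = z%:~R by exact: rmorph_int.
have lE : latF C a = map_mx (real_complex R) (latF R a).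
  by apply/rowP => i; rewrite !mxE iE.
have gE : gramF L C = map_mx (real_complex R) (gramF L R).
  by apply/matrixP => i j; rewrite !mxE iE.
by rewrite /ipF /complexify lE gE map_trmx -!map_mxM mxE.
Qed.

End Comparison.

(** Each summand of h pairs with a to an element of k times an integer, by duality. *)
Lemma H_k_pairing (l : nat) (L : even_lattice l) (R : realType) (k : set R[i])
    (h : 'rV[R[i]]_l) (a : 'rV[int]_l) :
  additive_subgroup k -> H_k L k h -> k (ipF L h (latF R[i] a)).
Proof.
move=> sk [n [c [f [kf ->]]]]; rewrite ipF_suml.
have [k0 kB] := sk; elim: n c f kf => [|n IH] c f kf; first by rewrite big_ord0.
rewrite big_ord_recr ipFZl ipF_complexify.
have [kc /(_ a)[z ->]] := kf ord_max.
have -> : real_complex R z%:~R = z%:~R by exact: rmorph_int.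
rewrite -[X in k (_ + X)]opprK; apply: (kB _ _); first exact: (IH (fun j => c (widen_ord (leqnSn n) j))).
by rewrite -sub0r; apply: kB => //; exact: additive_subgroup_mulz.
Qed.

Lemma additive_subgroup_int (F : nzRingType) :
  additive_subgroup (range (fun z : int => z%:~R : F)).
Proof.
split=> [|_ _ [x _ <-] [y _ <-]]; first by exists 0.
by exists (x - y) => //; rewrite intrB.
Qed.

Theorem theorem3p1 (R : realType) (l : nat) (L : even_lattice l)
    (eps : 'rV[int]_l -> 'rV[int]_l -> int) (heps : lattice_cocycle L eps)
    (h : 'rV[R[i]]_l) :
  [/\ graded_voa (Y_L L eps) (vac_L R) (omega_h L h)
        (l%:R - 12%:R * ipF L h h),
      (forall k : set R[i], additive_subgroup k -> k 1 -> H_k L k h ->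
         k_graded_voa k (Y_L L eps) (vac_L R) (omega_h L h)
           (l%:R - 12%:R * ipF L h h))
    & (forall f : 'rV[R]_l, dual_lattice L f -> h = complexify f ->
         voa (Y_L L eps) (vac_L R) (omega_h L h)
           (l%:R - 12%:R * ipF L h h))].
Proof.
rewrite Y_LE (vac_LE L) omega_hE; split=> [|k sk k1 hk|f Lf hf].
- exact: omegah_graded_voa.
- by apply: omegah_k_graded_voa => // a; exact: H_k_pairing hk.
- apply: omegah_k_graded_voa => //; first exact: additive_subgroup_int.
  + by exists 1.
  + move=> a; rewrite hf ipF_complexify; have [z ->] := Lf a.
    by exists z => //; rewrite rmorph_int.
Qed.
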